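(* For all $\rho\in\mathbb{N}=\{1,2,\dots\}$, there exists a unique constant $\alpha_c(\rho)$ with the following properties (for $\alpha\in(0,\infty)$). (Fast mixing.) Suppose $\alpha<\alpha_c(\rho)$ or $\alpha>1$. There exists a constant $C$ so that, for all $\varepsilon\in(0,1)$ and all $K$ and $n$ sufficiently large, $t_{\mathrm{mix}}(\varepsilon;\alpha,K,n;\rho)\le C\log n$. (Slow mixing.) Suppose $\alpha_c(\rho)<\alpha<1$. There exists a positive constant $c$ so that, for all $\varepsilon\in(0,\tfrac12)$ and all $K$ and $n$ sufficiently large, $t_{\mathrm{mix}}(\varepsilon;\alpha,K,n;\rho)\ge e^{cn}$. Further, the map $\rho\mapsto\alpha_c(\rho):\mathbb{N}\to\mathbb{R}$ is strictly decreasing and satisfies $\alpha_c(\rho)\in(0,1)$ for all $\rho\in\mathbb{N}$.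
   Context: Let $K,n,\rho\ge 1$ be integers, $\alpha>0$, $\Omega:=\{0,1,\dots,K\}^n$, and for $x\in\Omega$ let $\varphi(x):=\tfrac1n|\{j\in[n]: x_j=K\}|$. For $f\in[0,1)$ let $$r_\rho(f):=\frac{2f\bigl(1-(1-(1-f)^2)^\rho\bigr)}{1-f},\qquad \beta_\rho(f):=\alpha(1+r_\rho(f)).$$ $\mathrm{DAR}_n^\rho(\alpha,K)$ (dynamic alternative routing with $\rho$ rerouting attempts) denotes the continuous-time Markov chain $X=(X^t)_{t\ge0}$ on $\Omega$ with the following transitions from state $x$: for each $j$ with $x_j<K$, $x_j\to x_j+1$ at rate $\beta_\rho(\varphi(x))K$; for each $j$, $x_j\to x_j-1$ at rate $x_j$; no other transitions. $\Pi$ denotes its invariant distribution, and $$t_{\mathrm{mix}}(\varepsilon;\alpha,K,n;\rho):=\inf\bigl\{t\ge0:\max_{x\in\Omega}\|\mathbb{P}_x(X^t\in\cdot)-\Pi\|_{\mathrm{TV}}\le\varepsilon\bigr\}.$$ The constants $C,c$ may depend on $\alpha,\rho$ but not on $\varepsilon,K,n$. ''For all $K$ and $n$ sufficiently large'' means: there is $K_0$ such that for every $K\ge K_0$ there is $n_0$ (possibly depending on $K$) such that the assertion holds for all $n\ge n_0$; $K_0,n_0$ may depend on the parameters quantified before this phrase. *)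

(* Defs.v *)
From HB Require Import structures.
From mathcomp Require Import all_boot all_order all_algebra.
From mathcomp Require Import all_classical all_reals all_analysis.

Set Implicit Arguments.
Unset Strict Implicit.
Unset Printing Implicit Defensive.

Import Order.TTheory GRing.Theory Num.Theory.
Import numFieldNormedType.Exports.

Local Open Scope classical_set_scope.
Local Open Scope ring_scope.

(* Continuous-time Markov chains on a finite set [T], given by their jump     *)
(* rates [q x y] (x <> y).                                                    *)
Section FiniteMarkovChain.
Variables (R : realType) (T : finType).
Implicit Types (q : T -> T -> R) (mu nu : T -> R) (t eps : R).

(* The diagonal values [q x x] cancel out in the diagonal entries. *)
Definition generator q : 'M[R]_#|T| :=
  \matrix_(i, j) (q (enum_val i) (enum_val j)
                  - (i == j)%:R * \sum_(z : T) q (enum_val i) z).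

(* P_x(X^t = y), as the (x, y) entry of the matrix exponential
   exp(t Q) = \sum_k (t^k / k!) Q^k of the generator Q, the limit being taken
   entrywise. *)
Definition transition q t (x y : T) : R :=
  limn (series (fun k : nat =>
    exp_coeff t k * (generator q ^+ k) (enum_rank x) (enum_rank y))).

Definition is_distribution mu : Prop :=
  (forall x, 0 <= mu x) /\ \sum_(x : T) mu x = 1.

Definition is_invariant q mu : Prop :=
  is_distribution mu /\
  forall t y, 0 <= t -> \sum_(x : T) mu x * transition q t x y = mu y.

(* Total, by choice; meaningful when there is exactly one invariant
   distribution, as is the case for irreducible rates. *)
Definition invariant_distribution q : T -> R :=
  xget (fun=> 0) [set mu | is_invariant q mu].

Definition tv_dist mu nu : R :=
  \big[Num.max/0]_(A : {set T})
    `| \sum_(x in A) mu x - \sum_(x in A) nu x |.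

(* Extended-real valued, so that the infimum of the empty set is +oo. *)
Definition mixing_time q eps : \bar R :=
  ereal_inf [set t%:E | t in [set t : R | 0 <= t /\
    \big[Num.max/0]_(x : T)
      tv_dist (transition q t x) (invariant_distribution q) <= eps]].

End FiniteMarkovChain.

Section DynamicAlternativeRouting.
Variables (R : realType) (rho : nat) (alpha : R).

Definition reroute (f : R) : R :=
  2 * f * (1 - (1 - (1 - f) ^+ 2) ^+ rho) / (1 - f).

Definition arrival (f : R) : R := alpha * (1 + reroute f).

Definition full_fraction (K n : nat) (x : {ffun 'I_n -> 'I_K.+1}) : R :=
  #|[pred j | x j == K :> nat]|%:R / n%:R.

(* If [x <> y], at most one index [j] satisfies the condition of the sum,
   namely the only coordinate in which [x] and [y] differ.  When all
   coordinates equal [K], no upward jump exists, so that the division by zero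
   in [reroute 1] is harmless. *)
Definition dar_rate (K n : nat) (x y : {ffun 'I_n -> 'I_K.+1}) : R :=
  \sum_(j < n | [forall i, (i != j) ==> (y i == x i)])
    (if (y j == (x j).+1 :> nat) then arrival (full_fraction x) * K%:R
     else if (x j == (y j).+1 :> nat) then (x j)%:R
     else 0).

Definition dar_tmix (eps : R) (K n : nat) : \bar R :=
  mixing_time (@dar_rate K n) eps.

(* The nested filters express that there is K0 such that, for every K >= K0,
   there is n0, possibly depending on K, with the bound for all n >= n0. *)
Definition fast_mixing : Prop :=
  exists C : R, forall eps : R, 0 < eps < 1 ->
    \forall K \near \oo, \forall n \near \oo,
      (dar_tmix eps K n <= (C * ln n%:R)%:E)%E.

Definition slow_mixing : Prop :=
  exists2 c : R, 0 < c & forall eps : R, 0 < eps < 2^-1 ->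
    \forall K \near \oo, \forall n \near \oo,
      ((expR (c * n%:R))%:E <= dar_tmix eps K n)%E.

End DynamicAlternativeRouting.

Definition is_critical (R : realType) (rho : nat) (ac : R) : Prop :=
  (forall alpha : R, 0 < alpha -> alpha < ac \/ 1 < alpha ->
     fast_mixing rho alpha) /\
  (forall alpha : R, 0 < alpha -> ac < alpha < 1 ->
     slow_mixing rho alpha).

(* Main.v *)
(** As K grows, a link with arrival rate bK is full for a fraction of about
    max(0, 1 - 1/b) of the time. When a fraction f of the links is full, every
    link sees the rate alpha * gain f * K, so a level f > 0 is self-consistent
    iff alpha * throughput f = 1, where throughput f = (1 - f) * gain f. Hence
    alpha_c = 1 / max throughput, and it decreases with rho because throughput
    increases strictly with rho on (0, 1).

    Fast mixing: under the coupling that moves the same coordinates of both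
    copies, a sum of coordinatewise distances contracts at a constant rate as
    long as both copies lie in a good region. A Lyapunov function u with
    increments at most 1/n drives the chain into that region, and multiplying
    the distance by 2 + exp(A(u(x) - u1)) + exp(A(u(x') - u1)) extends the
    contraction to all pairs. If alpha < alpha_c, the good region has few links
    near capacity, u is the mean of tau^(K - x_j), and the coordinatewise
    distance gives a large weight to the circuits near capacity. If alpha > 1,
    the distance is the l1 distance and u is a smoothed l1 distance from the
    empirical tail distribution to that of the Erlang law at a
    self-consistent level.

    Slow mixing: if alpha < 1 < alpha * throughput f0, both {f < d} and
    {l < f < c} are traps. Replace the arrival rate by one that agrees with it
    in the trap and stays between two constants outside. The stationary law of
    the modified chain is dominated by products of Erlang laws, so it gives the
    complement of the trap a mass exponentially small in n. Started from that
    law, the two chains agree until they leave the trap, which takes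
    exponentially long; two disjoint traps preclude mixing before that. *)

Require Import Defs.
From HB Require Import structures.
From mathcomp Require Import all_boot all_order all_algebra.
From mathcomp Require Import all_classical all_reals all_analysis.
From mathcomp Require Import ring lra zify.

Set Implicit Arguments.
Unset Strict Implicit.
Unset Printing Implicit Defensive.

Import Order.TTheory GRing.Theory Num.Theory.
Import numFieldNormedType.Exports.

Local Open Scope classical_set_scope.
Local Open Scope ring_scope.

(** * Transition semigroup and uniformization *)

(** No process, coupling or stopping time is built on a path space. Laws at time t are Poisson
    mixtures of powers of a one-step kernel, couplings are operators on functions of pairs, and
    exits from a trap are counted by iterating a one-step inequality. The contraction rate must be
    free of K, whereas jump rates are of order K and one more full link changes the arrival rate by
    order K/n, felt by all n links. Above full load the l1 distance survives this because
    [throughput] decreases around the fixed point. Near 0 it increases, so below the critical load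
    that argument is lost: a link full in one copy only must carry a weight W large enough to pay
    for the surplus arrivals, and the weights can climb to W only because arrivals are slower than
    departures near capacity. The constant in front of log n must not see K or eps. The Lyapunov
    weights multiply a distance of order n by a factor that depends on K but not on n, and a time (2
    / kap) ln n leaves order 1/n, so K and eps enter only through the threshold for n. *)

Section ExponentialSeries.
Variable R : realType.
Implicit Types (a b : nat -> R) (u x y : R).

Lemma triangle_sum (F : nat -> nat -> R) N :
  \sum_(0 <= k < N) \sum_(0 <= i < k.+1) F i (k - i)%N =
  \sum_(0 <= i < N) \sum_(0 <= j < N | (i + j < N)%N) F i j.
Proof.
transitivity (\sum_(0 <= k < N) \sum_(0 <= i < N | (i < k.+1)%N) F i (k - i)%N).
  rewrite !big_mkord; apply: eq_bigr => k _.
  by rewrite (big_nat_widen 0 k.+1 N) // ltn_ord.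
rewrite (exchange_big_dep xpredT) //=; apply: eq_big_nat => i /andP[_ iN].
under eq_bigl => k do rewrite ltnS.
rewrite -[LHS]/(\sum_(0 <= k < N | (i <= k)%N) _).
rewrite -(big_nat_widenl i 0 N xpredT) // -{1}[i]add0n big_addn.
under eq_bigr => k _ do rewrite addnK.
rewrite (big_nat_widen 0 (N - i) N) ?leq_subr //.
by apply: eq_bigl => j /=; rewrite ltn_subRL.
Qed.

Lemma exp_coeffD x y k :
  \sum_(0 <= i < k.+1) exp_coeff x i * exp_coeff y (k - i)%N =
  exp_coeff (x + y) k.
Proof.
rewrite /exp_coeff /= addrC exprDn mulr_suml big_mkord; apply: eq_bigr => i _.
have ik : (i <= k)%N by rewrite -ltnS.
have /(congr1 (fun m => m%:R : R)) := bin_fact ik; rewrite !natrM => <-.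
rewrite -mulr_natr.
have i0 : (i`!)%:R != 0 :> R by rewrite pnatr_eq0 -lt0n fact_gt0.
have ki0 : ((k - i)`!)%:R != 0 :> R by rewrite pnatr_eq0 -lt0n fact_gt0.
have C0 : 'C(k, i)%:R != 0 :> R by rewrite pnatr_eq0 -lt0n bin_gt0.
by field; rewrite i0 ki0 C0.
Qed.

(** The defect between the product of the partial sums and the partial Cauchy product runs over
    pairs with [i + j >= N]. It is dominated termwise by the same defect for [exp_coeff u], whose
    limit is [expR u * expR u - expR (u + u) = 0]. *)
Lemma cauchy_product_exp u a b (A B : R) : 0 <= u ->
  (forall i, `|a i| <= exp_coeff u i) -> (forall j, `|b j| <= exp_coeff u j) ->
  series a @ \oo --> A -> series b @ \oo --> B ->
  series (fun k => \sum_(0 <= i < k.+1) a i * b (k - i)%N) @ \oo --> A * B.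
Proof.
move=> u0 ha hb cA cB.
pose e := exp_coeff u.
have ce : series e @ \oo --> expR u by apply: is_cvg_series_exp_coeff.
have ce2 : series (exp_coeff (u + u)) @ \oo --> expR u * expR u.
  by rewrite -expRD; apply: is_cvg_series_exp_coeff.
pose c k := \sum_(0 <= i < k.+1) a i * b (k - i)%N.
have bound N : `|series a N * series b N - series c N| <=
    series e N * series e N - series (exp_coeff (u + u)) N.
  have sqr (f g : nat -> R) : series f N * series g N
     = \sum_(0 <= i < N) \sum_(0 <= j < N) f i * g j.
    rewrite /series /= mulr_suml; apply: eq_bigr => i _.
    by rewrite mulr_sumr.
  rewrite !sqr.
  have -> : series (exp_coeff (u + u)) N =
     \sum_(0 <= k < N) \sum_(0 <= i < k.+1) e i * e (k - i)%N.
    by rewrite /series /=; apply: eq_bigr => k _; rewrite exp_coeffD.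
  rewrite (triangle_sum (fun i j => e i * e j)).
  rewrite [series c N]/series /= /c (triangle_sum (fun i j => a i * b j)).
  have split (f g : nat -> R) : \sum_(0 <= i < N) \sum_(0 <= j < N) f i * g j -
     \sum_(0 <= i < N) \sum_(0 <= j < N | (i + j < N)%N) f i * g j =
     \sum_(0 <= i < N) \sum_(0 <= j < N | ~~ (i + j < N)%N) f i * g j.
    rewrite -sumrB; apply: eq_bigr => i _.
    by rewrite (bigID (fun j => (i + j < N)%N)) /= addrAC subrr add0r.
  rewrite !split; apply: (le_trans (ler_norm_sum _ _ _)).
  apply: ler_sum => i _; apply: (le_trans (ler_norm_sum _ _ _)).
  apply: ler_sum => j _; rewrite normrM; apply: ler_pM => //.
have c0 : series e N * series e N - series (exp_coeff (u + u)) N @[N --> \oo]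
    --> (0 : R).
  rewrite -(subrr (expR u * expR u)).
  by apply: cvgB => //; apply: cvgM.
have d0 : (series a N * series b N - series c N) @[N --> \oo] --> (0 : R).
  apply/norm_cvg0P.
  apply: (squeeze_cvgr _ (cvg_cst 0) c0).
  by apply: nearW => N; rewrite bound normr_ge0.
have : (series a N * series b N - (series a N * series b N - series c N))
    @[N --> \oo] --> A * B - 0.
  by apply: cvgB => //; apply: cvgM.
rewrite subr0; apply: cvg_trans; apply: near_eq_cvg.
by apply: nearW => N; rewrite subKr.
Qed.

End ExponentialSeries.

Section Uniformization.
Variables (R : realType) (T : finType) (q : T -> T -> R) (Lam : R).
Implicit Types (h : T -> R) (x y : T).

Definition drift h x : R := \sum_y q x y * (h y - h x).

(* One step of the discrete-time chain with kernel [1 + generator q / Lam]. *)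
Definition ustep h x : R := h x + Lam^-1 * drift h x.

Hypothesis Lam_gt0 : 0 < Lam.
Hypothesis q_ge0 : forall x y, x != y -> 0 <= q x y.
Hypothesis q_le : forall x, \sum_(y | y != x) q x y <= Lam.

Let A : 'M[R]_#|T| := 1 + Lam^-1 *: generator q.
Let Ak k x y := (A ^+ k) (enum_rank x) (enum_rank y).

Let sum_rank (f : 'I_#|T| -> R) : \sum_i f i = \sum_(y : T) f (enum_rank y).
Proof. by rewrite (reindex enum_rank) //; apply: onW_bij; exact: enum_rank_bij. Qed.

Let generatorE x y : generator q (enum_rank x) (enum_rank y) =
  q x y - (x == y)%:R * \sum_z q x z.
Proof. by rewrite mxE !enum_rankK (inj_eq enum_rank_inj). Qed.

Lemma generator_drift h x :
  \sum_y generator q (enum_rank x) (enum_rank y) * h y = drift h x.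
Proof.
under eq_bigr => y _ do rewrite generatorE mulrBl.
rewrite sumrB /drift; under [RHS]eq_bigr => y _ do rewrite mulrBr.
rewrite sumrB -mulr_suml; congr (_ - _); move: (\sum_z q x z) => c.
rewrite (bigD1 x) //= eqxx mul1r big1 ?addr0 // => y /negPf.
by rewrite eq_sym => ->; rewrite !mul0r.
Qed.

Lemma ustepE h x : ustep h x = \sum_y Ak 1 x y * h y.
Proof.
rewrite /Ak expr1 /A; under eq_bigr => y _ do rewrite mxE [X in _ + X]mxE mulrDl.
rewrite big_split /=; congr (_ + _).
  rewrite (bigD1 x) //= mxE eqxx mul1r big1 ?addr0 // => y /negPf yx.
  by rewrite mxE (inj_eq enum_rank_inj) eq_sym yx mul0r.
rewrite -generator_drift mulr_sumr.
by apply: eq_bigr => y _; rewrite mulrA.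
Qed.

Let Ak0 x y : Ak 0 x y = (x == y)%:R.
Proof. by rewrite /Ak expr0 mxE (inj_eq enum_rank_inj). Qed.

Let AkS k x y : Ak k.+1 x y = \sum_z Ak 1 x z * Ak k z y.
Proof. by rewrite /Ak exprS mxE sum_rank expr1. Qed.

Let Ak1_ge0 x y : 0 <= Ak 1 x y.
Proof.
rewrite /Ak expr1 !mxE !enum_rankK (inj_eq enum_rank_inj).
have [->|xy] := eqVneq x y; last first.
  by rewrite mul0r subr0 add0r mulr_ge0 ?invr_ge0 ?q_ge0 // ltW.
rewrite mul1r (bigD1 y) //= opprD addrA subrr add0r mulrN subr_ge0.
by rewrite mulrC ler_pdivrMr // mul1r.
Qed.

Lemma iter_ustepE k h x : iter k ustep h x = \sum_y Ak k x y * h y.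
Proof.
elim: k x => [|k IH] x.
  rewrite (bigD1 x) //= Ak0 eqxx mul1r big1 ?addr0 // => y /negPf.
  by rewrite Ak0 eq_sym => ->; rewrite mul0r.
rewrite iterS ustepE; under eq_bigr => z _ do rewrite IH mulr_sumr.
rewrite exchange_big; apply: eq_bigr => y _ /=.
by rewrite AkS mulr_suml; apply: eq_bigr => z _; rewrite mulrA.
Qed.

Lemma ustep_cst c : ustep (fun=> c) = fun=> c.
Proof.
apply/funext => x; rewrite /ustep /drift big1 ?mulr0 ?addr0 // => y _.
by rewrite subrr mulr0.
Qed.

Lemma ustep_le h h' : (forall x, h x <= h' x) -> forall x, ustep h x <= ustep h' x.
Proof.
by move=> hh' x; rewrite !ustepE; apply: ler_sum => y _; exact: ler_wpM2l.
Qed.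

Let Ak_ge0 k x y : 0 <= Ak k x y.
Proof.
elim: k x => [|k IH] x; first by rewrite Ak0.
by rewrite AkS sumr_ge0 // => z _; rewrite mulr_ge0.
Qed.

Let Ak_sum k x : \sum_y Ak k x y = 1.
Proof.
have := iter_ustepE k (fun=> 1) x.
under [RHS]eq_bigr do rewrite mulr1.
move<-; elim: k x => //= k IH x; have -> : iter k ustep (fun=> 1) = fun=> 1.
  exact/funext.
by rewrite ustep_cst.
Qed.

Let Ak_le1 k x y : `|Ak k x y| <= 1.
Proof.
by rewrite ger0_norm // -(Ak_sum k x) (bigD1 y) //= lerDl sumr_ge0.
Qed.

(** [generator q = Lam *: (A - 1)], and the binomial formula then exhibits the k-th term of
    [exp (t Q)] as a term of the Cauchy product of the series of [exp (t Lam A)] and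
    [expR (- (t * Lam))]. *)
Let genX k x y : (generator q ^+ k) (enum_rank x) (enum_rank y) =
  \sum_(0 <= i < k.+1) Lam ^+ k * (-1) ^+ (k - i) * 'C(k, i)%:R * Ak i x y.
Proof.
have -> : generator q = Lam *: (A - 1).
  by rewrite /A addrC addKr scalerA divff ?scale1r // gt_eqF.
have -> : (Lam *: (A - 1)) ^+ k = Lam ^+ k *: (A - 1) ^+ k.
  elim: k => [|k IH]; first by rewrite !expr0 scale1r.
  rewrite !exprS IH -[RHS]scalerA.
  rewrite -[_ * _]/((Lam *: (A - 1)) *m (Lam ^+ k *: (A - 1) ^+ k)).
  by rewrite -scalemxAr -scalemxAl scalerA scalerA mulrC.
rewrite exprBn_comm; last by rewrite /GRing.comm mulr1 mul1r.
rewrite mxE summxE -(big_mkord xpredT (fun i => ((-1) ^+ i * A ^+ (k - i) * 1 ^+ i *+ 'C(k, i)) (enum_rank x) (enum_rank y))).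
rewrite big_nat_rev /= add0n mulr_sumr !big_mkord.
apply: eq_bigr => i _; have ik : (i <= k)%N by rewrite -ltnS.
rewrite subSS subKn // expr1n mulr1 mulmxnE bin_sub // -mulr_natr.
rewrite /Ak -!mulrA; congr (_ * _).
have signM (M : 'M[R]_#|T|) j : (-1) ^+ j * M = (-1) ^+ j *: M.
  rewrite -signr_odd -[in RHS]signr_odd; case: odd.
    by rewrite !expr1 mulN1r scaleN1r.
  by rewrite !expr0 mul1r scale1r.
rewrite signM mxE.
ring.
Qed.

Section Time.
Variable t : R.
Hypothesis t_ge0 : 0 <= t.

Let tL0 : 0 <= t * Lam.
Proof. by rewrite mulr_ge0 // ltW. Qed.

Let cvg_Ak x y : cvgn (series (fun k => exp_coeff (t * Lam) k * Ak k x y)).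
Proof.
apply: normed_cvg; apply: (series_le_cvg _ _ _ (is_cvg_series_exp_coeff (t * Lam))).
- by move=> n /=.
- by move=> n; exact: exp_coeff_ge0.
- move=> n /=; rewrite normrM (ger0_norm (exp_coeff_ge0 _ _)) //.
  by rewrite ler_piMr // exp_coeff_ge0.
Qed.

Let cvg_gen x y :
  series (fun k => exp_coeff t k * (generator q ^+ k) (enum_rank x) (enum_rank y))
   @ \oo --> limn (series (fun k => exp_coeff (t * Lam) k * Ak k x y)) * expR (- (t * Lam)).
Proof.
pose a k := exp_coeff (t * Lam) k * Ak k x y.
pose b k := exp_coeff (- (t * Lam)) k.
rewrite (_ : (fun k => _) = fun k => \sum_(0 <= i < k.+1) a i * b (k - i)%N); last first.
  apply/funext => k; rewrite genX mulr_sumr !big_mkord; apply: eq_bigr => i _.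
  have ik : (i <= k)%N by rewrite -ltnS.
  have /(congr1 (fun m => m%:R : R)) := bin_fact ik; rewrite !natrM => kE.
  rewrite /a /b /exp_coeff /= -kE.
  have split (v : R) : v ^+ k = v ^+ i * v ^+ (k - i) by rewrite -exprD subnKC.
  rewrite [(- (t * Lam)) ^+ _]exprNn !exprMn (split t) (split Lam).
  have i0 : (i`!)%:R != 0 :> R by rewrite pnatr_eq0 -lt0n fact_gt0.
  have ki0 : ((k - i)`!)%:R != 0 :> R by rewrite pnatr_eq0 -lt0n fact_gt0.
  have C0 : 'C(k, i)%:R != 0 :> R by rewrite pnatr_eq0 -lt0n bin_gt0.
  by field; rewrite i0 ki0 C0.
apply: (@cauchy_product_exp R (t * Lam)) => //.
- move=> i; rewrite normrM (ger0_norm (exp_coeff_ge0 _ _)) //.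
  by rewrite ler_piMr // exp_coeff_ge0.
- move=> j; rewrite /b /exp_coeff /= normrM normrX normrN normfV.
  by rewrite (ger0_norm tL0) (ger0_norm (ler0n _ _)).
- exact: cvg_Ak.
- exact: is_cvg_series_exp_coeff.
Qed.

(* The law at time [t] is a Poisson mixture of the laws of the discrete chain. *)
Lemma uniformization h x :
  series (fun k => expR (- (t * Lam)) * (exp_coeff (t * Lam) k * iter k ustep h x))
    @ \oo --> \sum_y transition q t x y * h y.
Proof.
have trE y : transition q t x y =
    limn (series (fun k => exp_coeff (t * Lam) k * Ak k x y)) * expR (- (t * Lam)).
  by apply/cvg_lim => //; exact: cvg_gen.
rewrite (_ : series _ = fun N => \sum_y
   (series (fun k => exp_coeff (t * Lam) k * Ak k x y) N * expR (- (t * Lam)) * h y)).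
  apply: cvg_big => [|y _]; first exact: add_continuous.
  rewrite trE; apply: cvgM; last exact: cvg_cst.
  by apply: cvgM; [exact: cvg_Ak|exact: cvg_cst].
apply/funext => N; rewrite /series /=.
under eq_bigr => k _ do rewrite iter_ustepE mulr_sumr mulr_sumr.
rewrite exchange_big; apply: eq_bigr => y _ /=.
rewrite !mulr_suml; apply: eq_bigr => k _.
by ring.
Qed.

End Time.
End Uniformization.

(** * Invariant laws and bounds on the mixing time *)

Section Mixing.
Variables (R : realType) (T : finType) (q : T -> T -> R) (Lam : R).
Implicit Types (h mu nu : T -> R) (x y : T) (t : R).

Hypothesis Lam_gt0 : 0 < Lam.
Hypothesis q_ge0 : forall x y, x != y -> 0 <= q x y.
Hypothesis q_le : forall x, \sum_(y | y != x) q x y <= Lam.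

Local Notation S := (ustep q Lam).

Let kern x y := S (fun z => (z == y)%:R) x.

Let sum_delta (f : T -> R) x : \sum_y (x == y)%:R * f y = f x.
Proof.
rewrite (bigD1 x) //= eqxx mul1r big1 ?addr0 // => y /negPf.
by rewrite eq_sym => ->; rewrite mul0r.
Qed.

Let sum_rank (f : 'I_#|T| -> R) : \sum_i f i = \sum_(y : T) f (enum_rank y).
Proof. by rewrite (reindex enum_rank) //; apply: onW_bij; exact: enum_rank_bij. Qed.

Lemma ustep_kern h x : S h x = \sum_y S (fun z => (z == y)%:R) x * h y.
Proof.
rewrite ustepE //; apply: eq_bigr => y _; rewrite ustepE //.
congr (_ * _); under [RHS]eq_bigr => z _ do rewrite mulrC eq_sym.
by rewrite sum_delta.
Qed.

Let kern_ge0 x y : 0 <= kern x y.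
Proof.
have := ustep_le Lam_gt0 q_ge0 q_le (h := fun=> 0) (h' := fun z => (z == y)%:R).
by rewrite ustep_cst; apply => z; exact: ler0n.
Qed.

Let kern_sum x : \sum_y kern x y = 1.
Proof.
transitivity (S (fun=> 1) x); last by rewrite ustep_cst.
by rewrite ustep_kern; apply: eq_bigr => y _; rewrite mulr1.
Qed.

(** The generator kills constants, hence has a left null vector [s], possibly signed. By the
    triangle inequality [|s|] is at most its image under the kernel, and both have the same total
    mass, so they agree and [|s|] can be normalised. *)
Lemma exists_stationary (x0 : T) : exists mu, is_distribution mu /\
  forall h, \sum_x mu x * S h x = \sum_x mu x * h x.
Proof.
have [v v0 vG] : exists2 v : 'rV_#|T|, v != 0 & v *m generator q = 0.
  apply/det0P; rewrite -det_tr; apply/det0P; exists (const_mx 1).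
    apply/eqP => /rowP /(_ (enum_rank x0)); rewrite !mxE => /eqP.
    by rewrite oner_eq0.
  apply/rowP => i; rewrite !mxE -(enum_valK i).
  transitivity (drift q (fun=> 1) (enum_val i)).
    rewrite -generator_drift sum_rank; apply: eq_bigr => y _.
    by rewrite mxE mul1r mulr1 mxE.
  by rewrite /drift big1 // => y _; rewrite subrr mulr0.
pose s x := v ord0 (enum_rank x).
have sS h : \sum_x s x * S h x = \sum_x s x * h x.
  under eq_bigr => x _ do rewrite /ustep mulrDr.
  rewrite big_split /= -[RHS]addr0; congr (_ + _).
  under eq_bigr => x _ do rewrite mulrCA -generator_drift mulr_sumr.
  rewrite -mulr_sumr exchange_big /= big1 ?mulr0 // => y _.
  under eq_bigr => x _ do rewrite mulrA.
  rewrite -mulr_suml; have /rowP/(_ (enum_rank y)) := vG; rewrite !mxE => vy.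
  by rewrite sum_rank in vy; rewrite vy mul0r.
have sE y : s y = \sum_x s x * kern x y.
  by rewrite sS; under eq_bigr => x _ do rewrite mulrC eq_sym; rewrite sum_delta.
pose Z := \sum_x `|s x|.
have Z0 : 0 < Z.
  rewrite lt_neqAle sumr_ge0 // andbT eq_sym psumr_neq0 //.
  case/rV0Pn: v0 => i vi; apply/hasP; exists (enum_val i); rewrite ?mem_index_enum //=.
  by rewrite normr_gt0 /s enum_valK.
have absE y : `|s y| = \sum_x `|s x| * kern x y.
  have le y' : `|s y'| <= \sum_x `|s x| * kern x y'.
    rewrite {1}sE (le_trans (ler_norm_sum _ _ _)) //; apply: ler_sum => x _.
    by rewrite normrM (ger0_norm (kern_ge0 _ _)).
  apply/eqP; rewrite -subr_eq0 -oppr_eq0 opprB.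
  have : \sum_y (\sum_x `|s x| * kern x y - `|s y|) = 0.
    rewrite sumrB exchange_big /=; apply/eqP; rewrite subr_eq0; apply/eqP.
    by apply: eq_bigr => x _; rewrite -mulr_sumr kern_sum mulr1.
  move/eqP; rewrite psumr_eq0; last by move=> y' _; rewrite subr_ge0.
  by move/allP/(_ y (mem_index_enum y)).
exists (fun x => `|s x| / Z); split.
  split=> [x|]; first by rewrite divr_ge0 // ltW.
  by rewrite -mulr_suml divff // gt_eqF.
move=> h; under eq_bigr => x _ do rewrite ustep_kern mulr_sumr.
rewrite exchange_big; apply: eq_bigr => y _ /=; rewrite absE !mulr_suml.
apply: eq_bigr => x _.
by rewrite /kern; ring.
Qed.

(** The geometric bound is averaged over a Poisson number of steps of mean [t * Lam], whose
    generating function at [r] is the exponential on the right. The weights [nu] may be signed and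
    [r] may exceed 1: differences of two starting points and linearly growing errors are both
    treated this way. *)
Lemma mixture_le nu h (c1 c2 r : R) t : 0 <= t ->
  (forall k, \sum_x nu x * iter k S h x <= c1 + c2 * r ^+ k) ->
  \sum_x nu x * \sum_y transition q t x y * h y
    <= c1 + c2 * expR (- (t * Lam) * (1 - r)).
Proof.
move=> t0 le; pose w k := expR (- (t * Lam)) * exp_coeff (t * Lam) k.
have w0 k : 0 <= w k.
  by rewrite mulr_ge0 ?expR_ge0 // exp_coeff_ge0 // mulr_ge0 // ltW.
have geo s : series (fun k => w k * s ^+ k) @ \oo --> expR (- (t * Lam) * (1 - s)).
  have -> : expR (- (t * Lam) * (1 - s)) = expR (- (t * Lam)) * expR (t * Lam * s).
    by rewrite -expRD; congr expR; ring.
  rewrite (_ : series _ = fun N => expR (- (t * Lam)) * series (exp_coeff (t * Lam * s)) N).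
    by apply: cvgM; [exact: cvg_cst|exact: is_cvg_series_exp_coeff].
  apply/funext => N; rewrite /series /= mulr_sumr; apply: eq_bigr => k _.
  by rewrite /w /exp_coeff /= (exprMn _ (t * Lam) s); ring.
have cR : series (fun k => w k * (c1 + c2 * r ^+ k)) @ \oo -->
    c1 + c2 * expR (- (t * Lam) * (1 - r)).
  rewrite (_ : series _ = fun N => series (fun k => w k * 1 ^+ k) N * c1
      + c2 * series (fun k => w k * r ^+ k) N).
    apply: cvgD; last by apply: cvgM; [exact: cvg_cst|exact: geo].
    rewrite -[X in _ --> X]mul1r; apply: cvgM; last exact: cvg_cst.
    by have := geo 1; rewrite subrr mulr0 expR0.
  apply/funext => N; rewrite /series /= mulr_suml mulr_sumr -big_split.
  by apply: eq_bigr => k _ /=; rewrite expr1n; ring.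
have cL : series (fun k => w k * \sum_x nu x * iter k S h x) @ \oo -->
    \sum_x nu x * \sum_y transition q t x y * h y.
  rewrite (_ : series _ = fun N => \sum_x nu x * series (fun k => expR (- (t * Lam)) *
     (exp_coeff (t * Lam) k * iter k S h x)) N).
    apply: cvg_big => [|x _]; first exact: add_continuous.
    by apply: cvgM; [exact: cvg_cst|exact: uniformization].
  apply/funext => N; rewrite /series /=.
  under eq_bigr => k _ do rewrite mulr_sumr.
  rewrite exchange_big; apply: eq_bigr => x _ /=; rewrite mulr_sumr.
  by apply: eq_bigr => k _; rewrite /w; ring.
apply: (ler_cvg_to cL cR); apply: nearW => N.
by rewrite /series /=; apply: ler_sum => k _; exact: ler_wpM2l.
Qed.

Let sum_pair x x' (f : T -> R) :
  \sum_z ((x == z)%:R - (x' == z)%:R) * f z = f x - f x'.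
Proof.
by under eq_bigr => z _ do rewrite mulrBl; rewrite sumrB !sum_delta.
Qed.

Lemma transition_contract h x x' (c r : R) t : 0 <= t ->
  (forall k, iter k S h x - iter k S h x' <= c * r ^+ k) ->
  \sum_y transition q t x y * h y - \sum_y transition q t x' y * h y
    <= c * expR (- (t * Lam) * (1 - r)).
Proof.
move=> t0 le; rewrite -(sum_pair x x' (fun z => \sum_y transition q t z y * h y)) -[leRHS]add0r; apply: mixture_le => // k.
by rewrite sum_pair add0r.
Qed.

Lemma stationary_invariant mu : is_distribution mu ->
  (forall h, \sum_x mu x * S h x = \sum_x mu x * h x) -> is_invariant q mu.
Proof.
move=> dmu muS; split=> // t y t0.
have iterE h k : \sum_x mu x * iter k S h x = \sum_x mu x * h x.
  by elim: k h => // k IH h; rewrite iterSr IH muS.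
have E h : \sum_x mu x * \sum_y transition q t x y * h y = \sum_x mu x * h x.
  apply/le_anti/andP; split.
    rewrite -[leRHS]addr0 -[X in _ + X](mul0r (expR (- (t * Lam) * (1 - 1)))).
    by apply: mixture_le => // k; rewrite iterE mul0r addr0.
  have le : \sum_x - mu x * (\sum_y transition q t x y * h y)
     <= - (\sum_x mu x * h x) + 0 * expR (- (t * Lam) * (1 - 1)).
    apply: mixture_le => // k; rewrite mul0r addr0 -(iterE h k) -sumrN.
    by apply: ler_sum => x _; rewrite mulNr.
  move: le; rewrite mul0r addr0 -lerN2 opprK -sumrN => /le_trans; apply.
  by apply: ler_sum => x _; rewrite mulNr opprK.
have := E (fun z => (y == z)%:R).
under [RHS]eq_bigr => z _ do rewrite mulrC.
rewrite sum_delta => <-; apply: eq_bigr => x _; congr (_ * _).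
by under [RHS]eq_bigr => z _ do rewrite mulrC; rewrite sum_delta.
Qed.

Let inv := invariant_distribution q.

Lemma invariant_distributionP (x0 : T) : is_invariant q inv.
Proof.
have [mu [dmu muS]] := exists_stationary x0.
apply: (@xgetPex _ (fun=> 0) [set mu | is_invariant q mu]).
by exists mu; exact: stationary_invariant.
Qed.

Let sum_setE (A : {set T}) (f : T -> R) :
  \sum_(x in A) f x = \sum_x f x * (x \in A)%:R.
Proof.
rewrite big_mkcond; apply: eq_bigr => x _.
by case: (x \in A); rewrite ?mulr1 ?mulr0.
Qed.

(** Invariance writes the equilibrium mass of a set as an average over starting points [z], so the
    distance to equilibrium is at most the worst distance between two starting points. *)
Lemma mixing_time_le (x0 : T) (eps t : R) : 0 <= eps -> 0 <= t ->
  (forall h x x', (forall y, 0 <= h y <= 1) ->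
     \sum_y transition q t x y * h y - \sum_y transition q t x' y * h y <= eps) ->
  (mixing_time q eps <= t%:E)%E.
Proof.
move=> e0 t0 le; apply: ereal_inf_lbound; exists t => //; split=> //.
have [[inv_ge0 inv_sum] invP] := invariant_distributionP x0.
apply: bigmax_le => // x _; apply: bigmax_le => // A _.
pose h y : R := (y \in A)%:R.
have h01 y : 0 <= h y <= 1 by rewrite /h; case: (y \in A); rewrite ?lexx ?ler01.
have -> : \sum_(y in A) inv y = \sum_z inv z * \sum_y transition q t z y * h y.
  rewrite sum_setE; under [RHS]eq_bigr => z _ do rewrite mulr_sumr.
  rewrite exchange_big; apply: eq_bigr => y _ /=; rewrite -(invP t y t0) mulr_suml.
  by apply: eq_bigr => z _; rewrite mulrA.
rewrite sum_setE.
have avg (c : R) : c = \sum_z inv z * c by rewrite -mulr_suml inv_sum mul1r.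
rewrite [X in X - _]avg -sumrB [leRHS]avg (le_trans (ler_norm_sum _ _ _)) //.
apply: ler_sum => z _; rewrite -mulrBr normrM ger0_norm //; apply: ler_wpM2l => //.
rewrite ler_norml; apply/andP; split.
  by rewrite lerNl opprB; exact: (le h _ _ h01).
exact: (le h _ _ h01).
Qed.

(** Closeness to equilibrium at a time before [tau] would force the invariant law to give more than
    half of its mass to each of two disjoint sets. *)
Lemma mixing_time_ge (A1 A2 : {set T}) nu1 nu2 (eps tau : R) :
  (forall x, x \in A1 -> x \notin A2) -> is_distribution nu1 -> is_distribution nu2 ->
  (forall t, 0 <= t < tau ->
     2^-1 + eps < \sum_x nu1 x * \sum_y transition q t x y * (y \in A1)%:R
  /\ 2^-1 + eps < \sum_x nu2 x * \sum_y transition q t x y * (y \in A2)%:R) ->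
  (tau%:E <= mixing_time q eps)%E.
Proof.
move=> dis d1 d2 H; apply: le_ereal_inf_tmp => _ [t [t0 tvle] <-].
rewrite lee_fin leNgt; apply/negP => ttau.
have /H[H1 H2] : 0 <= t < tau by rewrite t0.
have low (A : {set T}) nu : is_distribution nu ->
    2^-1 + eps < \sum_x nu x * \sum_y transition q t x y * (y \in A)%:R ->
    2^-1 < \sum_(x in A) inv x.
  move=> [nu0 nu1'] ltA; rewrite -(ltrD2r eps) (lt_le_trans ltA) //.
  have avg (c : R) : c = \sum_z nu z * c by rewrite -mulr_suml nu1' mul1r.
  rewrite [leRHS]avg; apply: ler_sum => x _.
  apply: ler_wpM2l => //; rewrite -sum_setE -lerBlDl (le_trans (ler_norm _)) //.
  apply: le_trans tvle; apply: le_trans (le_bigmax _ _ x).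
  exact: (le_bigmax _ (fun A : {set T} => `|\sum_(y in A) _ - \sum_(y in A) _|) A).
have {}H1 := low _ _ d1 H1; have {}H2 := low _ _ d2 H2.
have : \sum_(x in A1) inv x + \sum_(x in A2) inv x <= 1.
  (* Without an invariant distribution [xget] returns its default, the zero function, and the bound
     is trivial. *)
  have [ex|nex] := pselect (exists mu, is_invariant q mu).
    have [[inv0 inv1] _] : is_invariant q inv by exact: (@xgetPex _ (fun=> 0) _ ex).
    rewrite !sum_setE -big_split /= -[leRHS]inv1; apply: ler_sum => x _.
    rewrite -mulrDr ler_piMr //; have := dis x.
    by case: (x \in A1) => [/(_ isT)/negPf->|_]; case: (x \in A2) => //=; rewrite ?addr0 ?add0r.
  have invE : inv = fun=> 0.
    by apply: xgetPN => mu imu; apply: nex; exists mu.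
  by rewrite invE !big1 // addr0 ler01.
by lra.
Qed.

End Mixing.

(** * Link events and couplings *)

Section Events.
Variables (R : realType) (K n : nat).
Notation config := {ffun 'I_n -> 'I_K.+1}.
Implicit Types (x y : config) (B : config -> R) (h : config -> R) (j : 'I_n).

Definition upd x j (i : 'I_K.+1) : config := [ffun k => if k == j then i else x k].

(** Saturates at [K], so that an arrival at a full link is an event without effect and all links
    share one arrival rate. *)
Definition inc (i : 'I_K.+1) : 'I_K.+1 := inord (minn i.+1 K).
Definition dec (l : nat) (i : 'I_K.+1) : 'I_K.+1 := inord (i - (l < i))%N.

Definition up j x := upd x j (inc (x j)).
(* Lowers coordinate [j] iff it exceeds [l]: summing over [l < K] gives the
   departure rate [x j] through monotone maps of constant rate. *)
Definition dn (l : 'I_K) j x := upd x j (dec l (x j)).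

Lemma val_inc i : inc i = minn i.+1 K :> nat.
Proof. by rewrite inordK // ltnS geq_minr. Qed.

Lemma val_dec l i : dec l i = (i - (l < i))%N :> nat.
Proof. by rewrite inordK // (leq_ltn_trans (leq_subr _ _)). Qed.

Lemma updE x j i k : upd x j i k = if k == j then i else x k.
Proof. by rewrite ffunE. Qed.

Lemma upd_id x j : upd x j (x j) = x.
Proof. by apply/ffunP => k; rewrite updE; case: eqP => [->|]. Qed.

(** The arrival rate [B] is a parameter: the routing chain, its clipped modifications and the
    constant-rate chains are all instances. *)
Definition dar_op B h x : R :=
  \sum_j (B x * (h (up j x) - h x) + \sum_(l < K) (h (dn l j x) - h x)).

Lemma sum_dec (f : 'I_K.+1 -> R) (i : 'I_K.+1) :
  \sum_(l < K) (f (dec l i) - f i) = i%:R * (f (inord i.-1) - f i).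
Proof.
transitivity (\sum_(l < K | (l < i)%N) (f (inord i.-1) - f i)).
  rewrite [RHS]big_mkcond; apply: eq_bigr => l _; rewrite /dec.
  by case: ifP => li; rewrite ?subn1 // subn0 inord_val subrr.
have iK : (i <= K)%N by rewrite -ltnS.
rewrite -(big_ord_widen K (fun=> f (inord i.-1) - f i) iK).
by rewrite sumr_const card_ord mulr_natl.
Qed.

(** A state that agrees with [x] off [j] is [upd x j i] for a unique [i], and only the neighbours of
    [x j] carry a rate. The events without effect at 0 and [K] add nothing. *)
Lemma drift_dar rho alpha h x :
  drift (@dar_rate R rho alpha K n) h x =
  dar_op (fun x => arrival rho alpha (full_fraction R x) * K%:R) h x.
Proof.
rewrite /drift /dar_op.
under eq_bigr => y _ do rewrite /dar_rate mulr_suml.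
rewrite (exchange_big_dep xpredT) //=; apply: eq_bigr => j _.
rewrite (reindex_onto (upd x j) (fun y => y j)) /=; last first.
  move=> y /forallP yx; apply/ffunP => k; rewrite updE.
  by case: eqP => [->//|/eqP kj]; have /implyP/(_ kj)/eqP := yx k.
rewrite (eq_bigl xpredT); last first.
  move=> i; rewrite updE eqxx eqxx andbT; apply/forallP => k.
  by apply/implyP => /negPf kj; rewrite updE kj.
under eq_bigr => i _ do rewrite updE eqxx.
set b := arrival _ _ _ * _.
have -> : \sum_(l < K) (h (dn l j x) - h x) =
    (x j)%:R * (h (upd x j (inord (x j).-1)) - h x).
  by have := sum_dec (fun i => h (upd x j i)) (x j); rewrite upd_id.
pose up_part (i : 'I_K.+1) := (i == (x j).+1 :> nat)%:R * b * (h (upd x j i) - h x).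
pose dn_part (i : 'I_K.+1) := (x j == i.+1 :> nat)%:R * (x j)%:R * (h (upd x j i) - h x).
rewrite (eq_bigr (fun i => up_part i + dn_part i)); last first.
  move=> i _; rewrite /up_part /dn_part -mulrDl; congr (_ * _).
  case: eqVneq => [->|_]; case: eqVneq => [E|_]; rewrite ?mul1r ?mul0r ?addr0 ?add0r //.
  by have := ltn_ord (x j); lia.
rewrite big_split /=; congr (_ + _).
  have [xK|xK] := ltnP (x j) K.
    rewrite (bigD1 (inc (x j))) //= big1 ?addr0.
      by rewrite /up_part val_inc (minn_idPl xK) eqxx mul1r.
    move=> i ij; rewrite /up_part; case: eqVneq => [E|_]; last by rewrite !mul0r.
    by case/eqP: ij; apply/val_inj; rewrite /= val_inc (minn_idPl xK).
  have xjK : x j = K :> nat by apply/eqP; rewrite eqn_leq xK -ltnS ltn_ord.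
  rewrite big1; last first.
    move=> i _; rewrite /up_part; case: eqVneq => [E|_]; last by rewrite !mul0r.
    by have := ltn_ord i; rewrite E xjK ltnn.
  have -> : up j x = x.
    rewrite /up (_ : inc (x j) = x j) ?upd_id //; apply/val_inj.
    by rewrite /= val_inc xjK; exact/minn_idPr.
  by rewrite subrr mulr0.
have [x0|x0] := posnP (x j).
  rewrite x0 mul0r big1 // => i _; rewrite /dn_part x0.
  by rewrite mulr0 mul0r.
have pj : ((x j).-1 < K.+1)%N by exact: leq_ltn_trans (leq_pred _) (ltn_ord _).
rewrite (bigD1 (inord (x j).-1)) //= big1 ?addr0.
  by rewrite /dn_part inordK // prednK // eqxx mul1r.
move=> i ij; rewrite /dn_part; case: eqVneq => [E|_]; last by rewrite !mul0r.
by case/eqP: ij; apply/val_inj; rewrite /= E /= inord_val.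
Qed.

Definition dstep B (Lam : R) h x : R := h x + Lam^-1 * dar_op B h x.

Lemma dar_opE B h x : dar_op B h x =
  \sum_j (B x * h (up j x) + \sum_(l < K) h (dn l j x)) - n%:R * (B x + K%:R) * h x.
Proof.
rewrite /dar_op -mulrA mulr_natl -[in X in _ - X](card_ord n) -sumr_const -sumrB.
apply: eq_bigr => j _; rewrite sumrB sumr_const card_ord -mulr_natl; ring.
Qed.

Lemma dar_opD B h1 h2 x :
  dar_op B (fun x => h1 x + h2 x) x = dar_op B h1 x + dar_op B h2 x.
Proof.
rewrite /dar_op -big_split; apply: eq_bigr => j _ /=.
have -> : \sum_(l < K) (h1 (dn l j x) + h2 (dn l j x) - (h1 x + h2 x)) =
   \sum_(l < K) (h1 (dn l j x) - h1 x) + \sum_(l < K) (h2 (dn l j x) - h2 x).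
  by rewrite -big_split; apply: eq_bigr => l _ /=; ring.
by ring.
Qed.

Lemma dar_opZ B c h x : dar_op B (fun x => c * h x) x = c * dar_op B h x.
Proof.
rewrite /dar_op mulr_sumr; apply: eq_bigr => j _ /=.
rewrite (eq_bigr (fun l => c * (h (dn l j x) - h x))) -?mulr_sumr; first by ring.
by move=> l _; ring.
Qed.

Lemma dar_op_cst B c x : dar_op B (fun=> c) x = 0.
Proof.
by rewrite /dar_op big1 // => j _; rewrite subrr mulr0 big1 ?addr0 // => l _; rewrite subrr.
Qed.

Lemma dstep_cst B Lam c : dstep B Lam (fun=> c) = fun=> c.
Proof. by apply/funext => x; rewrite /dstep dar_op_cst mulr0 addr0. Qed.

Lemma dstep_le B Lam h h' x : 0 < Lam -> 0 <= B x -> n%:R * (B x + K%:R) <= Lam ->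
  (forall x, h x <= h' x) -> dstep B Lam h x <= dstep B Lam h' x.
Proof.
move=> L0 B0 BL hh'; rewrite /dstep !dar_opE.
have E (g : config -> R) s : g x + Lam^-1 * (s - n%:R * (B x + K%:R) * g x) =
   Lam^-1 * ((Lam - n%:R * (B x + K%:R)) * g x + s).
  by field; rewrite gt_eqF.
rewrite !E ler_pM2l ?invr_gt0 //; apply: lerD.
  by apply: ler_wpM2l; rewrite ?subr_ge0.
apply: ler_sum => j _; apply: lerD; first exact: ler_wpM2l.
by apply: ler_sum => l _.
Qed.

(* A rate matrix realising [dar_op B] for an arbitrary state-dependent [B]. *)
Definition event_rate B x y : R :=
  \sum_j (B x * (up j x == y)%:R + \sum_(l < K) (dn l j x == y)%:R).

Lemma drift_event_rate B h x : drift (event_rate B) h x = dar_op B h x.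
Proof.
have delta (f : config -> R) z : \sum_y (z == y)%:R * f y = f z.
  rewrite (bigD1 z) //= eqxx mul1r big1 ?addr0 // => y /negPf.
  by rewrite eq_sym => ->; rewrite mul0r.
rewrite /drift /event_rate; under eq_bigr => y _ do rewrite mulr_suml.
rewrite exchange_big; apply: eq_bigr => j _ /=.
under eq_bigr => y _ do rewrite mulrDl -mulrA mulr_suml.
rewrite big_split /= -mulr_sumr delta; congr (_ + _).
by rewrite exchange_big; apply: eq_bigr => l _ /=; rewrite delta.
Qed.

Lemma event_rate_ge0 B x y : 0 <= B x -> 0 <= event_rate B x y.
Proof.
move=> B0; apply: sumr_ge0 => j _; apply: addr_ge0; first exact: mulr_ge0.
exact: sumr_ge0.
Qed.

Lemma exit_rate_le (q : config -> config -> R) B x : 0 <= B x ->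
  (forall h, drift q h x = dar_op B h x) ->
  \sum_(y | y != x) q x y <= n%:R * (B x + K%:R).
Proof.
move=> B0 qB; have := qB (fun y => (y != x)%:R).
rewrite /drift => E.
have -> : \sum_(y | y != x) q x y = \sum_y q x y * ((y != x)%:R - (x != x)%:R).
  rewrite big_mkcond; apply: eq_bigr => y _; rewrite eqxx subr0.
  by case: eqP => _; rewrite ?mulr0 ?mulr1.
have le1 (b : bool) : b%:R <= 1 :> R by case: b; rewrite ?ler01 ?lexx.
have sumc (m : nat) (c : R) : \sum_(i < m) c = m%:R * c.
  by rewrite sumr_const card_ord mulr_natl.
rewrite E /dar_op eqxx -sumc.
apply: ler_sum => j _; rewrite subr0; apply: lerD.
  by rewrite -[leRHS]mulr1; apply: ler_wpM2l.
rewrite -[leRHS]mulr1 -sumc.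
by apply: ler_sum => l _; rewrite subr0.
Qed.

Section Coupling.
Variable B : config -> R.

(** Each link receives the common part of the two arrival rates in both copies at once, the surplus
    in one copy only, and departures through the same threshold map. Only this generator is used,
    never a process on pairs. *)
Definition cpl_op (G : config -> config -> R) x x' : R :=
  let m := Num.min (B x) (B x') in
  \sum_j (m * (G (up j x) (up j x') - G x x')
    + (B x - m) * (G (up j x) x' - G x x')
    + (B x' - m) * (G x (up j x') - G x x')
    + \sum_(l < K) (G (dn l j x) (dn l j x') - G x x')).

(** This expresses that the coupling has the right marginals. *)
Lemma cpl_diff h x x' :
  cpl_op (fun x x' => h x - h x') x x' = dar_op B h x - dar_op B h x'.
Proof.
rewrite /cpl_op /dar_op -sumrB; apply: eq_bigr => j _.
have -> : \sum_(l < K) (h (dn l j x) - h (dn l j x') - (h x - h x')) =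
  \sum_(l < K) (h (dn l j x) - h x) - \sum_(l < K) (h (dn l j x') - h x').
  by rewrite -sumrB; apply: eq_bigr => l _; ring.
by ring.
Qed.

Lemma cpl_opE G x x' : let m := Num.min (B x) (B x') in
  cpl_op G x x' = \sum_j (m * G (up j x) (up j x') + (B x - m) * G (up j x) x'
     + (B x' - m) * G x (up j x') + \sum_(l < K) G (dn l j x) (dn l j x'))
   - n%:R * (B x + B x' - m + K%:R) * G x x'.
Proof.
move=> m; have -> : n%:R * (B x + B x' - m + K%:R) * G x x' =
    \sum_(j < n) (B x + B x' - m + K%:R) * G x x'.
  by rewrite sumr_const card_ord -mulrA mulr_natl.
rewrite /cpl_op -sumrB.
apply: eq_bigr => j _; rewrite sumrB sumr_const card_ord -mulr_natl -/m; ring.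
Qed.

Variable Lam : R.
Hypothesis Lam_gt0 : 0 < Lam.
Hypothesis B_ge0 : forall x, 0 <= B x.
Hypothesis B_le : forall x x', n%:R * (B x + B x' + K%:R) <= Lam.

Lemma cpl_le (G G' : config -> config -> R) x x' :
  (forall x x', G x x' <= G' x x') ->
  G x x' + Lam^-1 * cpl_op G x x' <= G' x x' + Lam^-1 * cpl_op G' x x'.
Proof.
move=> GG'; rewrite !cpl_opE; set m := Num.min _ _.
have mx : m <= B x by rewrite ge_min lexx.
have mx' : m <= B x' by rewrite ge_min lexx orbT.
have m0 : 0 <= m by rewrite le_min !B_ge0.
pose r := n%:R * (B x + B x' - m + K%:R).
have rL : r <= Lam.
  apply: le_trans (B_le x x'); apply: ler_wpM2l => //; lra.
have E (g s : R) : g + Lam^-1 * (s - r * g) = Lam^-1 * ((Lam - r) * g + s).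
  by field; rewrite gt_eqF.
rewrite -/r !E ler_pM2l ?invr_gt0 //; apply: lerD.
  by apply: ler_wpM2l; rewrite ?subr_ge0.
apply: ler_sum => j _; apply: lerD; last by apply: ler_sum => l _.
by apply: lerD; [apply: lerD|]; apply: ler_wpM2l => //; rewrite subr_ge0.
Qed.

(** One coupled step is a positive operator, so the comparison of [h x - h x'] with [F] survives
    each step and picks up the contraction factor of [F]. Here [F] is any function of pairs, later a
    distance times a Lyapunov weight. *)
Lemma cpl_contract (F : config -> config -> R) (kap : R) :
  (forall x x', cpl_op F x x' <= - kap * F x x') -> kap <= Lam ->
  forall h, (forall x x', h x - h x' <= F x x') ->
  forall k x x', iter k (dstep B Lam) h x - iter k (dstep B Lam) h x' <=
    (1 - kap / Lam) ^+ k * F x x'.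
Proof.
move=> FK kL h hF; elim=> [|k IH] x x'; first by rewrite expr0 mul1r; exact: hF.
rewrite !iterS; set g := iter k _ h in IH *.
set c := (1 - kap / Lam) ^+ k in IH *.
have c0 : 0 <= c by rewrite exprn_ge0 // subr_ge0 ler_pdivrMr // mul1r.
have -> : dstep B Lam g x - dstep B Lam g x' =
    (g x - g x') + Lam^-1 * cpl_op (fun x x' => g x - g x') x x'.
  by rewrite cpl_diff /dstep; ring.
apply: (le_trans (cpl_le (G' := fun x x' => c * F x x') x x' IH)).
have -> : cpl_op (fun x x' => c * F x x') x x' = c * cpl_op F x x'.
  rewrite /cpl_op mulr_sumr; apply: eq_bigr => j _.
  rewrite (eq_bigr (fun l => c * (F (dn l j x) (dn l j x') - F x x'))) -?mulr_sumr.
    by ring.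
  by move=> l _; ring.
rewrite exprSr -/c -mulrA.
have -> : c * F x x' + Lam^-1 * (c * cpl_op F x x') = c * (F x x' + Lam^-1 * cpl_op F x x').
  by ring.
apply: ler_wpM2l => //.
have -> : (1 - kap / Lam) * F x x' = F x x' + Lam^-1 * (- kap * F x x') by ring.
by rewrite lerD2l; apply: ler_wpM2l; [rewrite invr_ge0 ltW|exact: FK].
Qed.

End Coupling.
End Events.

Section DarMixing.
Variables (R : realType) (rho : nat) (alpha : R) (K n : nat).
Notation config := {ffun 'I_n -> 'I_K.+1}.

Let B (x : config) : R := arrival rho alpha (full_fraction R x) * K%:R.
Hypothesis B_ge0 : forall x, 0 <= B x.

Lemma dar_rate_ge0 x y : x != y -> 0 <= @dar_rate R rho alpha K n x y.
Proof.
move=> _; apply: sumr_ge0 => j _; case: ifP => _; first exact: B_ge0.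
by case: ifP => _; rewrite ?ler0n.
Qed.

Lemma ustep_dar Lam h x : ustep (@dar_rate R rho alpha K n) Lam h x = dstep B Lam h x.
Proof. by rewrite /ustep drift_dar. Qed.

Lemma dar_tmix_le (F : config -> config -> R) (kap eps t : R) :
  0 < kap -> 0 <= eps -> 0 <= t ->
  (forall x x', 0 <= F x x') -> (forall x x', x != x' -> 1 <= F x x') ->
  (forall x x', cpl_op B F x x' <= - kap * F x x') ->
  (forall x x', expR (- (kap * t)) * F x x' <= eps) ->
  (dar_tmix rho alpha eps K n <= t%:E)%E.
Proof.
move=> k0 e0 t0 F0 F1 FK Fe.
(* Any bound on all jump rates will do, since the exponent [t * Lam * (kap / Lam)] is free of [Lam];
   the summand [kap] gives [kap <= Lam]. *)
pose Lam := kap + \sum_x \sum_x' n%:R * (B x + B x' + K%:R).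
have rate_ge0 x x' : 0 <= n%:R * (B x + B x' + K%:R).
  by rewrite mulr_ge0 // !addr_ge0.
have sum_ge0 : 0 <= \sum_x \sum_x' n%:R * (B x + B x' + K%:R).
  by apply: sumr_ge0 => x _; apply: sumr_ge0.
have kL : kap <= Lam by rewrite lerDl.
have L0 : 0 < Lam by rewrite (lt_le_trans k0).
have BL x x' : n%:R * (B x + B x' + K%:R) <= Lam.
  apply: ler_wpDl; first exact: ltW.
  rewrite (bigD1 x) //= (bigD1 x') //= -[leRHS]addrA lerDl addr_ge0 //.
    by apply: sumr_ge0.
  by apply: sumr_ge0 => y _; apply: sumr_ge0.
apply: (@mixing_time_le _ _ _ Lam) => //.
- exact: dar_rate_ge0.
- move=> x; apply: le_trans (BL x x); apply: (le_trans (exit_rate_le (B_ge0 x) _)).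
    by move=> h; rewrite drift_dar.
  by apply: ler_wpM2l => //; rewrite -addrA lerD2l lerDr.
- exact: [ffun=> ord0].
- move=> h x x' h01.
  apply: le_trans (Fe x x'); rewrite mulrC.
  have -> : - (kap * t) = - (t * Lam) * (1 - (1 - kap / Lam)).
    by field; rewrite gt_eqF.
  apply: transition_contract => //.
  + exact: dar_rate_ge0.
  + move=> y; apply: le_trans (BL y y); apply: (le_trans (exit_rate_le (B_ge0 y) _)).
      by move=> g; rewrite drift_dar.
    by apply: ler_wpM2l => //; rewrite -addrA lerD2l lerDr.
  + move=> k; rewrite mulrC.
    have -> : ustep (@dar_rate R rho alpha K n) Lam = dstep B Lam.
      by apply/funext => g; apply/funext => y; exact: ustep_dar.
    apply: (cpl_contract L0 B_ge0 BL FK kL) => y y'.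
    have [->|yy'] := eqVneq y y'; first by rewrite subrr.
    apply: le_trans (F1 _ _ yy'); have /andP[_ hy] := h01 y.
    by have /andP[hy' _] := h01 y'; lra.
Qed.

End DarMixing.

(** * Rates of the mean-field dynamics *)

Section RateFunctions.
Variables (R : realType) (rho : nat).
Implicit Types (f x y : R).

Lemma poly_lipschitz01 (p : {poly R}) : exists2 L : R, 0 <= L &
  forall x y, 0 <= x <= 1 -> 0 <= y <= 1 ->
    `|p.[x]| <= L /\ `|p.[x] - p.[y]| <= L * `|x - y|.
Proof.
elim/poly_ind: p => [|p c [L L0 IH]].
  by exists 0 => // x y _ _; rewrite !horner0 subrr normr0 mul0r.
exists (2 * L + `|c|) => [|x y x01 y01]; first by rewrite addr_ge0 // mulr_ge0.
have [px pxy] := IH x y x01 y01; have [py _] := IH y x y01 x01.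
rewrite !hornerMXaddC; split.
  apply: (le_trans (ler_normD _ _)); rewrite normrM lerD2r.
  have : `|p.[x]| * `|x| <= L * 1.
    by apply: ler_pM => //; case/andP: x01 => x0 x1; rewrite ger0_norm.
  by lra.
have -> : p.[x] * x + c - (p.[y] * y + c) = (p.[x] - p.[y]) * x + p.[y] * (x - y) by ring.
apply: (le_trans (ler_normD _ _)); rewrite !normrM.
have : `|p.[x] - p.[y]| * `|x| <= L * `|x - y| * 1.
  by apply: ler_pM => //; case/andP: x01 => x0 x1; rewrite ger0_norm.
have : `|p.[y]| * `|x - y| <= L * `|x - y| by apply: ler_wpM2r.
have : 0 <= `|c| * `|x - y| by rewrite mulr_ge0.
by lra.
Qed.

(* Probability that both links of a rerouting attempt are not available. *)
Definition fail f : R := f * (2 - f).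
(** This is [1 + reroute], with the quotient by [1 - f] replaced by a geometric sum: a polynomial,
    hence Lipschitz on the unit interval. At 1 both are equal to 1, for [reroute] because division
    by zero gives 0. *)
Definition gain f : R := 1 + 2 * f * (1 - f) * \sum_(i < rho) fail f ^+ i.
Definition throughput f : R := 1 + f - 2 * f * fail f ^+ rho.

Lemma failE f : 1 - fail f = (1 - f) ^+ 2.
Proof. by rewrite /fail; ring. Qed.

Lemma fail_ge0 f : 0 <= f <= 1 -> 0 <= fail f.
Proof. by case/andP => f0 f1; rewrite mulr_ge0 //; lra. Qed.

Lemma fail_le f f' : f <= f' -> f' <= 1 -> fail f <= fail f'.
Proof. by rewrite /fail => ff' f1; nra. Qed.

Lemma fail_le1 f : fail f <= 1.
Proof. by rewrite -subr_ge0 failE sqr_ge0. Qed.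

Lemma arrivalE (alpha : R) f : arrival rho alpha f = alpha * gain f.
Proof.
rewrite /arrival /gain /reroute; congr (_ * (1 + _)).
have -> : 1 - (1 - f) ^+ 2 = fail f by rewrite -failE; ring.
have -> : 1 - fail f ^+ rho = (1 - f) ^+ 2 * \sum_(i < rho) fail f ^+ i.
  by rewrite -failE -opprB subrX1; ring.
have [->|f1] := eqVneq f 1; first by rewrite subrr invr0 !(mulr0, mul0r).
by field; rewrite subr_eq0 eq_sym.
Qed.

Lemma throughputE f : throughput f = (1 - f) * gain f.
Proof.
have E : 1 - fail f ^+ rho = (1 - f) ^+ 2 * \sum_(i < rho) fail f ^+ i.
  by rewrite -failE -opprB subrX1; ring.
have -> : (1 - f) * gain f = (1 - f) + 2 * f * ((1 - f) ^+ 2 * \sum_(i < rho) fail f ^+ i).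
  by rewrite /gain; ring.
by rewrite -E /throughput; ring.
Qed.

Lemma gain_ge1 f : 0 <= f <= 1 -> 1 <= gain f.
Proof.
move=> f01; case/andP: (f01) => f0 f1; rewrite lerDl mulr_ge0 ?mulr_ge0 ?subr_ge0 //.
by apply: sumr_ge0 => i _; rewrite exprn_ge0 // fail_ge0.
Qed.

(* [gain f / (1 - f) = 1 / (1 - f) + 2 * f * \sum_i fail f ^ i] is increasing. *)
Lemma gain_cross f f' : 0 <= f -> f < f' -> f' <= 1 ->
  gain f * (1 - f') < gain f' * (1 - f).
Proof.
move=> f0 ff' f1; rewrite /gain.
set s := \sum_(i < rho) fail f ^+ i; set s' := \sum_(i < rho) fail f' ^+ i.
have f01 : 0 <= f <= 1 by rewrite f0 (le_trans (ltW ff')).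
have s0 : 0 <= s by apply: sumr_ge0 => i _; rewrite exprn_ge0 // fail_ge0.
have ss' : s <= s'.
  apply: ler_sum => i _; apply: lerXn2r; rewrite ?nnegrE ?fail_ge0 //.
    by rewrite f1 (le_trans f0) // ltW.
  by apply: fail_le => //; exact: ltW.
have d0 : 0 <= (1 - f) * (1 - f') by case/andP: f01 => *; rewrite mulr_ge0 ?subr_ge0.
have fs : f * s <= f' * s' by apply: ler_pM => //; exact: ltW.
have : (1 - f) * (1 - f') * (f * s) <= (1 - f) * (1 - f') * (f' * s').
  exact: ler_wpM2l.
by nra.
Qed.

Lemma gain_cross_le f f' : 0 <= f -> f <= f' -> f' <= 1 ->
  gain f * (1 - f') <= gain f' * (1 - f).
Proof.
move=> f0; rewrite le_eqVlt => /predU1P[->//|ff'] f1.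
by apply/ltW; exact: gain_cross.
Qed.

Lemma throughput_ge1 f : 0 <= f -> 2 * fail f ^+ rho <= 1 -> 1 <= throughput f.
Proof. by rewrite /throughput => f0 hf; nra. Qed.

(** [throughput f = 1 + f * (1 - 2 * fail f ^+ rho)], and past [m] the bracket is nonpositive and
    decreasing while its factor grows. *)
Lemma throughput_anti m f f' : 0 <= m -> 1 <= 2 * fail m ^+ rho ->
  m <= f -> f <= f' -> f' <= 1 -> throughput f' <= throughput f.
Proof.
move=> m0 hm mf ff' f1; rewrite /throughput.
have f0 : 0 <= f by exact: le_trans mf.
have pf a b : 0 <= a -> a <= b -> b <= 1 -> fail a ^+ rho <= fail b ^+ rho.
  move=> a0 ab b1; apply: lerXn2r; rewrite ?nnegrE; [| |exact: fail_le].
    by apply: fail_ge0; lra.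
  by apply: fail_ge0; lra.
have := pf _ _ m0 mf (le_trans ff' f1); have := pf _ _ f0 ff' f1.
by nra.
Qed.

Let gain_poly : {poly R} := 1 + 2%:P * 'X * (1 - 'X) * \sum_(i < rho) ('X * (2%:P - 'X)) ^+ i.

Let gain_polyE f : gain_poly.[f] = gain f.
Proof.
rewrite /gain_poly /gain /fail !hornerE horner_sum; congr (_ + _ * _).
by apply: eq_bigr => i _; rewrite !hornerE.
Qed.

Lemma gain_continuous : continuous gain.
Proof.
rewrite (_ : gain = horner gain_poly); first exact: continuous_horner.
by apply/funext => f; rewrite gain_polyE.
Qed.

Lemma gain_lipschitz : exists2 L : R, 0 < L &
  forall f f', 0 <= f <= 1 -> 0 <= f' <= 1 ->
    gain f <= L /\ `|gain f - gain f'| <= L * `|f - f'|.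
Proof.
have [L L0 HL] := poly_lipschitz01 gain_poly; exists (L + 1); first lra.
move=> f f' f01 f01'; have [] := HL f f' f01 f01'; rewrite !gain_polyE => H1 H2.
split; first by have := ler_norm (gain f); lra.
by have := normr_ge0 (f - f'); lra.
Qed.

Lemma fail_continuous : continuous fail.
Proof.
rewrite (_ : fail = horner ('X * (2%:P - 'X))); first exact: continuous_horner.
by apply/funext => f; rewrite !hornerE.
Qed.

Lemma throughput_continuous : continuous throughput.
Proof.
rewrite (_ : throughput = fun f => (1 - f) * gain f).
  move=> f; apply: cvgM; last exact: gain_continuous.
  by apply: cvgB; [exact: cvg_cst|exact: cvg_id].
by apply/funext => f; exact: throughputE.
Qed.

Lemma throughput_max : exists2 f, 0 <= f <= 1 &
  forall f', 0 <= f' <= 1 -> throughput f' <= throughput f.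
Proof.
have tc : {within `[0, 1], continuous throughput}.
  exact/continuous_subspaceT/throughput_continuous.
have [f] := EVT_max ler01 tc; rewrite in_itv /= => f01 H; exists f => // f' f01'.
Qed.

Section Trap.
Variables (alpha f0 : R).
Hypotheses (alpha_gt0 : 0 < alpha) (alpha_lt1 : alpha < 1).
Hypotheses (f0_01 : 0 <= f0 <= 1) (f0_gt1 : 1 < alpha * throughput f0).

Let h f := alpha * gain f.

Lemma low_trap : exists d b : R, [/\ 0 < d, d < 1, 0 < b, b < 1 &
  forall f, 0 <= f <= d -> alpha * gain f <= b].
Proof.
have a0 := alpha_gt0; have a1 := alpha_lt1.
have [L L0 HL] := gain_lipschitz.
have aL : 0 < 2 * (alpha * L + 1) by have := mulr_gt0 alpha_gt0 L0; lra.
(* [alpha * gain] starts at [alpha] and has slope at most [alpha * L], so on [[0, d]] it stays below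
   the midpoint of [alpha] and 1; the summand 1 in the denominator keeps [d < 1]. *)
exists ((1 - alpha) / (2 * (alpha * L + 1))), ((1 + alpha) / 2).
have d0 : 0 < (1 - alpha) / (2 * (alpha * L + 1)) by rewrite divr_gt0 // subr_gt0.
have d1 : (1 - alpha) / (2 * (alpha * L + 1)) < 1.
  by rewrite ltr_pdivrMr // mul1r; have := mulr_gt0 alpha_gt0 L0; lra.
split=> //; try lra.
move=> f /andP[f_ge0 fd].
have f01 : 0 <= f <= 1 by rewrite f_ge0 (le_trans fd) // ltW.
have o01 : 0 <= (0 : R) <= 1 by rewrite lexx ler01.
have [_] := HL f 0 f01 o01.
rewrite subr0 (ger0_norm f_ge0) => H.
have g0 : gain 0 = 1 by rewrite /gain mulr0 !mul0r addr0.
have {}H : gain f <= 1 + L * f by rewrite g0 in H; have := ler_norm (gain f - 1); lra.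
have : alpha * gain f <= alpha * (1 + L * f) by rewrite ler_pM2l.
have : f * (2 * (alpha * L + 1)) <= 1 - alpha by rewrite -ler_pdivlMr.
by nra.
Qed.

(** At constant rate [b * K] with [b > 1] the full fraction settles near [1 - 1 / b], so the
    conditions on [b1] and [b2] say that the level is pushed up at [l] and down at [c]. The
    difficulty is that [gain] is not monotone; [gain_cross_le] is the substitute. *)
Lemma high_trap : exists l c b1 b2 : R,
  [/\ 0 < l, l < c, c < 1, 1 < b1 * (1 - l) & b2 * (1 - c) < 1] /\
  0 < b1 /\ forall f, l <= f <= c -> b1 <= alpha * gain f <= b2.
Proof.
have a0 := alpha_gt0; have a1 := alpha_lt1.
have h_cont : continuous h.
  by move=> f; apply: cvgM; [exact: cvg_cst|exact: gain_continuous].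
have hcross f f' : 0 <= f -> f <= f' -> f' <= 1 -> h f * (1 - f') <= h f' * (1 - f).
  by move=> *; rewrite /h -!mulrA ler_pM2l // gain_cross_le.
have h_gt0 f : 0 <= f <= 1 -> 0 < h f.
  by move=> f01; rewrite mulr_gt0 // (lt_le_trans ltr01) // gain_ge1.
case/andP: (f0_01) => f0_ge0 f0_le1.
(* Left of the maximiser [fa] nothing exceeds [h fa], and [h fa * (1 - fa)] is still greater than
   1. *)
have [fa] : exists2 c, c \in `[0, f0] & forall t, t \in `[0, f0] -> h t <= h c.
  by apply: EVT_max => //; exact: continuous_subspaceT.
rewrite in_itv /= => /andP[fa0 faf0] famax.
have h0 : h f0 <= h fa by apply: famax; rewrite in_itv /= f0_ge0 lexx.
have hf0 : 1 < h f0 * (1 - f0) by have := f0_gt1; rewrite throughputE /h; lra.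
have hfa : 1 < h fa * (1 - fa).
  apply: (lt_le_trans hf0); apply: ler_pM => //.
  - exact/ltW/h_gt0.
  - by rewrite subr_ge0.
  - by lra.
have fa1 : fa < 1.
  rewrite ltNge; apply/negP => fa1; have : h fa * (1 - fa) <= 0; last lra.
  by rewrite mulr_ge0_le0 ?subr_le0 //; apply/ltW/h_gt0; lra.
have fa_gt0 : 0 < fa.
  rewrite lt_neqAle fa0 andbT eq_sym; apply/eqP => fa00; move: hfa.
  by rewrite fa00 /h /gain mulr0 !mul0r addr0 subr0; lra.
have ifa : 0 < (1 - fa)^-1 by rewrite invr_gt0 subr_gt0.
have hfa' : (1 - fa)^-1 < h fa by rewrite -div1r ltr_pdivrMr // subr_gt0.
have [l [l0 lfa hl]] : exists l, [/\ 0 < l, l < fa &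
    forall f, l <= f <= fa -> (1 - fa)^-1 < h f].
  have d0 : 0 < h fa - (1 - fa)^-1 by rewrite subr_gt0.
  have := h_cont fa; move/cvgrPdist_lt => /(_ _ d0).
  case/nbhs_ballP => e /= e0 He.
  exists (Num.max (fa / 2) (fa - e / 2)); split.
  - by rewrite lt_max; apply/orP; left; lra.
  - by rewrite gt_max; apply/andP; split; lra.
  - move=> f /andP[]; rewrite ge_max => /andP[_ lf] ffa.
    have : ball fa e f by rewrite /ball /= ger0_norm; lra.
    by move/He => /=; rewrite ltr_norml => /andP[_]; lra.
have l1 : 0 < 1 - l by lra.
have il : (1 - l)^-1 < (1 - fa)^-1.
  by rewrite ltf_pV2 ?posrE ?subr_gt0 //; lra.
(* Strictly between the value required at [l] and the lower bound for [h] on [[l, fa]]: the first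
   gap gives [1 < b1 * (1 - l)], the second gives [e < 1]. *)
pose b1 := ((1 - l)^-1 + (1 - fa)^-1) / 2.
have b1fa : b1 < (1 - fa)^-1 by rewrite /b1; lra.
have b1l : (1 - l)^-1 < b1 by rewrite /b1; lra.
have b10 : 0 < b1 by have : 0 < (1 - l)^-1; [rewrite invr_gt0|lra].
pose e := b1 * (1 - fa).
have e0 : 0 < e by rewrite mulr_gt0 // subr_gt0.
have e1 : e < 1 by rewrite /e -ltr_pdivlMr ?subr_gt0 // div1r.
(* [c = inf S] is the first point past [fa] for which [e / (1 - c)] dominates [h] on [[fa, c]]. Any
   [x] in [[fa, c)] has some [f <= x] with [h f * (1 - x) > e], and the cross inequality turns this
   into [b1 <= h x]. *)
pose S := [set c : R | fa <= c <= 1 /\ forall f, fa <= f <= c -> h f * (1 - c) <= e].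
have [L L0 HL] := gain_lipschitz.
have aL : 0 < alpha * L by rewrite mulr_gt0.
have hM f : 0 <= f <= 1 -> h f <= alpha * L.
  by move=> f01; rewrite ler_pM2l //; case: (HL f f f01 f01).
pose c1 := Num.max fa (1 - e / (alpha * L)).
have eaL : 0 < e / (alpha * L) by rewrite divr_gt0.
have Sc1 : S c1.
  have c11 : c1 < 1 by rewrite gt_max fa1; lra.
  split; first by rewrite (ltW c11) andbT /c1 le_max lexx.
  move=> f /andP[f1 f2]; have f01 : 0 <= f <= 1 by lra.
  have : 1 - c1 <= e / (alpha * L).
    have : 1 - e / (alpha * L) <= c1 by rewrite le_max lexx orbT.
    by lra.
  rewrite ler_pdivlMr //; have := hM f f01; have := h_gt0 f f01; nra.
have S_inf : has_inf S.
  by split; [exists c1|exists fa; move=> x [/andP[]]].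
pose c := inf S.
have lbc x : S x -> c <= x by move=> Sx; apply: ge_inf => //; case: S_inf.
have cfa : fa <= c by apply: lb_le_inf; [exists c1|move=> x [/andP[]]].
have c1c : c < 1 by apply: le_lt_trans (lbc _ Sc1) _; rewrite gt_max fa1; lra.
have Sc : S c.
  split=> [|f /andP[f1 f2]]; first by rewrite cfa ltW.
  rewrite leNgt; apply/negP => lt; have f01 : 0 <= f <= 1 by lra.
  have hf := h_gt0 f f01.
  have d0 : 0 < (h f * (1 - c) - e) / h f by rewrite divr_gt0 // subr_gt0.
  have [c' Sc' c'c] := inf_adherent d0 S_inf.
  have cc' := lbc _ Sc'; have [_ /(_ f)] := Sc'.
  rewrite f1 (le_trans f2 cc') => /(_ isT); apply/negP; rewrite -ltNge.
  have : h f * ((h f * (1 - c) - e) / h f) = h f * (1 - c) - e by field; rewrite gt_eqF.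
  have : h f * (c' - c) < h f * ((h f * (1 - c) - e) / h f) by rewrite ltr_pM2l //; rewrite -/c in c'c; lra.
  by lra.
have fac : fa < c.
  rewrite lt_neqAle cfa andbT; apply/eqP => fac; have [_ /(_ c)] := Sc.
  by rewrite cfa lexx -fac => /(_ isT); lra.
have hb1 x : fa <= x < c -> b1 <= h x.
  move=> /andP[fax xc].
  have [f [/andP[faf fx] hf]] : exists f, fa <= f <= x /\ e < h f * (1 - x).
    apply: contrapT => nex; have : S x.
      split=> [|f fx]; first by rewrite fax; lra.
      by rewrite leNgt; apply/negP => hf; apply: nex; exists f.
    by move/lbc; rewrite leNgt xc.
  have := hcross f x; rewrite fx => /(_ _ isT _) H.
  have {}H : h f * (1 - x) <= h x * (1 - f) by apply: H; lra.
  have hx : 0 < h x by apply: h_gt0; lra.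
  have : h x * (1 - f) <= h x * (1 - fa) by rewrite ler_pM2l //; lra.
  have fa1' : 0 < 1 - fa by rewrite subr_gt0.
  move=> H2; have : b1 * (1 - fa) <= h x * (1 - fa) by rewrite -/e; lra.
  by rewrite ler_pM2r.
have hb1c : b1 <= h c.
  rewrite leNgt; apply/negP => hc.
  have d0 : 0 < b1 - h c by rewrite subr_gt0.
  have := h_cont c; move/cvgrPdist_lt => /(_ _ d0).
  case/nbhs_ballP => e' /= e'0 He.
  have [x [fax xc xe]] : exists x, [/\ fa <= x, x < c & c - x < e'].
    exists (Num.max fa (c - e' / 2)); split.
    - by rewrite le_max lexx.
    - by rewrite gt_max fac; lra.
    - have : c - e' / 2 <= Num.max fa (c - e' / 2) by rewrite le_max lexx orbT.
      by lra.
  have : ball c e' x by rewrite /ball /= ger0_norm; lra.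
  move/He => /=; rewrite ltr_norml => /andP[+ _].
  by have := hb1 x; rewrite fax xc => /(_ isT); lra.
exists l, c, b1, (e / (1 - c)).
have c1' : 0 < 1 - c by rewrite subr_gt0.
split; first split=> //.
- by rewrite (lt_trans lfa).
- by rewrite -ltr_pdivrMr // div1r.
- by rewrite divfK // gt_eqF.
split=> // f /andP[lf fc]; have [ffa|faf] := leP f fa.
  have hfl := hl f; rewrite lf ffa in hfl; have {}hfl := hfl isT.
  apply/andP; split; first by rewrite -/(h f); lra.
  rewrite -/(h f) ler_pdivlMr //; apply: le_trans (_ : h fa * (1 - c) <= _).
    rewrite ler_pM2r //; apply: famax; rewrite in_itv /=; lra.
  by have [_] := Sc; apply; rewrite lexx cfa.
apply/andP; split.
  move: fc; rewrite le_eqVlt => /predU1P[->//|fc].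
  by apply: hb1; rewrite ltW.
by rewrite -/(h f) ler_pdivlMr //; have [_] := Sc; apply; rewrite ltW.
Qed.
End Trap.
End RateFunctions.

(** * Lyapunov-weighted contractions *)

Section ExponentialBounds.
Variable R : realType.

Lemma nat_bound (X : R) : exists n0 : nat, forall n, (n0 <= n)%N -> X <= n%:R.
Proof.
exists (Num.bound `|X|) => n nn; apply: (le_trans (ler_norm X)).
apply: (le_trans (ltW (archi_boundP (normr_ge0 X)))); rewrite ler_nat; exact: nn.
Qed.

Lemma expR_le_quad (z : R) : z <= 2^-1 -> expR z <= 1 + z + 2 * z ^+ 2.
Proof.
move=> z2; have z1 : 0 < 1 - z by lra.
have : expR z * (1 - z) <= 1.
  by rewrite -[leRHS](expRxMexpNx_1 z) ler_pM2l ?expR_gt0 //; have := expR_ge1Dx (- z); lra.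
have : 1 <= (1 + z + 2 * z ^+ 2) * (1 - z) by nra.
by move=> h1 h2; rewrite -(ler_pM2r z1); exact: le_trans h1.
Qed.

Lemma expR_dist (z : R) : `|z| <= 2^-1 -> `|expR z - 1| <= 2 * `|z|.
Proof.
move=> z2; have zle := ler_norm z; have h3 := expR_le_quad (le_trans zle z2).
have h2 := expR_ge1Dx z; have h1 := ler_norm (- z); have h0 := normr_ge0 z.
have zz : z ^+ 2 = `|z| * `|z| by rewrite -expr2 real_normK ?num_real.
rewrite zz in h3; rewrite normrN in h1.
by rewrite ler_norml; apply/andP; split; [lra|nra].
Qed.

Lemma mul_expRN_small (s th : R) : 0 < s -> 0 < th ->
  exists A0 : R, forall A, A0 <= A -> A * expR (- (A * s)) <= th.
Proof.
move=> s0 th0; exists (4 / (th * s ^+ 2) + 1) => A AA0.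
have ths : 0 < th * s ^+ 2 by rewrite mulr_gt0 // exprn_gt0.
have A0 : 0 < A by rewrite (lt_le_trans _ AA0) // ltr_wpDl // divr_ge0 // ltW.
rewrite expRN ler_pdivrMr ?expR_gt0 //.
have : (A * s / 2) ^+ 2 <= expR (A * s).
  have -> : A * s = A * s / 2 + A * s / 2 by lra.
  have As : 0 < A * s by rewrite mulr_gt0.
  have e1 : A * s / 2 <= expR (A * s / 2) by have := expR_ge1Dx (A * s / 2); lra.
  rewrite expRD -expr2 ler_sqr ?nnegrE ?expR_ge0 //; last lra.
  by have -> : (A * s / 2 + A * s / 2) / 2 = A * s / 2 by lra.
have : 4 <= A * (th * s ^+ 2) by rewrite -ler_pdivrMr //; lra.
move=> h1 h2; have := ler_wpM2l (ltW th0) h2; apply: le_trans.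
have := ler_wpM2l (ltW A0) h1; have -> : th * (A * s / 2) ^+ 2 = A * (A * (th * s ^+ 2)) / 4 by field.
by lra.
Qed.

End ExponentialBounds.

Section Lyapunov.
Variables (R : realType) (K n : nat).
Notation config := {ffun 'I_n -> 'I_K.+1}.
Variable B : config -> R.
Hypothesis B_ge0 : forall x, 0 <= B x.
Implicit Types (D Xi : config -> config -> R) (Th u : config -> R).

(** Total variation of [D] per unit time along the coupled jumps; it controls the cross term of the
    product rule [cpl_op_prod]. *)
Definition cpl_abs D x x' : R :=
  let m := Num.min (B x) (B x') in
  \sum_j (m * `|D (up j x) (up j x') - D x x'|
    + (B x - m) * `|D (up j x) x' - D x x'|
    + (B x' - m) * `|D x (up j x') - D x x'|
    + \sum_(l < K) `|D (dn l j x) (dn l j x') - D x x'|).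

Let min_ge0 x x' : 0 <= Num.min (B x) (B x').
Proof. by rewrite le_min !B_ge0. Qed.

Let min_lel x x' : 0 <= B x - Num.min (B x) (B x').
Proof. by rewrite subr_ge0 ge_min lexx. Qed.

Let min_ler x x' : 0 <= B x' - Num.min (B x) (B x').
Proof. by rewrite subr_ge0 ge_min lexx orbT. Qed.

Lemma cpl_op_abs D x x' : cpl_op B D x x' <= cpl_abs D x x'.
Proof.
apply: ler_sum => j _; apply: lerD; last by apply: ler_sum => l _; exact: ler_norm.
by apply: lerD; [apply: lerD|]; apply: ler_wpM2l => //; exact: ler_norm.
Qed.

Lemma cpl_opD D1 D2 x x' :
  cpl_op B (fun x x' => D1 x x' + D2 x x') x x' = cpl_op B D1 x x' + cpl_op B D2 x x'.
Proof.
rewrite /cpl_op -big_split; apply: eq_bigr => j _ /=.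
rewrite (eq_bigr (fun l => (D1 (dn l j x) (dn l j x') - D1 x x')
  + (D2 (dn l j x) (dn l j x') - D2 x x'))) ?big_split /=; first by ring.
by move=> l _; ring.
Qed.

Lemma cpl_op_left Th x x' : cpl_op B (fun x _ => Th x) x x' = dar_op B Th x.
Proof. by apply: eq_bigr => j _; ring. Qed.

Lemma cpl_op_right Th x x' : cpl_op B (fun _ x' => Th x') x x' = dar_op B Th x'.
Proof. by apply: eq_bigr => j _; ring. Qed.

(** Leibniz rule for a jump operator: the extra term, a product of two increments, is estimated by
    the largest increment of [Xi]. *)
Lemma cpl_op_prod D Xi x x' e :
  (forall y y', (exists j, (y = x \/ y = up j x) /\ (y' = x' \/ y' = up j x')) \/
     (exists l j, y = dn l j x /\ y' = dn l j x') ->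
     `|Xi y y' - Xi x x'| <= e) ->
  cpl_op B (fun x x' => D x x' * Xi x x') x x' <=
    Xi x x' * cpl_op B D x x' + D x x' * cpl_op B Xi x x' + e * cpl_abs D x x'.
Proof.
move=> He; rewrite /cpl_op /cpl_abs !mulr_sumr -!big_split /=; apply: ler_sum => j _.
have ev y y' : `|Xi y y' - Xi x x'| <= e -> D y y' * Xi y y' - D x x' * Xi x x' <=
    Xi x x' * (D y y' - D x x') + D x x' * (Xi y y' - Xi x x') + e * `|D y y' - D x x'|.
  move=> Xe; have -> : D y y' * Xi y y' - D x x' * Xi x x' =
    Xi x x' * (D y y' - D x x') + D x x' * (Xi y y' - Xi x x')
    + (Xi y y' - Xi x x') * (D y y' - D x x') by ring.
  rewrite lerD2l (le_trans (ler_norm _)) // normrM; exact: ler_wpM2r.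
have e1 := ev (up j x) (up j x') (He _ _ (or_introl (ex_intro _ j (conj (or_intror erefl) (or_intror erefl))))).
have e2 := ev (up j x) x' (He _ _ (or_introl (ex_intro _ j (conj (or_intror erefl) (or_introl erefl))))).
have e3 := ev x (up j x') (He _ _ (or_introl (ex_intro _ j (conj (or_introl erefl) (or_intror erefl))))).
have e4 : \sum_(l < K) (D (dn l j x) (dn l j x') * Xi (dn l j x) (dn l j x') - D x x' * Xi x x')
   <= Xi x x' * (\sum_(l < K) (D (dn l j x) (dn l j x') - D x x'))
    + D x x' * (\sum_(l < K) (Xi (dn l j x) (dn l j x') - Xi x x'))
    + e * (\sum_(l < K) `|D (dn l j x) (dn l j x') - D x x'|).
  rewrite !mulr_sumr -!big_split /=; apply: ler_sum => l _; apply: ev.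
  by apply: He; right; exists l, j.
have := ler_wpM2l (min_ge0 x x') e1; have := ler_wpM2l (min_lel x x') e2.
have := ler_wpM2l (min_ler x x') e3.
move: e4; set s := \sum_(l < K) _; set s1 := \sum_(l < K) _; set s2 := \sum_(l < K) _.
set s3 := \sum_(l < K) _; set m := Num.min _ _.
by lra.
Qed.

(** At most [C2 * n] jumps per unit time change [u] by at most [1 / n] each, so the quadratic term
    of the exponential costs only order [1 / n]. *)
Lemma exp_lyapunov u (A u1 C2 : R) x : (0 < n)%N -> 0 <= A -> A <= 2^-1 * n%:R ->
  n%:R * (B x + K%:R) <= C2 * n%:R ->
  (forall j, `|u (up j x) - u x| <= n%:R^-1) ->
  (forall l j, `|u (dn l j x) - u x| <= n%:R^-1) ->
  dar_op B (fun x => expR (A * (u x - u1))) x <=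
    expR (A * (u x - u1)) * (A * dar_op B u x + 2 * A ^+ 2 * C2 / n%:R).
Proof.
move=> n0 A0 An C2n uu ud; have nR : 0 < n%:R :> R by rewrite ltr0n.
set E := fun x => expR _.
pose a := A ^+ 2 / n%:R ^+ 2.
have ev y : `|u y - u x| <= n%:R^-1 ->
    E y - E x <= E x * (A * (u y - u x) + 2 * a).
  move=> uy; have -> : E y = E x * expR (A * (u y - u x)).
    by rewrite -expRD; congr expR; ring.
  rewrite -[X in _ - X]mulr1 -mulrBr ler_pM2l ?expR_gt0 //.
  have Auy : `|A * (u y - u x)| <= A / n%:R.
    by rewrite normrM ger0_norm //; exact: ler_wpM2l.
  have An2 : A / n%:R <= 2^-1 by rewrite ler_pdivrMr.
  have := expR_le_quad (le_trans (le_trans (ler_norm _) Auy) An2).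
  have : (A * (u y - u x)) ^+ 2 <= A ^+ 2 / n%:R ^+ 2.
    rewrite -exprVn -exprMn -[leLHS]real_normK ?num_real //.
    by apply: lerXn2r => //; rewrite nnegrE divr_ge0.
  by rewrite -/a; lra.
apply: le_trans (_ : \sum_j E x * (A * (B x * (u (up j x) - u x)
    + \sum_(l < K) (u (dn l j x) - u x)) + (B x + K%:R) * (2 * a)) <= _).
  apply: ler_sum => j _.
  have e1 := ler_wpM2l (B_ge0 x) (ev _ (uu j)).
  have e2 : \sum_(l < K) (E (dn l j x) - E x) <=
     E x * (A * (\sum_(l < K) (u (dn l j x) - u x)) + K%:R * (2 * a)).
    have -> : K%:R * (2 * a) = \sum_(l < K) (2 * a) :> R.
      by rewrite sumr_const card_ord mulr_natl.
    rewrite mulr_sumr -big_split mulr_sumr; apply: ler_sum => l _ /=; exact: ev.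
  move: e1 e2; set s := \sum_(l < K) _; set s' := \sum_(l < K) _.
  by lra.
rewrite -mulr_sumr ler_pM2l ?expR_gt0 // big_split /= -mulr_sumr lerD2l.
rewrite sumr_const card_ord -[_ *+ n]mulr_natl mulrA.
have -> : 2 * A ^+ 2 * C2 / n%:R = C2 * n%:R * (2 * a).
  by rewrite /a; field; rewrite gt_eqF.
by apply: ler_wpM2r => //; rewrite mulr_ge0 // divr_ge0 ?exprn_ge0.
Qed.

End Lyapunov.

Section FastCriterion.
Variable R : realType.

(* [D] contracts only where [u < u1]; multiplying it by a large exponential of
   the Lyapunov function [u] makes it contract everywhere. *)
Lemma fast_lyapunov (K : nat) (kap C0 c u0 u1 C1 C2 : R) :
  0 < kap -> 0 <= C0 -> 0 < c -> u0 < u1 -> 0 <= C1 -> 0 <= C2 ->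
  exists2 A : R, 0 <= A & exists n0 : nat, forall n, (n0 <= n)%N -> (0 < n)%N ->
  forall (B : {ffun 'I_n -> 'I_K.+1} -> R) (D : _ -> _ -> R) (u : _ -> R),
    (forall x, 0 <= B x) -> (forall x x', 0 <= D x x') ->
    (forall x x', u x < u1 -> u x' < u1 -> cpl_op B D x x' <= - kap * D x x') ->
    (forall x x', cpl_abs B D x x' <= C1 * D x x') ->
    (forall x j, `|u (up j x) - u x| <= n%:R^-1) ->
    (forall x l j, `|u (dn l j x) - u x| <= n%:R^-1) ->
    (forall x, B x + K%:R <= C2) ->
    (forall x, dar_op B u x <= C0) ->
    (forall x, u0 <= u x -> dar_op B u x <= - c) ->
  forall x x',
    cpl_op B (fun x x' => D x x' *
      ((1 + expR (A * (u x - u1))) + (1 + expR (A * (u x' - u1))))) x x' <=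
    - (kap / 2) * (D x x' *
      ((1 + expR (A * (u x - u1))) + (1 + expR (A * (u x' - u1))))).
Proof.
move=> k0 C00 c0 u01 C10 C20.
have s0 : 0 < u1 - u0 by lra.
have th0 : 0 < kap / (8 * (C0 + c)) by rewrite divr_gt0 // mulr_gt0 //; lra.
have [A0 HA0] := mul_expRN_small s0 th0.
(* The first bound makes the drift of the weight at most [kap / 8] below [u0], where the drift of
   [u] is merely bounded. The second makes the decay of the weight beyond [u1] outweigh the growth
   rate [C1] of [D]. *)
pose A := Num.max (Num.max A0 0) (8 * (C1 + kap) / c).
have A_ge0 : 0 <= A by rewrite !le_max lexx orbT.
have Asmall : A * expR (- (A * (u1 - u0))) <= kap / (8 * (C0 + c)).
  by apply: HA0; rewrite !le_max lexx.
have Abig : 8 * (C1 + kap) <= A * c by rewrite -ler_pdivrMr // le_max lexx orbT.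
exists A => //.
(* These bounds on [n] handle, in turn, the size of one increment of [A * u], the quadratic term of
   the exponential, and the cross term of the product rule. *)
have [n1 Hn1] := nat_bound (2 * A).
have [n2 Hn2] := nat_bound (4 * A * C2 / c).
have [n3 Hn3] := nat_bound (16 * A * C1 / kap).
exists (maxn n1 (maxn n2 n3)) => n; rewrite !geq_max => /and3P[nn1 nn2 nn3] n0.
have {}Hn1 := Hn1 n nn1; have {}Hn2 := Hn2 n nn2; have {}Hn3 := Hn3 n nn3.
move=> B D u B0 D0 good absD uu ud BC2 LuC Luc.
have nR : 0 < n%:R :> R by rewrite ltr0n.
pose E x := expR (A * (u x - u1)).
have E0 x : 0 < E x by exact: expR_gt0.
have C2n : 2 * A ^+ 2 * C2 / n%:R <= A * c / 2.
  rewrite ler_pdivrMr //; move: Hn2; rewrite ler_pdivrMr // => Hn2.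
  by have := ler_wpM2l A_ge0 Hn2; lra.
have LE x : dar_op B E x <= E x * (A * dar_op B u x + A * c / 2).
  apply: (le_trans (@exp_lyapunov _ _ _ B B0 u A u1 C2 x n0 A_ge0 _ _ _ _)) => //.
  - lra.
  - by rewrite mulrC ler_pM2r.
  - by rewrite -/(E x) ler_pM2l // lerD2l.
have LEsmall x : dar_op B E x <= kap / 8.
  apply: (le_trans (LE x)); have [uu0|uu0] := leP u0 (u x).
    apply: le_trans (_ : 0 <= _); last lra.
    apply: mulr_ge0_le0; first exact: ltW.
    have := ler_wpM2l A_ge0 (Luc x uu0); have : 0 <= A * c by rewrite mulr_ge0 // ltW.
    by lra.
  have Ee : E x <= expR (- (A * (u1 - u0))).
    by rewrite ler_expR; have := ler_wpM2l A_ge0 (ltW uu0); lra.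
  apply: le_trans (_ : E x * (A * (C0 + c)) <= _).
    rewrite ler_pM2l //; have := ler_wpM2l A_ge0 (LuC x).
    have : 0 <= A * c by rewrite mulr_ge0 // ltW.
    by lra.
  have Cc : 0 < C0 + c by lra.
  apply: le_trans (_ : expR (- (A * (u1 - u0))) * (A * (C0 + c)) <= _).
    by apply: ler_wpM2r => //; rewrite mulr_ge0 // ltW.
  have := Asmall; rewrite ler_pdivlMr ?mulr_gt0 //; lra.
have LEbad x : u1 <= u x -> dar_op B E x <= - (A * c / 4) * (1 + E x).
  move=> ux; apply: (le_trans (LE x)).
  have E1 : 1 <= E x by rewrite -expR0 ler_expR mulr_ge0 // subr_ge0.
  have := Luc x (le_trans (ltW u01) ux) => H.
  have AL := ler_wpM2l A_ge0 H; have Ac : 0 <= A * c by rewrite mulr_ge0 // ltW.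
  apply: le_trans (_ : E x * (- (A * c / 2)) <= _); first by rewrite ler_pM2l //; lra.
  have := ler_wpM2l Ac E1; lra.
pose Th x := 1 + E x.
have LTh x : dar_op B Th x = dar_op B E x.
  by rewrite /Th (@dar_opD _ _ _ _ (fun=> 1) E) dar_op_cst add0r.
pose e := 2 * A / n%:R.
have e0 : 0 <= e by rewrite divr_ge0 ?mulr_ge0.
have dTh x y : `|u y - u x| <= n%:R^-1 -> `|Th y - Th x| <= e * Th x.
  move=> uy; have -> : Th y - Th x = E x * (expR (A * (u y - u x)) - 1).
    rewrite mulrBr mulr1 -expRD /Th /E; have -> : A * (u x - u1) + A * (u y - u x) = A * (u y - u1) by ring.
    by ring.
  rewrite normrM (gtr0_norm (E0 x)).
  have Auy : `|A * (u y - u x)| <= A / n%:R.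
    by rewrite normrM ger0_norm //; exact: ler_wpM2l.
  have An2 : A / n%:R <= 2^-1 by rewrite ler_pdivrMr //; lra.
  have := expR_dist (le_trans Auy An2) => H.
  have {}H : `|expR (A * (u y - u x)) - 1| <= e.
    by apply: (le_trans H); rewrite /e -mulrA ler_pM2l.
  rewrite mulrC; apply: ler_pM => //; first exact: ltW.
  by rewrite lerDr.
have Th0 x : 0 <= e * Th x by rewrite mulr_ge0 // addr_ge0 // ltW.
pose Xi x x' := Th x + Th x'.
have Xi2 x x' : 2 <= Xi x x' by rewrite /Xi /Th; have := E0 x; have := E0 x'; lra.
move=> x x'.
have Hprod := @cpl_op_prod R K n B B0 D Xi x x' (e * Xi x x').
apply: (le_trans (Hprod _)).
  move=> y y' H; suff [/dTh H1 /dTh H2] : `|u y - u x| <= n%:R^-1 /\ `|u y' - u x'| <= n%:R^-1.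
    have -> : Xi y y' - Xi x x' = (Th y - Th x) + (Th y' - Th x') by rewrite /Xi; ring.
    by rewrite /Xi mulrDr (le_trans (ler_normD _ _)) // lerD.
  have n0' : 0 <= n%:R^-1 :> R by rewrite invr_ge0.
  by case: H => [[j [[->|->] [->|->]]]|[l [j [-> ->]]]]; rewrite ?subrr ?normr0 ?n0' ?uu ?ud.
rewrite (cpl_opD B (fun x _ => Th x) (fun _ x' => Th x')) cpl_op_left cpl_op_right !LTh.
have Xi0 : 0 <= Xi x x' by have := Xi2 x x'; lra.
have DX : 0 <= D x x' * Xi x x' by rewrite mulr_ge0.
have cross : e * Xi x x' * cpl_abs B D x x' <= kap / 8 * (D x x' * Xi x x').
  apply: le_trans (_ : e * Xi x x' * (C1 * D x x') <= _).
    by apply: ler_wpM2l => //; rewrite mulr_ge0.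
  have -> : e * Xi x x' * (C1 * D x x') = (e * C1) * (D x x' * Xi x x') by ring.
  apply: ler_wpM2r => //; rewrite /e mulrAC ler_pdivrMr //.
  by move: Hn3; rewrite ler_pdivrMr //; lra.
clear s0 th0 Asmall Hn1 Hn2 Hn3 C2n u01 C20 e0 nR C00.
(* If [u1 <= u y] then [2 <= Th y], while [Th y'] either decays as well or is at most 2; hence the
   decay of [Th y] is worth a fixed share of [Xi y y']. *)
have half y y' : u1 <= u y -> dar_op B E y + dar_op B E y' <= - (A * c / 8) * Xi y y' + kap / 16 * Xi y y'.
  move=> yb; have hb := LEbad y yb; have Thy2 : 2 <= Th y.
    have : 1 <= E y by rewrite -expR0 ler_expR mulr_ge0 // subr_ge0.
    by rewrite /Th; lra.
  have Ac : 0 <= A * c by rewrite mulr_ge0 // ltW.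
  have X2 := Xi2 y y'; have X0 : 0 <= Xi y y' by lra.
  have [yb'|yg'] := leP u1 (u y').
    have hb' := LEbad y' yb'; rewrite /Xi -/(Th y) -/(Th y') in hb hb' X2 *.
    by have := mulr_ge0 Ac X0; rewrite /Xi; nra.
  have hs' := LEsmall y'; have Thy' : Th y' <= 2.
    have : E y' <= 1 by rewrite -expR0 ler_expR mulr_ge0_le0 // subr_le0 ltW.
    by rewrite /Th; lra.
  rewrite -/(Th y) in hb; have : A * c * Xi y y' <= A * c * (2 * Th y).
    by apply: ler_wpM2l => //; rewrite /Xi; lra.
  have := ler_wpM2l (ltW k0) X2; lra.
have finish : dar_op B E x + dar_op B E x' <= - (A * c / 8) * Xi x x' + kap / 16 * Xi x x' ->
    D x x' * (dar_op B E x + dar_op B E x') + Xi x x' * cpl_op B D x x' +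
      e * Xi x x' * cpl_abs B D x x' <= - (kap / 2) * (D x x' * Xi x x').
  move=> hs; have := ler_wpM2l (D0 x x') hs.
  have := ler_wpM2l Xi0 (le_trans (cpl_op_abs B0 D x x') (absD x x')).
  have : 8 * (C1 + kap) * (D x x' * Xi x x') <= A * c * (D x x' * Xi x x') by exact: ler_wpM2r.
  by move: cross; have := mulr_ge0 (ltW k0) DX; lra.
have [xb|xg] := leP u1 (u x); last have [xb'|xg'] := leP u1 (u x').
- have := finish (half x x' xb); rewrite -/(Xi x x') -!/(Th _); lra.
- have := half x' x xb'; rewrite [_ + dar_op B E x]addrC /Xi [Th x' + _]addrC -/(Xi x x') => /finish.
  rewrite -/(Xi x x') -!/(Th _); lra.
- have hs : dar_op B E x + dar_op B E x' <= kap / 8 * Xi x x'.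
    have := LEsmall x; have := LEsmall x'; have := ler_wpM2l (ltW k0) (Xi2 x x'); lra.
  have := ler_wpM2l (D0 x x') hs; have := ler_wpM2l Xi0 (good x x' xg xg').
  by move: cross; have := mulr_ge0 (ltW k0) DX; rewrite -/(Xi x x'); lra.
Qed.

End FastCriterion.

Lemma dist_le_range (R : realDomainType) (a b c : R) :
  0 <= a <= c -> 0 <= b <= c -> `|a - b| <= c.
Proof. by rewrite ler_norml; lra. Qed.

(** * Distances that are sums over links *)

Section AdditiveDistance.
Variables (R : realType) (K n : nat).
Notation config := {ffun 'I_n -> 'I_K.+1}.
Implicit Types (x y : config) (j : 'I_n) (i : 'I_K.+1).
Variable H : nat -> R.

(** The identity [H] gives the l1 distance; a convex [H] charges more near capacity. *)
Definition hdist (i i' : nat) : R := `|H i - H i'|.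
Definition hsum x x' : R := \sum_j hdist (x j) (x' j).

Lemma hdistC (i i' : nat) : hdist i i' = hdist i' i.
Proof. by rewrite /hdist distrC. Qed.

Lemma hsumC x x' : hsum x x' = hsum x' x.
Proof. by apply: eq_bigr => j _; exact: hdistC. Qed.

Lemma hsum_ge0 x x' : 0 <= hsum x x'.
Proof. by apply: sumr_ge0 => j _; exact: normr_ge0. Qed.

Lemma sum_upd (f : 'I_n -> 'I_K.+1 -> R) x j i :
  \sum_k f k (upd x j i k) - \sum_k f k (x k) = f j i - f j (x j).
Proof.
rewrite (bigD1 j) //= [X in _ - X](bigD1 j) //= updE eqxx.
rewrite (eq_bigr (fun k => f k (x k))); last by move=> k /negPf kj; rewrite updE kj.
by ring.
Qed.

Lemma hsum_upd x x' j i i' :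
  hsum (upd x j i) (upd x' j i') - hsum x x' = hdist i i' - hdist (x j) (x' j).
Proof.
rewrite /hsum (bigD1 j) //= [X in _ - X](bigD1 j) //= !updE eqxx.
rewrite (eq_bigr (fun k => hdist (x k) (x' k))); last by move=> k /negPf kj; rewrite !updE kj.
by ring.
Qed.

Lemma hsum_updl x x' j i :
  hsum (upd x j i) x' - hsum x x' = hdist i (x' j) - hdist (x j) (x' j).
Proof. by rewrite -{1}(upd_id x' j) hsum_upd. Qed.

Lemma hsum_updr x x' j i' :
  hsum x (upd x' j i') - hsum x x' = hdist (x j) i' - hdist (x j) (x' j).
Proof. by rewrite -{1}(upd_id x j) hsum_upd. Qed.

Lemma hsum_le (C : R) x x' : (forall i i', hdist i i' <= C) -> hsum x x' <= C * n%:R.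
Proof.
move=> hC; have -> : C * n%:R = \sum_(j < n) C by rewrite sumr_const card_ord mulr_natr.
by apply: ler_sum.
Qed.

Definition dec_drift (i i' : 'I_K.+1) : R :=
  \sum_(l < K) (hdist (dec l i) (dec l i') - hdist i i').

Lemma cpl_hsum (B : config -> R) x x' : let m := Num.min (B x) (B x') in
  cpl_op B hsum x x' = \sum_j
    (m * (hdist (inc (x j)) (inc (x' j)) - hdist (x j) (x' j))
    + (B x - m) * (hdist (inc (x j)) (x' j) - hdist (x j) (x' j))
    + (B x' - m) * (hdist (x j) (inc (x' j)) - hdist (x j) (x' j))
    + dec_drift (x j) (x' j)).
Proof.
move=> m; rewrite /cpl_op; apply: eq_bigr => j _.
by rewrite hsum_upd hsum_updl hsum_updr; congr (_ + _); apply: eq_bigr => l _; rewrite hsum_upd.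
Qed.

Hypothesis H_mono : {homo H : i i' / (i <= i')%N >-> i <= i'}.

Lemma dec_driftE (i i' : 'I_K.+1) : (i <= i')%N ->
  dec_drift i i' = i'%:R * (H i'.-1 - H i') - i%:R * (H i.-1 - H i).
Proof.
move=> ii'; rewrite /dec_drift.
have E (k : 'I_K.+1) : k%:R * (H k.-1 - H k) = \sum_(l < K) (H (dec l k) - H k).
  rewrite (sum_dec (fun k : 'I_K.+1 => H k)) inordK //.
  exact: leq_ltn_trans (leq_pred _) (ltn_ord _).
rewrite !E -sumrB; apply: eq_bigr => l _; rewrite /hdist.
have dii' : (dec l i <= dec l i')%N by rewrite !val_dec; lia.
rewrite (ler0_norm (_ : H i - H i' <= 0)) ?subr_le0 ?H_mono //.
by rewrite (ler0_norm (_ : H (dec l i) - _ <= 0)) ?subr_le0 ?H_mono //; ring.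
Qed.

Lemma dec_driftC (i i' : 'I_K.+1) : dec_drift i i' = dec_drift i' i.
Proof. by apply: eq_bigr => l _; rewrite (hdistC i) (hdistC (dec l i)). Qed.

Section Crude.
Variable W : R.
Hypothesis W_ge1 : 1 <= W.
Hypothesis H_lip : forall k : nat, (k < K)%N -> 1 <= H k.+1 - H k <= W.

Lemma hdist_ge1 i i' : i != i' -> 1 <= hdist i i'.
Proof.
wlog ii' : i i' / (i < i')%N => [wl|] neq.
  have [lt|gt|/val_inj eq] := ltngtP i i'; first exact: wl.
    by rewrite hdistC; apply: wl => //; rewrite eq_sym.
  by rewrite eq eqxx in neq.
have iK : (i < K)%N by rewrite (leq_trans ii') // -ltnS.
have /andP[H1 _] := H_lip iK; have H2 : H i.+1 <= H i' by exact: H_mono.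
by rewrite /hdist distrC ger0_norm; lra.
Qed.

Lemma hsum_ge1 x x' : x != x' -> 1 <= hsum x x'.
Proof.
move=> xx'; have [j xj] : exists j, x j != x' j.
  apply/existsP; rewrite -negb_forall; apply: contra xx' => /forallP xx'.
  by apply/eqP/ffunP => j; apply/eqP.
rewrite /hsum (bigD1 j) //= (le_trans (hdist_ge1 xj)) // lerDl.
by apply: sumr_ge0 => k _; exact: normr_ge0.
Qed.

Lemma H_inc i : `|H (inc i) - H i| <= W.
Proof.
have w1 := W_ge1; rewrite val_inc; case: (ltnP i K) => iK.
  rewrite (minn_idPl iK); have /andP[H1 H2] := H_lip iK.
  by rewrite ger0_norm //; lra.
have -> : minn i.+1 K = i :> nat by have := ltn_ord i; lia.
by rewrite subrr normr0; lra.
Qed.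

Lemma H_dec l i : `|H (dec l i) - H i| <= W.
Proof.
have w1 := W_ge1; rewrite val_dec; case: (ltnP l i) => li; last first.
  by rewrite subn0 subrr normr0; lra.
have i0 : (0 < i)%N by exact: leq_ltn_trans li.
have iK : (i.-1 < K)%N by rewrite prednK // -ltnS.
have /andP[H1 H2] := H_lip iK; rewrite prednK // in H1 H2.
by rewrite subn1 distrC ger0_norm //; lra.
Qed.

Lemma hdist_move a b i i' : `|H a - H i| <= W -> `|H b - H i'| <= W ->
  `|hdist a b - hdist i i'| <= 2 * W.
Proof.
move=> Ha Hb; rewrite /hdist; apply: (le_trans (ler_dist_dist _ _)).
have -> : H a - H b - (H i - H i') = (H a - H i) - (H b - H i') by ring.
by apply: (le_trans (ler_normB _ _)); lra.
Qed.

Lemma hdist_move1 a i i' : `|H a - H i| <= W -> `|hdist a i' - hdist i i'| <= W.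
Proof.
move=> Ha; apply: (le_trans (ler_dist_dist _ _)).
by have -> : H a - H i' - (H i - H i') = (H a - H i) by ring.
Qed.

(** Shared moves matter only where the coordinates differ, and there the distance is at least 1, so
    they cost at most a multiple of it. Surplus arrivals also separate equal coordinates; their
    total rate [n * |B x - B x'|] is what the hypothesis with [L] bounds by the distance. *)
Lemma cpl_abs_hsum (B : config -> R) (M L : R) x x' : 0 <= L ->
  (forall x, 0 <= B x <= M) ->
  n%:R * `|B x - B x'| <= L * hsum x x' ->
  cpl_abs B hsum x x' <= (2 * W * (M + K%:R) + W * L) * hsum x x'.
Proof.
have w1 := W_ge1; move=> L0 BM BL; rewrite /cpl_abs; set m := Num.min _ _.
have m0 : 0 <= m by rewrite le_min; have /andP[-> _] := BM x; have /andP[-> _] := BM x'.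
have mM : m <= M by rewrite ge_min; have /andP[_ ->] := BM x.
have mx : 0 <= B x - m by rewrite subr_ge0 ge_min lexx.
have mx' : 0 <= B x' - m by rewrite subr_ge0 ge_min lexx orbT.
have Bm : (B x - m) + (B x' - m) = `|B x - B x'|.
  rewrite /m; have [le|gt] := leP (B x) (B x').
    by rewrite ler0_norm; lra.
  by rewrite gtr0_norm; lra.
apply: le_trans (_ : \sum_j ((2 * W * (M + K%:R)) * hdist (x j) (x' j)
    + W * `|B x - B x'|) <= _); last first.
  rewrite big_split /= -mulr_sumr -/(hsum x x').
  rewrite sumr_const card_ord -[_ *+ n]mulr_natl.
  have W0 : 0 <= W by lra.
  by have := ler_wpM2l W0 BL; lra.
apply: ler_sum => j _; rewrite hsum_upd hsum_updl hsum_updr.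
under eq_bigr => l _ do rewrite hsum_upd.
set d := hdist (x j) (x' j); have d0 : 0 <= d by exact: normr_ge0.
have e2 : `|hdist (inc (x j)) (x' j) - d| <= W by rewrite /d; apply: hdist_move1; exact: H_inc.
have e3 : `|hdist (x j) (inc (x' j)) - d| <= W.
  by rewrite /d hdistC (hdistC (x j)); apply: hdist_move1; exact: H_inc.
have e1 : `|hdist (inc (x j)) (inc (x' j)) - d| <= 2 * W * d.
  have [E|ne] := eqVneq (x j) (x' j).
    by rewrite /d E /hdist !subrr !normr0 !mulr0.
  apply: le_trans (_ : 2 * W <= _); first by rewrite /d; apply: hdist_move; exact: H_inc.
  by rewrite ler_peMr ?(hdist_ge1 ne) //; lra.
have e4 : \sum_(l < K) `|hdist (dec l (x j)) (dec l (x' j)) - d| <= K%:R * (2 * W * d).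
  have -> : K%:R * (2 * W * d) = \sum_(l < K) (2 * W * d).
    by rewrite sumr_const card_ord mulr_natl.
  apply: ler_sum => l _; have [E|ne] := eqVneq (x j) (x' j).
    by rewrite /d E /hdist !subrr !normr0 !mulr0.
  apply: le_trans (_ : 2 * W <= _); first by rewrite /d; apply: hdist_move; exact: H_dec.
  by rewrite ler_peMr ?(hdist_ge1 ne) //; lra.
have := ler_wpM2l mx e2; have := ler_wpM2l mx' e3.
have : m * `|hdist (inc (x j)) (inc (x' j)) - d| <= M * (2 * W * d).
  by apply: ler_pM.
rewrite -Bm; lra.
Qed.

End Crude.
End AdditiveDistance.

Section FullFraction.
Variables (R : realType) (K n : nat).
Notation config := {ffun 'I_n -> 'I_K.+1}.
Implicit Types (x y : config).

Let full (x : config) (j : 'I_n) : R := (x j == K :> nat)%:R.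

Lemma full_fractionE x : full_fraction R x = (\sum_j full x j) / n%:R.
Proof.
rewrite /full_fraction -sum1_card natr_sum big_mkcond /=; congr (_ / _).
by apply: eq_bigr => j _; rewrite /full inE; case: eqP.
Qed.

Lemma full_fraction01 x : 0 <= full_fraction R x <= 1.
Proof.
rewrite full_fractionE; have s0 : 0 <= \sum_j full x j by apply: sumr_ge0 => j _; exact: ler0n.
rewrite divr_ge0 //=; have [n0|n0] := posnP n; first by rewrite [X in X%:R]n0 invr0 mulr0 ler01.
rewrite ler_pdivrMr ?ltr0n // mul1r.
have -> : n%:R = \sum_(j < n) 1 :> R by rewrite sumr_const card_ord.
by apply: ler_sum => j _; rewrite /full; case: eqP.
Qed.

Definition only_l x y : R := \sum_j ((x j == K :> nat) && (y j != K :> nat))%:R.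

Lemma only_l_ge0 x y : 0 <= only_l x y.
Proof. by apply: sumr_ge0 => j _; exact: ler0n. Qed.

Lemma full_fraction_diff x y : (0 < n)%N ->
  n%:R * full_fraction R x - n%:R * full_fraction R y = only_l x y - only_l y x.
Proof.
move=> n0; have nR : n%:R != 0 :> R by rewrite pnatr_eq0 -lt0n.
rewrite !full_fractionE !(mulrC n%:R) !divfK // -!sumrB; apply: eq_bigr => j _.
rewrite /full; case: eqP; case: eqP => _ _ /=; lra.
Qed.

Lemma only_l_le (H : nat -> R) (W : R) x y : {homo H : i i' / (i <= i')%N >-> i <= i'} ->
  (forall k : nat, (k < K)%N -> 1 <= H k.+1 - H k <= W) ->
  only_l x y + only_l y x <= hsum H x y.
Proof.
move=> Hm Hl; rewrite /only_l /hsum -big_split; apply: ler_sum => j _ /=.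
have [E|ne] := eqVneq (x j) (y j).
  by rewrite E !andbN addr0 normr_ge0.
apply: le_trans (hdist_ge1 Hm Hl ne).
by case: eqP => [xK|_]; case: eqP => [yK|_] /=; rewrite ?addr0 ?add0r ?ler01.
Qed.

Lemma full_fraction_lip (H : nat -> R) (W : R) x y : (0 < n)%N ->
  {homo H : i i' / (i <= i')%N >-> i <= i'} ->
  (forall k : nat, (k < K)%N -> 1 <= H k.+1 - H k <= W) ->
  n%:R * `|full_fraction R x - full_fraction R y| <= hsum H x y.
Proof.
move=> n0 Hm Hl; apply: le_trans (only_l_le x y Hm Hl).
rewrite -[X in X * _]ger0_norm ?ler0n // -normrM mulrBr full_fraction_diff //.
have := only_l_ge0 x y; have := only_l_ge0 y x => a0 b0.
by apply: (le_trans (ler_normB _ _)); rewrite !ger0_norm.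
Qed.

End FullFraction.

Section Ell1.
Variables (R : realType) (K n : nat).
Notation config := {ffun 'I_n -> 'I_K.+1}.
Implicit Types (x y : config).
Local Notation ell1 := (hsum (fun i : nat => i%:R : R)).
Local Notation phi := (full_fraction R).

Lemma natr_homo : {homo (fun i : nat => i%:R : R) : i i' / (i <= i')%N >-> i <= i'}.
Proof. by move=> i i' ii'; rewrite ler_nat. Qed.

Lemma natr_lip (k : nat) : (1 : R) <= (k.+1%:R : R) - k%:R <= 1.
Proof. by rewrite -natr1 addrC addKr lexx. Qed.

Lemma ell1_le x x' : ell1 x x' <= K%:R * n%:R.
Proof.
by apply: hsum_le => i i'; apply: dist_le_range; rewrite ler0n ler_nat -ltnS /=.
Qed.

Lemma cpl_op_sym (B : config -> R) (D : config -> config -> R) x x' :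
  (forall x x', D x x' = D x' x) -> cpl_op B D x x' = cpl_op B D x' x.
Proof.
move=> Ds; rewrite /cpl_op minC; apply: eq_bigr => j _.
rewrite (Ds (up j x) (up j x')) (Ds (up j x) x') (Ds x (up j x')) (Ds x x').
rewrite (eq_bigr (fun l => D (dn l j x') (dn l j x) - D x' x)); first by ring.
by move=> l _; rewrite (Ds (dn l j x)).
Qed.

(** Departures alone contract at rate 1, so it remains that arrivals do not increase the distance.
    Let [a] and [c] count the links full only in [x'] and only in [x]. Shared arrivals reduce it by
    [B x' * (a + c)], the surplus [B x - B x'] increases it by at most [n * (1 - phi x) - 2 * a] per
    unit, and [n * (phi x - phi x') = c - a]. The two last hypotheses are what the two signs of
    [c - a] require. *)
Lemma ell1_contract_le (B : config -> R) x x' : (0 < n)%N -> 0 <= B x' -> B x' <= B x ->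
  (phi x' <= phi x -> B x * (1 - phi x) <= B x' * (1 - phi x')) ->
  (phi x < phi x' -> B x * (1 - phi x') <= B x' * (1 - phi x)) ->
  cpl_op B ell1 x x' <= - ell1 x x'.
Proof.
move=> n0 B0 BB anti cross; rewrite cpl_hsum.
have -> : Num.min (B x) (B x') = B x' by exact/min_idPr.
pose d (i i' : nat) : R := hdist (fun i : nat => i%:R) i i'.
pose nK (i : 'I_K.+1) : R := (i != K :> nat)%:R.
have natd (i i' : nat) : (i' <= i)%N -> d i i' = i%:R - i'%:R.
  by move=> le; rewrite /d /hdist ger0_norm // subr_ge0 ler_nat.
have natd' (i i' : nat) : (i <= i')%N -> d i i' = i'%:R - i%:R.
  by move=> le; rewrite /d hdistC; exact: natd.
have dd (i i' : 'I_K.+1) : dec_drift (fun i : nat => i%:R) i i' = - d i i'.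
  have E (a b : 'I_K.+1) : (a <= b)%N -> dec_drift (fun i : nat => i%:R) a b = - d a b.
    move=> ab; rewrite (dec_driftE natr_homo) // natd' //.
    have P (k : nat) : k%:R * (k.-1%:R - k%:R) = - k%:R :> R.
      by case: k => [|k]; rewrite ?mul0r ?oppr0 //= -natr1; ring.
    by rewrite !P; ring.
  by have [ii'|/ltnW ii'] := leqP i i'; [exact: E|rewrite dec_driftC E // /d hdistC].
have dboth (i i' : 'I_K.+1) : d (inc i) (inc i') - d i i' =
   - (((i == K :> nat) && (i' != K :> nat))%:R + ((i' == K :> nat) && (i != K :> nat))%:R).
  have iK := ltn_ord i; have iK' := ltn_ord i'; rewrite !val_inc.
  have [E|ne] := eqVneq (i : nat) K; have [E'|ne'] := eqVneq (i' : nat) K => /=.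
  - by rewrite E E' (minn_idPr _) // /d /hdist !subrr addr0 oppr0.
  - have lt : (i' < K)%N by lia.
    rewrite E (minn_idPr _) // (minn_idPl lt) !natd; [|lia..].
    by rewrite -natr1; ring.
  - have lt : (i < K)%N by lia.
    rewrite E' (minn_idPr (leqnSn _)) // (minn_idPl lt) !natd'; [|lia..].
    by rewrite -natr1; ring.
  - have lt : (i < K)%N by lia. have lt' : (i' < K)%N by lia.
    rewrite (minn_idPl lt) (minn_idPl lt') /d /hdist -!natr1.
    have -> : i%:R + 1 - (i'%:R + 1) = i%:R - i'%:R :> R by ring.
    by rewrite subrr addr0 oppr0.
have dleft (i i' : 'I_K.+1) : d (inc i) i' - d i i' <= nK i - 2 * ((i' == K :> nat) && (i != K :> nat))%:R.
  have iK := ltn_ord i; have iK' := ltn_ord i'; rewrite val_inc /nK.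
  have [E|ne] := eqVneq (i : nat) K => /=.
    by rewrite E (minn_idPr (leqnSn _)) subrr andbF mulr0 subr0.
  have lt : (i < K)%N by lia.
  rewrite (minn_idPl lt) andbT; have [E'|ne'] := eqVneq (i' : nat) K => /=.
    by rewrite !natd'; [rewrite -natr1; lra|lia..].
  have [le|gt] := leqP i' i.
    by rewrite !natd; [rewrite -natr1; lra|lia..].
  by rewrite !natd'; [rewrite -natr1; lra|lia..].
pose a := only_l R x' x; pose c := only_l R x x'.
have a0 : 0 <= a by exact: only_l_ge0.
have c0 : 0 <= c by exact: only_l_ge0.
have nKE : \sum_j nK (x j) = n%:R * (1 - phi x).
  rewrite mulrBr mulr1 full_fractionE mulrC divfK ?pnatr_eq0 -?lt0n //.
  have -> : n%:R = \sum_(j < n) 1 :> R by rewrite sumr_const card_ord.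
  by rewrite -sumrB; apply: eq_bigr => j _; rewrite /nK; case: eqP => _ /=; rewrite ?subrr ?subr0.
apply: le_trans (_ : - (B x' * (c + a)) + (B x - B x') * (n%:R * (1 - phi x) - 2 * a)
   - ell1 x x' <= _); last first.
  have F := @full_fraction_diff R K n x x' n0; rewrite -/a -/c in F.
  have nR : 0 < n%:R :> R by rewrite ltr0n.
  suff : - (B x' * (c + a)) + (B x - B x') * (n%:R * (1 - phi x) - 2 * a) <= 0 by lra.
  have [le|gt] := leP (phi x') (phi x).
    have := ler_wpM2l (ltW nR) (anti le); have := mulr_ge0 B0 a0.
    have := mulr_ge0 (_ : 0 <= B x - B x') a0; rewrite subr_ge0 => /(_ BB); nra.
  have := ler_wpM2l (ltW nR) (cross gt).
  have : n%:R * phi x < n%:R * phi x' by rewrite ltr_pM2l.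
  have := mulr_ge0 B0 a0; have := mulr_ge0 B0 c0.
  have := mulr_ge0 (le_trans B0 BB) a0; have := mulr_ge0 (le_trans B0 BB) c0; nra.
pose cj j : R := ((x j == K :> nat) && (x' j != K :> nat))%:R.
pose aj j : R := ((x' j == K :> nat) && (x j != K :> nat))%:R.
have -> : - (B x' * (c + a)) + (B x - B x') * (n%:R * (1 - phi x) - 2 * a) - ell1 x x' =
    \sum_j (- (B x' * (cj j + aj j)) + (B x - B x') * (nK (x j) - 2 * aj j) - d (x j) (x' j)).
  by rewrite sumrB big_split /= sumrN -!mulr_sumr big_split /= sumrB -mulr_sumr nKE.
apply: ler_sum => j _.
rewrite dd -!/(d _ _) dboth subrr mul0r addr0.
have := ler_wpM2l (_ : 0 <= B x - B x') (dleft (x j) (x' j)); rewrite subr_ge0 => /(_ BB).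
by rewrite -/(cj j) -/(aj j); lra.
Qed.

(** For the routing chain the last condition is [gain_cross_le] and holds everywhere; it is the
    other one, decreasing throughput, that confines the pair to a region [P]. *)
Lemma ell1_contract (B : config -> R) (P : config -> Prop) : (0 < n)%N ->
  (forall x, 0 <= B x) ->
  (forall x x', P x -> P x' -> B x' <= B x -> phi x' <= phi x ->
     B x * (1 - phi x) <= B x' * (1 - phi x')) ->
  (forall x x', phi x < phi x' -> B x * (1 - phi x') <= B x' * (1 - phi x)) ->
  forall x x', P x -> P x' -> cpl_op B ell1 x x' <= - ell1 x x'.
Proof.
move=> n0 B0 anti cross x x' Px Px'.
have [le|/ltW le] := leP (B x') (B x); first by apply: ell1_contract_le; auto.
rewrite cpl_op_sym; last by exact: hsumC.
by rewrite hsumC; apply: ell1_contract_le; auto.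
Qed.

End Ell1.

(** * Fast mixing above full load *)

Section SmoothAbs.
Variables (R : realType) (del : R).
Hypothesis del_gt0 : 0 < del.
Implicit Types z h : R.

(** The kink of the absolute value would cost an error of first order in the drift; with curvature
    at most [1 / del], links moving by [1 / n] contribute only order [1 / (del * n)]. *)
Definition sabs z : R := Num.sqrt (z ^+ 2 + del ^+ 2).
Definition slope z : R := z / sabs z.

Let d2 : 0 < del ^+ 2. Proof. by rewrite exprn_gt0. Qed.

Lemma sabs_sqr z : sabs z ^+ 2 = z ^+ 2 + del ^+ 2.
Proof. by rewrite sqr_sqrtr // addr_ge0 ?sqr_ge0. Qed.

Lemma sabs_gt0 z : 0 < sabs z.
Proof. by rewrite sqrtr_gt0 ltr_wpDl // sqr_ge0. Qed.

Lemma sabs0 : sabs 0 = del.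
Proof. by rewrite /sabs expr0n add0r sqrtr_sqr gtr0_norm. Qed.

Lemma sabs_ge z : `|z| <= sabs z.
Proof. by rewrite -sqrtr_sqr ler_wsqrtr // lerDl ltW. Qed.

Lemma sabs_ge_del z : del <= sabs z.
Proof. by rewrite -{1}sabs0 ler_wsqrtr // expr0n add0r lerDr sqr_ge0. Qed.

Lemma slope_le1 z : `|slope z| <= 1.
Proof.
by rewrite normrM normfV (gtr0_norm (sabs_gt0 z)) ler_pdivrMr ?sabs_gt0 // mul1r sabs_ge.
Qed.

Lemma sabs_convex z z' : slope z * (z' - z) <= sabs z' - sabs z.
Proof.
have S0 := sabs_gt0 z; have S0' := sabs_gt0 z'.
(* Cauchy-Schwarz for the vectors [(z, del)] and [(z', del)]. *)
have CS : z * z' + del ^+ 2 <= sabs z * sabs z'.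
  have P : 0 <= sabs z * sabs z' by rewrite mulr_ge0 // ltW.
  apply: (le_trans (ler_norm _)); rewrite -(@ler_pXn2r _ 2) ?nnegrE //.
  rewrite real_normK ?num_real // exprMn !sabs_sqr.
  rewrite -subr_ge0.
  have -> : (z ^+ 2 + del ^+ 2) * (z' ^+ 2 + del ^+ 2) - (z * z' + del ^+ 2) ^+ 2
     = (del * (z - z')) ^+ 2 by ring.
  exact: sqr_ge0.
rewrite -(ler_pM2r S0) mulrAC divfK ?gt_eqF // mulrBl -!expr2 sabs_sqr.
by lra.
Qed.

Lemma sabs_taylor z h : sabs (z + h) - sabs z <= slope z * h + h ^+ 2 / (2 * del).
Proof.
have dg := del_gt0; have S0 := sabs_gt0 z; have Sd := sabs_ge_del z; have S2 := sabs_sqr z.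
set S := sabs z in S0 Sd S2 *.
have le1 : sabs (z + h) <= S + (2 * z * h + h ^+ 2) / (2 * S).
  have E : S + (2 * z * h + h ^+ 2) / (2 * S) = (2 * S ^+ 2 + 2 * z * h + h ^+ 2) / (2 * S).
    by field; rewrite gt_eqF.
  have N0 : 0 <= 2 * S ^+ 2 + 2 * z * h + h ^+ 2.
    by rewrite S2; have := sqr_ge0 (z + h); have := sqr_ge0 z; have := d2; nra.
  have S20 : 0 < 2 * S by rewrite mulr_gt0.
  have P : 0 <= sabs (z + h) * (2 * S) by rewrite mulr_ge0 // ltW // sabs_gt0.
  rewrite E ler_pdivlMr // -(@ler_pXn2r _ 2) ?nnegrE //.
  rewrite exprMn sabs_sqr.
  have -> : (z + h) ^+ 2 + del ^+ 2 = S ^+ 2 + (2 * z * h + h ^+ 2) by rewrite S2; ring.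
  have := sqr_ge0 (2 * z * h + h ^+ 2); set q := 2 * z * h + h ^+ 2.
  have -> : 2 * S ^+ 2 + 2 * z * h + h ^+ 2 = 2 * S ^+ 2 + q by rewrite /q; ring.
  by nra.
have le2 : h ^+ 2 / (2 * S) <= h ^+ 2 / (2 * del).
  by rewrite ler_wpM2l ?sqr_ge0 // lef_pV2 ?posrE ?mulr_gt0 //; lra.
have E : (2 * z * h + h ^+ 2) / (2 * S) = slope z * h + h ^+ 2 / (2 * S).
  by rewrite /slope -/S; field; rewrite gt_eqF.
by rewrite E in le1; lra.
Qed.

Lemma sabs_lip z h : `|sabs (z + h) - sabs z| <= `|h|.
Proof.
rewrite ler_norml; apply/andP; split.
  have := sabs_convex z (z + h); have -> : z + h - z = h by ring.
  have : `|slope z * h| <= `|h|.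
    by rewrite normrM -[leRHS]mul1r; apply: ler_wpM2r => //; exact: slope_le1.
  by rewrite ler_norml => /andP[]; lra.
have := sabs_convex (z + h) z; have -> : z - (z + h) = - h by ring.
have : `|slope (z + h) * h| <= `|h|.
  by rewrite normrM -[leRHS]mul1r; apply: ler_wpM2r => //; exact: slope_le1.
by rewrite ler_norml mulrN => /andP[]; lra.
Qed.

End SmoothAbs.

Section TailDistance.
Variables (R : realType) (K n : nat) (del : R) (w : nat -> R).
Notation config := {ffun 'I_n -> 'I_K.+1}.
Implicit Types (x y : config).
Hypothesis del_gt0 : 0 < del.
Hypothesis n_gt0 : (0 < n)%N.
Hypothesis w_ge0 : forall k, 0 <= w k.
Hypothesis w_sum : \sum_(k < K.+1) w k = 1.

Definition tail x (k : nat) : R := (\sum_j (k <= x j)%:R) / n%:R.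
Definition level x (k : nat) : R := (\sum_j (x j == k :> nat)%:R) / n%:R.
Definition wtail (k : nat) : R := \sum_(k <= i < K.+1) w i.
Definition excess x k : R := tail x k - wtail k.
Definition tdist x : R := \sum_(k < K) sabs del (excess x k.+1).

Let nR : 0 < n%:R :> R. Proof. by rewrite ltr0n. Qed.

Lemma levelE x k : level x k = tail x k - tail x k.+1.
Proof.
rewrite /level /tail -mulrBl -sumrB; congr (_ / _); apply: eq_bigr => j _.
by rewrite [(k <= x j)%N]leq_eqVlt eq_sym; case: eqP => [->|_] /=; rewrite ?ltnn ?subr0 ?subrr.
Qed.

Lemma tail0 x : tail x 0 = 1.
Proof.
rewrite /tail (eq_bigr (fun=> 1)) // sumr_const card_ord divff //.
by rewrite pnatr_eq0 -lt0n.
Qed.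

Lemma tail_max x : tail x K.+1 = 0.
Proof.
rewrite /tail big1 ?mul0r // => j _.
by rewrite leqNgt ltn_ord.
Qed.

Lemma level_full x : level x K = full_fraction R x.
Proof. by rewrite full_fractionE. Qed.

Lemma level_ge0 x k : 0 <= level x k.
Proof. by rewrite divr_ge0 //; apply: sumr_ge0 => j _; exact: ler0n. Qed.

Lemma wtailE k : (k <= K)%N -> wtail k - wtail k.+1 = w k.
Proof. by move=> kK; rewrite /wtail big_ltn // addrK. Qed.

Lemma excess0 x : excess x 0 = 0.
Proof. by rewrite /excess tail0 /wtail big_mkord w_sum subrr. Qed.

Lemma excess_max x : excess x K.+1 = 0.
Proof. by rewrite /excess tail_max /wtail big_geq // subrr. Qed.

Lemma level_excess x k : (k <= K)%N ->
  level x k = w k + (excess x k - excess x k.+1).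
Proof. by move=> kK; rewrite levelE -(wtailE kK) /excess; ring. Qed.

Lemma excess_full x : excess x K = full_fraction R x - w K.
Proof.
by have := level_excess x (leqnn K); rewrite excess_max level_full; lra.
Qed.

Lemma excess_upd x j i k : excess (upd x j i) k - excess x k =
  ((k <= i)%:R - (k <= x j)%:R) / n%:R.
Proof.
have := sum_upd (fun _ (i : 'I_K.+1) => (k <= i)%:R : R) x j i.
move/(congr1 (fun z => z / n%:R)); rewrite mulrBl => <-.
by rewrite /excess /tail; ring.
Qed.

(** A move by one position changes a single tail, which is why [tdist] changes by at most
    [1 / n]. *)
Let step_sum (a i : 'I_K.+1) : (a <= i.+1)%N -> (i <= a.+1)%N ->
  \sum_(k < K) `|(k.+1 <= a)%:R - (k.+1 <= i)%:R| <= 1 :> R.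
Proof.
move=> ai ia; have aK := ltn_ord a; have iK := ltn_ord i.
have [E|ne] := eqVneq (a : nat) i.
  by rewrite big1 ?ler01 // => k _; rewrite E subrr normr0.
pose m := minn a i; have mK : (m < K)%N by rewrite /m; lia.
rewrite (bigD1 (Ordinal mK)) //= big1 ?addr0.
  by case: (_ <= _)%N; case: (_ <= _)%N; rewrite ?subrr ?subr0 ?sub0r ?normrN ?normr0 ?normr1 ?ler01.
move=> k km; have {}km : (k : nat) <> m by move=> E; case/eqP: km; apply/val_inj.
suff -> : (k.+1 <= a)%N = (k.+1 <= i)%N by rewrite subrr normr0.
by move: km; rewrite /m; lia.
Qed.

Let inc_near (i : 'I_K.+1) : (inc i <= i.+1)%N /\ (i <= (inc i).+1)%N.
Proof. by rewrite val_inc; have := ltn_ord i; split; lia. Qed.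

Let dec_near l (i : 'I_K.+1) : (dec l i <= i.+1)%N /\ (i <= (dec l i).+1)%N.
Proof. by rewrite val_dec; split; lia. Qed.

Let tdist_move x j (i : 'I_K.+1) : (i <= (x j).+1)%N -> (x j <= i.+1)%N ->
  `|tdist (upd x j i) - tdist x| <= n%:R^-1.
Proof.
move=> ix xi; rewrite /tdist -sumrB; apply: (le_trans (ler_norm_sum _ _ _)).
apply: le_trans (_ : \sum_(k < K) `|(k.+1 <= i)%:R - (k.+1 <= x j)%:R| / n%:R <= _).
  apply: ler_sum => k _; have := excess_upd x j i k.+1; set h := _ / _ => E.
  have -> : excess (upd x j i) k.+1 = excess x k.+1 + h by lra.
  apply: (le_trans (sabs_lip del_gt0 _ _)).
  by rewrite /h normrM normfV (gtr0_norm nR).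
rewrite -mulr_suml ler_pdivrMr // mulVf ?gt_eqF //; exact: step_sum.
Qed.

Lemma tdist_up x j : `|tdist (up j x) - tdist x| <= n%:R^-1.
Proof. by have [] := inc_near (x j); exact: tdist_move. Qed.

Lemma tdist_dn x l j : `|tdist (dn l j x) - tdist x| <= n%:R^-1.
Proof. by have [] := dec_near l (x j); exact: tdist_move. Qed.

Lemma tdist_full x : (0 < K)%N -> `|full_fraction R x - w K| <= tdist x.
Proof.
move=> K0; rewrite -excess_full; have K1 : (K.-1 < K)%N by rewrite prednK.
rewrite /tdist (bigD1 (Ordinal K1)) //= prednK // (le_trans (sabs_ge del_gt0 _)) // lerDl.
by apply: sumr_ge0 => k _; apply/ltW; exact: sabs_gt0.
Qed.

Lemma tdist_le x : tdist x <= K%:R * (1 + del).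
Proof.
have -> : K%:R * (1 + del) = \sum_(k < K) (1 + del) by rewrite sumr_const card_ord mulr_natl.
apply: ler_sum => k _.
have t0 : 0 <= tail x k.+1 by rewrite divr_ge0 //; apply: sumr_ge0.
have t1 : tail x k.+1 <= 1.
  rewrite -(tail0 x); apply: ler_wpM2r; first by rewrite invr_ge0 ltW.
  by apply: ler_sum => j _; case: ltnP.
have w0 : 0 <= wtail k.+1 by apply: sumr_ge0.
have w1 : wtail k.+1 <= 1.
  rewrite -w_sum /wtail (big_nat_widenl k.+1 0) //= big_mkord big_mkcond.
  by apply: ler_sum => i _; case: ifP.
have e1 : `|excess x k.+1| <= 1 by rewrite ler_norml /excess; apply/andP; split; lra.
have := sabs_lip del_gt0 0 (excess x k.+1); rewrite add0r sabs0 // ler_norml => /andP[_].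
by lra.
Qed.

Let slp x k := slope del (excess x k).

(* Linearise [tdist] at [x], up to the second-order term in [n^-2]. *)
Let Y x (i : nat) := \sum_(k < K) (k.+1 <= i)%:R * slp x k.+1.

Let tdist_lin x j (i : 'I_K.+1) : (i <= (x j).+1)%N -> (x j <= i.+1)%N ->
  tdist (upd x j i) - tdist x <= (Y x i - Y x (x j)) / n%:R + (2 * del * n%:R ^+ 2)^-1.
Proof.
move=> ix xi; rewrite /tdist -sumrB.
have d2n : 0 < 2 * del * n%:R ^+ 2 by rewrite !mulr_gt0 ?exprn_gt0.
apply: le_trans (_ : \sum_(k < K) (((k.+1 <= i)%:R - (k.+1 <= x j)%:R) * slp x k.+1 / n%:R
   + `|(k.+1 <= i)%:R - (k.+1 <= x j)%:R| / (2 * del * n%:R ^+ 2)) <= _).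
  apply: ler_sum => k _; pose u : R := (k.+1 <= i)%:R - (k.+1 <= x j)%:R; rewrite -!/u.
  have -> : excess (upd x j i) k.+1 = excess x k.+1 + u / n%:R.
    by rewrite /u -excess_upd; ring.
  apply: (le_trans (sabs_taylor del_gt0 _ _)); apply: lerD.
    by rewrite -/(slp x k.+1) mulrA [_ * u]mulrC.
  have -> : `|u| = u ^+ 2.
    by rewrite /u; case: (_ <= _)%N; case: (_ <= _)%N; rewrite ?subrr ?subr0 ?sub0r ?normrN ?normr0 ?normr1 ?sqrrN ?expr1n ?expr0n.
  rewrite le_eqVlt; apply/orP; left; apply/eqP.
  by field; rewrite !gt_eqF.
rewrite big_split /=; apply: lerD.
  rewrite -mulr_suml /Y -sumrB; apply: ler_wpM2r; first by rewrite invr_ge0 ltW.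
  by apply: ler_sum => k _; rewrite mulrBl.
rewrite -mulr_suml -[leRHS]mul1r; apply: ler_wpM2r; first by rewrite invr_ge0 ltW.
exact: step_sum.
Qed.

Let Y_inc x (i : 'I_K.+1) : Y x (inc i) - Y x i = \sum_(k < K) (i == k :> nat)%:R * slp x k.+1.
Proof.
rewrite /Y -sumrB; apply: eq_bigr => k _; rewrite -mulrBl; congr (_ * _).
rewrite val_inc; have kK := ltn_ord k; case: (ltngtP i k) => ik /=.
- have -> : (k < minn i.+1 K)%N = false by lia.
  by rewrite subrr.
- have -> : (k < minn i.+1 K)%N by lia.
  by rewrite subrr.
- have -> : (k < minn i.+1 K)%N by lia.
  by rewrite subr0.
Qed.

Let Y_pred x (i : 'I_K.+1) : i%:R * (Y x (inord i.-1 : 'I_K.+1) - Y x i) =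
  - \sum_(k < K) (i == k.+1 :> nat)%:R * (k.+1%:R * slp x k.+1).
Proof.
have iK := ltn_ord i; rewrite /Y -sumrB mulr_sumr -sumrN; apply: eq_bigr => k _.
rewrite inordK; last by exact: leq_ltn_trans (leq_pred _) _.
have [E|ne] := eqVneq (i : nat) k.+1.
  by rewrite E /= ltnn leqnn /= mul0r mul1r; ring.
have -> : (k < i.-1)%N = (k < i)%N by move/eqP: ne; lia.
by rewrite subrr mulr0 mul0r oppr0.
Qed.

(** The bracket is the net flow from level [k] to level [k + 1], the mean-field velocity of
    [tail x k.+1]; the last term is the curvature error. *)
Lemma tdist_drift (B : config -> R) x : 0 <= B x ->
  dar_op B tdist x <= \sum_(k < K) slp x k.+1 * (B x * level x k - k.+1%:R * level x k.+1)
    + (B x + K%:R) / (2 * del * n%:R).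
Proof.
move=> B0; pose a := (2 * del * n%:R ^+ 2)^-1.
have dn0 : 2 * del * n%:R != 0 by rewrite gt_eqF // !mulr_gt0.
have e1 j : tdist (up j x) - tdist x <= (Y x (inc (x j)) - Y x (x j)) / n%:R + a.
  by have [] := inc_near (x j); exact: tdist_lin.
have e2 l j : tdist (dn l j x) - tdist x <= (Y x (dec l (x j)) - Y x (x j)) / n%:R + a.
  by have [] := dec_near l (x j); exact: tdist_lin.
apply: le_trans (_ : \sum_j ((B x * (Y x (inc (x j)) - Y x (x j)) +
    (x j)%:R * (Y x (inord (x j).-1 : 'I_K.+1) - Y x (x j))) / n%:R + (B x + K%:R) * a) <= _).
  apply: ler_sum => j _; rewrite -(sum_dec (fun i : 'I_K.+1 => Y x i)).
  have := ler_wpM2l B0 (e1 j).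
  have : \sum_(l < K) (tdist (dn l j x) - tdist x) <=
      (\sum_(l < K) (Y x (dec l (x j)) - Y x (x j))) / n%:R + K%:R * a.
    have -> : K%:R * a = \sum_(l < K) a by rewrite sumr_const card_ord mulr_natl.
    by rewrite mulr_suml -big_split; apply: ler_sum => l _; exact: e2.
  by move: (\sum_(l < K) _) (\sum_(l < K) _) => s s'; lra.
rewrite big_split /=.
have -> : \sum_(j < n) (B x + K%:R) * a = (B x + K%:R) / (2 * del * n%:R).
  by rewrite sumr_const card_ord -mulr_natl /a; field; rewrite !gt_eqF.
rewrite lerD2r -mulr_suml ler_pdivrMr //.
rewrite (eq_bigr (fun j => \sum_(k < K) (B x * ((x j == k :> nat)%:R * slp x k.+1)
    + - ((x j == k.+1 :> nat)%:R * (k.+1%:R * slp x k.+1))))); last first.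
  by move=> j _; rewrite Y_inc Y_pred mulr_sumr -sumrN -big_split.
rewrite exchange_big mulr_suml; apply: ler_sum => k _ /=.
rewrite le_eqVlt; apply/orP; left; apply/eqP.
rewrite big_split /= sumrN -mulr_sumr -!mulr_suml /level.
by field; rewrite gt_eqF.
Qed.

Variable b : R.
Hypothesis b_ge0 : 0 <= b.
(* [w] is the stationary law of a single link with constant arrival rate [b]. *)
Hypothesis w_balance : forall k, (k < K)%N -> k.+1%:R * w k.+1 = b * w k.

Let abel (S : nat -> R) m : \sum_(k < m) k.+1%:R * (S k.+2 - S k.+1) =
  m%:R * S m.+1 - \sum_(k < m) S k.+1.
Proof.
elim: m => [|m IH]; first by rewrite !big_ord0 mul0r subrr.
by rewrite !big_ord_recr /= IH -natr1; ring.
Qed.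

(** Measured against the stationary flow, arrivals contribute a discrete gradient of [excess] with
    coefficient [c] plus [(B - b) * g], and departures a gradient with coefficient [k + 1]. By
    convexity of [sabs] the first gradient telescopes, and the second, summed by parts, yields
    [- tdist x]. *)
Let main_bound x (B c G : R) (g : nat -> R) : 0 <= c -> (forall k, (k < K)%N -> 0 <= g k) ->
  \sum_(k < K) g k = G ->
  (forall k, (k < K)%N -> B * level x k - b * w k =
      c * (excess x k - excess x k.+1) + (B - b) * g k) ->
  \sum_(k < K) slp x k.+1 * (B * level x k - k.+1%:R * level x k.+1) <=
    c * (del - sabs del (excess x K)) + `|B - b| * G + K%:R * del - tdist x.
Proof.
move=> c0 g0 gG E; pose S k := sabs del (excess x k).
have -> : c * (del - sabs del (excess x K)) = \sum_(k < K) c * (S k - S k.+1).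
  rewrite -mulr_sumr; congr (_ * _).
  have -> : \sum_(k < K) (S k - S k.+1) = - \sum_(0 <= k < K) (S k.+1 - S k).
    by rewrite big_mkord -sumrN; apply: eq_bigr => k _; rewrite opprB.
  by rewrite telescope_sumr // /S excess0 sabs0 // opprB.
have ZE : K%:R * del - tdist x = \sum_(k < K) k.+1%:R * (S k.+2 - S k.+1).
  by rewrite abel /S excess_max sabs0.
rewrite -addrA ZE -gG mulr_sumr -big_split /=.
rewrite -big_split /=; apply: ler_sum => k _.
have kK := ltn_ord k.
have -> : B * level x k - k.+1%:R * level x k.+1 =
   c * (excess x k - excess x k.+1) + (B - b) * g k
   + k.+1%:R * (excess x k.+2 - excess x k.+1).
  rewrite -(E _ kK) (level_excess x kK) -(w_balance kK); ring.
have c1 := ler_wpM2l c0 (sabs_convex del_gt0 (excess x k.+1) (excess x k)).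
have c2 := ler_wpM2l (ler0n R k.+1) (sabs_convex del_gt0 (excess x k.+1) (excess x k.+2)).
have c3 : slp x k.+1 * ((B - b) * g k) <= `|B - b| * g k.
  apply: (le_trans (ler_norm _)); rewrite (normrM (slp x k.+1)) (normrM (B - b)) (ger0_norm (g0 _ kK)).
  rewrite -[leRHS]mul1r; apply: ler_wpM2r; first by rewrite mulr_ge0 // g0.
  exact: (slope_le1 del_gt0).
by move: c1 c2 c3; rewrite -/(slp x k.+1) -!/(S _); lra.
Qed.

Lemma tdist_lyapunov (B : config -> R) (M : R) x : 0 <= B x <= M -> b <= M ->
  let phi := full_fraction R x in
  (phi <= w K /\ `|B x - b| * (1 - w K) <= B x * (w K - phi)) \/
  (w K <= phi /\ `|B x - b| * (1 - phi) <= b * (phi - w K)) ->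
  dar_op B tdist x <= - tdist x + del * (M + K%:R) + (M + K%:R) / (2 * del * n%:R).
Proof.
move=> /andP[B0 BM] bM phi cond; apply: (le_trans (tdist_drift B0)).
have dn0 : 0 < 2 * del * n%:R by rewrite !mulr_gt0.
apply: lerD; last first.
  by apply: ler_wpM2r; [rewrite invr_ge0 ltW|rewrite lerD2r].
have Sge : `|phi - w K| <= sabs del (excess x K).
  by rewrite -excess_full; exact: sabs_ge.
have dg := del_gt0.
have sumw : \sum_(k < K) w k = 1 - w K by rewrite -w_sum big_ord_recr /= addrK.
have suml : \sum_(k < K) level x k = 1 - phi.
  have -> : \sum_(k < K) level x k = \sum_(0 <= k < K) - (tail x k.+1 - tail x k).
    by rewrite big_mkord; apply: eq_bigr => k _; rewrite levelE opprB.
  by rewrite sumrN telescope_sumr // tail0 /phi -(level_full x) levelE tail_max; ring.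
(* [B * level - b * w] splits as [B * (level - w) + (B - b) * w] or as
   [b * (level - w) + (B - b) * level]; the side on which [phi] lies decides which splitting lets
   the gain at level [K] cover the loss. *)
case: cond => [[le H]|[le H]].
  have := @main_bound x (B x) (B x) _ w B0 (fun k _ => w_ge0 k) sumw _.
  move=> /(_ (fun k kK => ltac:(rewrite (level_excess x (ltnW kK)); ring))) Hm.
  apply: (le_trans Hm); have := ler_wpM2l B0 Sge; rewrite ler0_norm; last by lra.
  by have := ler_wpM2r (ltW dg) BM; lra.
have := @main_bound x (B x) b _ (level x) b_ge0 (fun k _ => level_ge0 x k) suml _.
move=> /(_ (fun k kK => ltac:(rewrite (level_excess x (ltnW kK)); ring))) Hm.
apply: (le_trans Hm); have := ler_wpM2l b_ge0 Sge; rewrite ger0_norm; last by lra.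
by have := ler_wpM2r (ltW dg) bM; lra.
Qed.

End TailDistance.

Section Erlang.
Variables (R : realType) (K : nat) (b : R).
Hypothesis b_ge0 : 0 <= b.

Definition poisson_weight (k : nat) : R := b ^+ k / k`!%:R.

(* Stationary law of one link of capacity [K] with constant arrival rate [b]. *)
Definition erlang (k : nat) : R :=
  poisson_weight k / \sum_(i < K.+1) poisson_weight i.

Lemma poisson_weight_ge0 k : 0 <= poisson_weight k.
Proof. by rewrite divr_ge0 // exprn_ge0. Qed.

Lemma poisson_weight_sum_gt0 : 0 < \sum_(i < K.+1) poisson_weight i.
Proof.
rewrite big_ord_recl /= ltr_wpDr //.
  by apply: sumr_ge0 => i _; exact: poisson_weight_ge0.
by rewrite /poisson_weight expr0 fact0 divr1.
Qed.

Lemma erlang_ge0 k : 0 <= erlang k.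
Proof. by rewrite divr_ge0 ?poisson_weight_ge0 // ltW // poisson_weight_sum_gt0. Qed.

Lemma erlang_sum : \sum_(k < K.+1) erlang k = 1.
Proof. by rewrite -mulr_suml divff // gt_eqF // poisson_weight_sum_gt0. Qed.

Lemma erlang_balance k : k.+1%:R * erlang k.+1 = b * erlang k.
Proof.
rewrite /erlang !mulrA; congr (_ / _); rewrite /poisson_weight exprS factS natrM.
have : (k`!)%:R != 0 :> R by rewrite pnatr_eq0 -lt0n fact_gt0.
have : k.+1%:R != 0 :> R by rewrite pnatr_eq0.
by move: (k.+1%:R : R) => z z0 k0; field; rewrite z0 k0.
Qed.

Lemma erlang_le1 : erlang K <= 1.
Proof.
rewrite -erlang_sum big_ord_recr /= lerDr.
by apply: sumr_ge0 => i _; exact: erlang_ge0.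
Qed.

Lemma erlang_lt1 : (0 < K)%N -> erlang K < 1.
Proof.
move=> K0; rewrite -erlang_sum (bigD1 ord_max) //= (bigD1 ord0) /=.
  rewrite ltrDl ltr_wpDr //; first by apply: sumr_ge0 => i _; exact: erlang_ge0.
  by rewrite divr_gt0 ?poisson_weight_sum_gt0 // /poisson_weight expr0 fact0 divr1.
by rewrite -val_eqE /= eq_sym -lt0n.
Qed.

(* The accepted load is the mean number of busy circuits. *)
Lemma erlang_load : b * (1 - erlang K) <= K%:R.
Proof.
have -> : b * (1 - erlang K) = \sum_(k < K) k.+1%:R * erlang k.+1.
  have -> : 1 - erlang K = \sum_(k < K) erlang k.
    by rewrite -erlang_sum big_ord_recr /= addrK.
  by rewrite mulr_sumr; apply: eq_bigr => k _; rewrite erlang_balance.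
apply: le_trans (_ : \sum_(k < K) K%:R * erlang k.+1 <= _).
  by apply: ler_sum => k _; apply: ler_wpM2r; [exact: erlang_ge0|rewrite ler_nat].
rewrite -mulr_sumr -[leRHS]mulr1; apply: ler_wpM2l => //.
by rewrite -erlang_sum big_ord_recl /= lerDr erlang_ge0.
Qed.

End Erlang.

Section FastFinish.
Variable R : realType.

(** At time [2 / kap * ln n] the contraction factor is [1 / n ^ 2], which leaves [G / n]. [G] may
    depend on [K] because [n] is taken large after [K]. *)
Lemma fast_mixing_contract (rho : nat) (alpha kap : R) : 0 < alpha -> 0 < kap ->
  (\forall K \near \oo, exists G : R, \forall n \near \oo,
    exists F : {ffun 'I_n -> 'I_K.+1} -> {ffun 'I_n -> 'I_K.+1} -> R,
      [/\ forall x x', 0 <= F x x' <= G * n%:R, forall x x', x != x' -> 1 <= F x x'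
        & forall x x', cpl_op (fun x => alpha * gain rho (full_fraction R x) * K%:R) F x x'
            <= - kap * F x x']) ->
  fast_mixing rho alpha.
Proof.
move=> a0 k0 H; exists (2 / kap) => eps /andP[e0 e1].
apply: filterS H => K [G HG].
have [n0 Hn0] := nat_bound (G / eps).
apply: filterS2 (nbhs_infty_ge (maxn n0 1)) HG => n /=; rewrite geq_max => /andP[n0n n1] [F [F0 F1 FK]].
have nR : 0 < n%:R :> R by rewrite ltr0n.
have lnn : 0 <= ln n%:R :> R by rewrite ln_ge0 // ler1n.
have BE : (fun x : {ffun 'I_n -> 'I_K.+1} => alpha * gain rho (full_fraction R x) * K%:R)
   = (fun x => arrival rho alpha (full_fraction R x) * K%:R).
  by apply/funext => x; rewrite arrivalE.
rewrite BE in FK; apply: (@dar_tmix_le _ _ _ _ _ _ F kap) => //.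
- move=> x; rewrite arrivalE; apply: mulr_ge0 => //; apply: mulr_ge0; first exact: ltW.
  by rewrite (le_trans ler01) // gain_ge1 // full_fraction01.
- exact: ltW.
- by rewrite mulr_ge0 // divr_ge0 // ltW.
- by move=> x x'; case/andP: (F0 x x').
- move=> x x'; have -> : kap * (2 / kap * ln n%:R) = ln (n%:R ^+ 2) :> R.
    by rewrite lnXn // -mulr_natl; field; rewrite gt_eqF.
  rewrite expRN lnK ?posrE ?exprn_gt0 //.
  rewrite mulrC ler_pdivrMr ?exprn_gt0 //.
  case/andP: (F0 x x') => _ /le_trans; apply.
  have := Hn0 n n0n; rewrite ler_pdivrMr // => le.
  by rewrite expr2 mulrA; apply: ler_wpM2r; [exact: ltW|rewrite mulrC].
Qed.

End FastFinish.

Section Supercritical.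
Variables (R : realType) (rho : nat) (alpha : R).
Hypothesis rho_gt0 : (0 < rho)%N.
Hypothesis alpha_gt1 : 1 < alpha.
Local Notation gain := (@gain R rho).
Local Notation throughput := (@throughput R rho).

(** This [m] is where [throughput] comes back to 1: it is at least 1 up to [m] and decreasing from
    [m] on. *)
Lemma half_fail : exists m : R, [/\ 0 < m, m < 1 & 2 * fail m ^+ rho = 1].
Proof.
have fc : {within `[0, 1], continuous (fun f : R => 2 * fail f ^+ rho)}.
  apply: continuous_subspaceT => f; apply: cvgM; first exact: cvg_cst.
  apply: (@continuous_comp _ _ _ (@fail R) (fun z => z ^+ rho)).
    exact: fail_continuous.
  exact: exprn_continuous.
have f0 : 2 * fail 0 ^+ rho = 0 :> R by rewrite /fail mul0r expr0n gtn_eqF // mulr0.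
have f1 : 2 * fail 1 ^+ rho = 2 :> R.
  have -> : fail 1 = 1 :> R by rewrite /fail; ring.
  by rewrite expr1n mulr1.
have [||m] := @IVT R _ 0 1 1 _ fc => //.
  by rewrite f0 f1 ge_min le_max; apply/andP; split; apply/orP; [left|right]; lra.
rewrite in_itv /= => /andP[m0 m1] E; exists m; split=> //.
  rewrite lt_neqAle m0 andbT; apply/eqP => mE; move: E; rewrite -mE f0; lra.
rewrite lt_neqAle m1 andbT; apply/eqP => mE; move: E; rewrite mE f1; lra.
Qed.

(** Room beyond [m]: the Lyapunov function confines the full fraction only up to an error, and
    [throughput] is known to decrease only past [m]. *)
Lemma overload_point (m : R) : 0 < m -> m < 1 -> 2 * fail m ^+ rho = 1 ->
  exists eta : R, [/\ 0 < eta, m + 2 * eta < 1 & 1 <= alpha * throughput (m + 2 * eta)].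
Proof.
move=> m0 m1 mh; have a1 := alpha_gt1; have a0 : 0 < alpha by lra.
have tm : throughput m = 1 by rewrite /throughput; nra.
have d0 : 0 < 1 - alpha^-1 by rewrite subr_gt0 invf_lt1.
have := @throughput_continuous R rho m; move/cvgrPdist_lt => /(_ _ d0).
case/nbhs_ballP => e /= e0 He.
exists (Num.min (e / 4) ((1 - m) / 4)); set h := Num.min _ _.
have h0 : 0 < h by rewrite lt_min; apply/andP; split; lra.
have h1 : h <= (1 - m) / 4 by rewrite ge_min lexx orbT.
have h2 : h <= e / 4 by rewrite ge_min lexx.
split=> //; first lra.
have : ball m e (m + 2 * h).
  rewrite /ball /= (_ : m - (m + 2 * h) = - (2 * h)); last by ring.
  by rewrite normrN ger0_norm; lra.
move/He => /=; rewrite tm ltr_norml => /andP[_ H].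
rewrite -ler_pdivrMl // mulr1; lra.
Qed.

Lemma erlang_fixpoint (K : nat) (m : R) : (0 < K)%N -> 0 <= m -> m < 1 ->
  1 <= alpha * throughput m ->
  exists f, [/\ m <= f, f < 1 & erlang K (alpha * gain f * K%:R) K = f].
Proof.
move=> K0 m0 m1 tm; have a1 := alpha_gt1; have a0 : 0 < alpha by lra.
have KR : 0 < K%:R :> R by rewrite ltr0n.
have b0 f : 0 <= f <= 1 -> 0 <= alpha * gain f * K%:R.
  by move=> f01; rewrite !mulr_ge0 ?ltW // (lt_le_trans ltr01) // gain_ge1.
(* The fixed-point equation is multiplied by the normalising sum, so that no division enters the
   continuity argument. *)
pose Psi f := poisson_weight (alpha * gain f * K%:R) K
   - f * \sum_(i < K.+1) poisson_weight (alpha * gain f * K%:R) i.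
have pc i : continuous (fun f => poisson_weight (alpha * gain f * K%:R) i).
  move=> f; apply: cvgM; last exact: cvg_cst.
  apply: (@continuous_comp _ _ _ (fun f => alpha * gain f * K%:R) (fun z => z ^+ i)).
    apply: cvgM; last exact: cvg_cst.
    by apply: cvgM; [exact: cvg_cst|exact: gain_continuous].
  exact: exprn_continuous.
have Pc : {within `[m, 1], continuous Psi}.
  apply: continuous_subspaceT => f; apply: cvgB; first exact: pc.
  apply: cvgM; first exact: cvg_id.
  by apply: cvg_big => [|i _]; [exact: add_continuous|exact: pc].
have Z0 f : 0 <= f <= 1 -> 0 < \sum_(i < K.+1) poisson_weight (alpha * gain f * K%:R) i.
  by move=> f01; apply: poisson_weight_sum_gt0; exact: b0.
have PsiE f : 0 <= f <= 1 -> Psi f = (erlang K (alpha * gain f * K%:R) K - f)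
    * \sum_(i < K.+1) poisson_weight (alpha * gain f * K%:R) i.
  by move=> f01; rewrite mulrBl divfK // gt_eqF // Z0.
have m01 : 0 <= m <= 1 by rewrite m0 ltW.
have o01 : 0 <= (1 : R) <= 1 by rewrite ler01 lexx.
(* The accepted load is at most [K], while blocking probability [m] would make it at least [K]; so
   the true one is at least [m]. *)
have Pm : 0 <= Psi m.
  rewrite PsiE //; apply: mulr_ge0; last exact/ltW/Z0.
  rewrite subr_ge0.
  have := erlang_load K (b0 _ m01); set w := erlang _ _ _.
  rewrite throughputE in tm; rewrite mulrAC -[leRHS]mul1r ler_pM2r // => load.
  have g1 := gain_ge1 rho m01; have ag : 0 < alpha * gain m by rewrite mulr_gt0 //; lra.
  have : alpha * gain m * (1 - w) <= alpha * gain m * (1 - m) by lra.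
  by rewrite ler_pM2l //; lra.
have P1 : Psi 1 <= 0.
  rewrite PsiE //; apply: mulr_le0_ge0; last exact/ltW/Z0.
  rewrite subr_le0.
  exact: erlang_le1 (b0 _ o01).
have [|f] := @IVT R Psi m 1 0 (ltW m1) Pc.
  by rewrite ge_min le_max P1 Pm orbT.
rewrite in_itv /= => /andP[mf f1] fE.
have f01 : 0 <= f <= 1 by rewrite f1 (le_trans m0).
have ff : erlang K (alpha * gain f * K%:R) K = f.
  move: fE; rewrite PsiE // => /eqP; rewrite mulf_eq0 [X in _ || X]gt_eqF ?Z0 // orbF.
  by rewrite subr_eq0 => /eqP.
exists f; split=> //; rewrite -ff.
exact: erlang_lt1 (b0 _ f01) K0.
Qed.

(** [p] times the left side equals [- B * (p - q) ^+ 2 + q * (B * q - b * p)]. *)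
Lemma double_cross (B b p q : R) : 0 < p -> 0 <= q -> 0 <= B -> B * q <= b * p ->
  2 * B * q - b * q - B * p <= 0.
Proof.
move=> p0 q0 B0 H; rewrite -(pmulr_rle0 _ p0).
have h1 := mulr_ge0 B0 (sqr_ge0 (p - q)); have h2 := ler_wpM2r q0 H.
by nra.
Qed.

Lemma throughput_gain (K p p' : R) : 0 <= K -> throughput p <= throughput p' ->
  alpha * gain p * K * (1 - p) <= alpha * gain p' * K * (1 - p').
Proof.
move=> K0; rewrite !throughputE => H; have a1 := alpha_gt1.
have aK : 0 <= alpha * K by rewrite mulr_ge0 //; lra.
by have := ler_wpM2l aK H; lra.
Qed.

Lemma gain_crossM (K p p' : R) : 0 <= K -> 0 <= p -> p <= p' -> p' <= 1 ->
  alpha * gain p * K * (1 - p') <= alpha * gain p' * K * (1 - p).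
Proof.
move=> K0 p0 pp' p1; have a1 := alpha_gt1.
have aK : 0 <= alpha * K by rewrite mulr_ge0 //; lra.
by have := ler_wpM2l aK (gain_cross_le rho p0 pp' p1); lra.
Qed.

(* At the fixed point [f] the flow in excess of its stationary value never
   beats the contraction caused by the links whose fullness differs. *)
Lemma flow_condition (K m f phi : R) : 0 < K -> 0 < m -> 2 * fail m ^+ rho = 1 ->
  m <= f -> f < 1 -> throughput f <= 1 -> 0 <= phi <= 1 ->
  let b := alpha * gain f * K in let B := alpha * gain phi * K in
  (phi <= f /\ `|B - b| * (1 - f) <= B * (f - phi)) \/
  (f <= phi /\ `|B - b| * (1 - phi) <= b * (phi - f)).
Proof.
move=> K0 m0 mh mf f1 gf1 phi01 b B; have a1 := alpha_gt1.
have mh' : 1 <= 2 * fail m ^+ rho by rewrite mh.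
have anti (p p' : R) : m <= p -> p <= p' -> p' <= 1 -> throughput p' <= throughput p.
  exact: throughput_anti (ltW m0) mh'.
have f01 : 0 <= f <= 1 by lra.
have aK : 0 <= alpha * K by rewrite mulr_ge0; lra.
have gpos g : 0 <= g <= 1 -> 0 <= alpha * gain g * K.
  by move=> g01; have := ler_wpM2l aK (gain_ge1 rho g01); lra.
have b0 : 0 <= b := gpos f f01; have B0 : 0 <= B := gpos phi phi01.
case/andP: phi01 => p0 p1; clear gpos; have K0' := ltW K0.
have [pf|/ltW fp] := leP phi f; [left|right]; split=> //.
  have [Bb|/ltW bB] := leP B b.
    rewrite ler0_norm; last by lra.
    have : b * (1 - f) <= B * (1 - phi).
      apply: throughput_gain => //; have [mp|pm] := leP m phi; first by apply: anti => //; exact: ltW.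
      (* Below [m], where [throughput] may increase, it is still at least 1 and so at least
         [throughput f]. *)
      apply: (le_trans gf1); apply: throughput_ge1 => //.
      have : fail phi ^+ rho <= fail m ^+ rho; last by lra.
      apply: lerXn2r; rewrite ?nnegrE; [| |apply: fail_le; lra].
        by apply: fail_ge0; rewrite p0.
      by apply: fail_ge0; lra.
    by clear -pf; lra.
  rewrite ger0_norm; last by lra.
  have H : B * (1 - f) <= b * (1 - phi) by apply: gain_crossM => //; exact: ltW.
  have := double_cross (_ : 0 < 1 - phi) (_ : 0 <= 1 - f) B0 H.
  by move=> H2; have : 2 * B * (1 - f) - b * (1 - f) - B * (1 - phi) <= 0; [apply: H2; lra|lra].
have [Bb|/ltW bB] := leP B b.
  rewrite ler0_norm; last by lra.
  have H : b * (1 - phi) <= B * (1 - f) by apply: gain_crossM => //; lra.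
  have := double_cross (_ : 0 < 1 - f) (_ : 0 <= 1 - phi) b0 H.
  by move=> H2; have : 2 * b * (1 - phi) - B * (1 - phi) - b * (1 - f) <= 0; [apply: H2; lra|lra].
rewrite ger0_norm; last by lra.
have : B * (1 - phi) <= b * (1 - f) by apply: throughput_gain => //; exact: anti.
by lra.
Qed.

Theorem fast_mixing_supercritical : fast_mixing rho alpha.
Proof.
have a1 := alpha_gt1; have a0 : 0 < alpha by lra.
have [m [m0 m1 mh]] := half_fail.
have [eta [eta0 mlt mthr]] := overload_point m0 m1 mh.
have [L L0 HL] := gain_lipschitz R rho.
have k20 : 0 < 1 / 2 :> R by lra.
apply: (fast_mixing_contract a0 k20).
exists 1%N => // K /= K0.
have KR : 0 < K%:R :> R by rewrite ltr0n.
have m2 : 0 <= m + 2 * eta by lra.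
have [f [mf f1 fE]] := erlang_fixpoint K0 m2 mlt mthr.
pose M := alpha * L * K%:R.
have aLK : 0 < M by rewrite !mulr_gt0.
have MK : 0 < M + K%:R by lra.
pose b := alpha * gain f * K%:R.
have f01 : 0 <= f <= 1 by lra.
have bM g : 0 <= g <= 1 -> 0 < alpha * gain g * K%:R <= M.
  move=> g01; have g1 := gain_ge1 rho g01; have [gL _] := HL g g g01 g01.
  rewrite !mulr_gt0 //=; last lra.
  by rewrite /M ler_pM2r // ler_pM2l.
have b0 : 0 <= b by have /andP[/ltW] := bM f f01.
pose w := erlang K b.
have wK : w K = f by exact: fE.
have wload : b * (1 - f) <= K%:R by rewrite -wK; exact: erlang_load.
(* The accepted load bounds [alpha * throughput f] by 1, and [alpha > 1]. *)
have gf1 : throughput f <= 1.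
  move: wload; rewrite /b mulrAC -[leRHS]mul1r ler_pM2r // => H.
  have : alpha * throughput f <= 1 by rewrite throughputE; lra.
  have [//|gt] := leP (throughput f) 1.
  have : alpha * 1 < alpha * throughput f by rewrite ltr_pM2l.
  by lra.
(* Smoothing and curvature errors are each kept below [eta / 8], so the drift of [u] is at most
   [eta / 4 - u], hence at most [- eta / 4] once [u >= eta / 2]. On [u < eta] the full fraction
   exceeds [m + eta], where [throughput] decreases. *)
pose del := eta / (8 * (M + K%:R)).
have del0 : 0 < del by rewrite divr_gt0 // mulr_gt0.
have delE : del * (M + K%:R) = eta / 8 by rewrite /del; field; rewrite gt_eqF.
pose C1 := 2 * 1 * (M + K%:R) + 1 * M.
have C10 : 0 <= C1 by rewrite /C1; lra.
have eta4 : 0 < eta / 4 by rewrite divr_gt0.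
have eta12 : eta / 2 < eta by rewrite ltr_pdivrMr // ltr_pMr // ltr1n.
have [A A0 [n0 Hn0]] := @fast_lyapunov R K 1 (eta / 4) (eta / 4) (eta / 2) eta C1 (M + K%:R)
  ltr01 (ltW eta4) eta4 eta12 C10 (ltW MK).
have [n1 Hn1] := nat_bound (8 * (M + K%:R) / (2 * del * eta)).
exists (K%:R * (2 * (1 + expR (A * (K%:R * (1 + del) - eta))))).
exists (maxn (maxn n0 n1) 1) => // n /=; rewrite !geq_max => /andP[/andP[n0n n1n] n_gt0].
have nR : 0 < n%:R :> R by rewrite ltr0n.
have {}Hn1 := Hn1 n n1n.
pose B (x : {ffun 'I_n -> 'I_K.+1}) := alpha * gain (full_fraction R x) * K%:R.
have phi01 x : 0 <= @full_fraction R K n x <= 1 by exact: full_fraction01.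
have B01 x : 0 <= B x <= M by have /andP[/ltW ? ?] := bM _ (phi01 x); apply/andP.
have B0 x : 0 <= B x by case/andP: (B01 x).
pose u := @tdist R K n del w.
have w0 k : 0 <= w k by exact: erlang_ge0.
have ws : \sum_(k < K.+1) w k = 1 by exact: erlang_sum.
have wb k : (k < K)%N -> k.+1%:R * w k.+1 = b * w k by move=> _; exact: erlang_balance.
have mh' : 1 <= 2 * fail m ^+ rho by rewrite mh.
have Lu x : dar_op B u x <= - u x + eta / 4.
  apply: (le_trans (@tdist_lyapunov R K n del w del0 n_gt0 w0 ws b b0 wb B M x (B01 x) _ _)).
  - by have /andP[] := bM f f01.
  - have mf' : m <= f by clear -mf eta0; lra.
    by rewrite wK; exact: (flow_condition KR m0 mh mf' f1 gf1 (phi01 x)).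
  - have -> : eta / 4 = eta / 8 + eta / 8 by field.
    have pn : 0 < 2 * del * n%:R by rewrite mulr_gt0 // mulr_gt0.
    have pe : 0 < 2 * del * eta by rewrite mulr_gt0 // mulr_gt0.
    rewrite -addrA lerD2l delE lerD2l ler_pdivrMr //.
    move: Hn1; rewrite ler_pdivrMr // => H.
    have -> : eta / 8 * (2 * del * n%:R) = n%:R * (2 * del * eta) / 8 by ring.
    by rewrite ler_pdivlMr //; clear -H; lra.
have u0 x : 0 <= u x by apply: sumr_ge0 => k _; apply/ltW; exact: sabs_gt0.
have uphi x : `|full_fraction R x - f| <= u x by rewrite -wK; exact: tdist_full.
pose D := @hsum R K n (fun i : nat => i%:R).
have Hl (k : nat) (_ : (k < K)%N) := natr_lip R k.
have contr := Hn0 n n0n n_gt0 B D u B0.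
exists (fun x x' => D x x' * ((1 + expR (A * (u x - eta))) + (1 + expR (A * (u x' - eta))))).
have T1 x : 1 <= 1 + expR (A * (u x - eta)) by rewrite lerDl expR_ge0.
have D0 x x' : 0 <= D x x' by exact: hsum_ge0.
split.
- move=> x x'; apply/andP; split; first by rewrite mulr_ge0 // addr_ge0 // (le_trans ler01).
  have uU y : u y <= K%:R * (1 + del) by apply: tdist_le.
  pose T := 1 + expR (A * (K%:R * (1 + del) - eta)).
  have TU y : 1 + expR (A * (u y - eta)) <= T.
    by rewrite lerD2l ler_expR; apply: ler_wpM2l => //; rewrite lerD2r.
  have DU : D x x' <= K%:R * n%:R by exact: ell1_le.
  have -> : K%:R * (2 * T) * n%:R = K%:R * n%:R * (T + T) by ring.
  have X0 : 0 <= (1 + expR (A * (u x - eta))) + (1 + expR (A * (u x' - eta))).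
    by rewrite addr_ge0 // (le_trans ler01).
  exact: ler_pM (D0 x x') X0 DU (lerD (TU x) (TU x')).
- move=> x x' xx'; have := @hsum_ge1 R K n _ (@natr_homo R) 1 Hl x x' xx'.
  rewrite -/(D x x') => D1; apply: le_trans (_ : 1 * 1 <= _); first by rewrite mulr1.
  apply: ler_pM => //; by apply: (le_trans (T1 x)); rewrite lerDl (le_trans ler01).
- move=> x x'.
  apply: contr => //.
  + move=> y y' uy uy'; rewrite mulN1r.
    apply: (@ell1_contract R K n B (fun z => u z < eta)) => //.
    * move=> z z' uz uz' _ zz'; apply: throughput_gain; first exact: ltW.
      apply: (throughput_anti (ltW m0) mh') => //.
        by have uz2 : u z' < eta := uz'; have := uphi z'; rewrite ler_norml => /andP[h1 h2]; clear -uz2 h1 mf eta0; lra.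
      by case/andP: (phi01 z).
    * move=> z z' zz'; apply: gain_crossM; [exact: ltW| |exact: ltW|].
        by case/andP: (phi01 z).
      by case/andP: (phi01 z').
  + move=> y y'; apply: (@cpl_abs_hsum R K n _ (@natr_homo R) 1 (lexx _) Hl B M M y y') => //.
      exact: ltW.
    apply: le_trans (_ : M * (n%:R * `|full_fraction R y - full_fraction R y'|) <= _); last first.
      rewrite ler_pM2l //.
      exact: (full_fraction_lip _ _ n_gt0 (@natr_homo R) Hl).
    have -> : B y - B y' = alpha * K%:R * (gain (full_fraction R y) - gain (full_fraction R y')).
      by rewrite /B; ring.
    have aK : 0 < alpha * K%:R by rewrite mulr_gt0.
    rewrite normrM gtr0_norm //; have [_ H] := HL _ _ (phi01 y) (phi01 y').
    have := ler_wpM2l (ltW aK) H; rewrite /M => H'.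
    by have := ler_wpM2l (ltW nR) H'; lra.
  + by move=> y j; exact: tdist_up.
  + by move=> y l j; exact: tdist_dn.
  + by move=> y; rewrite lerD2r; case/andP: (B01 y).
  + by move=> y; have := Lu y; have := u0 y; lra.
  + by move=> y uy; have := Lu y; lra.
Qed.
End Supercritical.

(** * Fast mixing below the critical load *)

Section Weights.
Variables (R : realType) (K k0 : nat) (W e z : R).
Hypotheses (W_ge1 : 1 <= W) (e_ge0 : 0 <= e) (z_ge0 : 0 <= z).

(** Past [k0] the increments are [e * z ^+ i], a geometric growth that departures at rate
    [k >= k0 >= B * z] still dominate. The cap [W] bounds what a single arrival can add to the
    distance. *)
Definition weight (k : nat) : R := Num.min W (1 + e * \sum_(i < k - k0) z ^+ i).
Definition cumweight (i : nat) : R := \sum_(k < i) weight k.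

Let geo_ge0 m : 0 <= \sum_(i < m) z ^+ i.
Proof. by apply: sumr_ge0 => i _; exact: exprn_ge0. Qed.

Lemma weight_le k : weight k <= W.
Proof. by rewrite ge_min lexx. Qed.

Lemma weight_ge1 k : 1 <= weight k.
Proof. by rewrite le_min W_ge1 lerDl mulr_ge0. Qed.

Lemma weight_low k : (k <= k0)%N -> weight k = 1.
Proof.
move=> kk; rewrite /weight (eqP (_ : (k - k0)%N == 0)%N) ?subn_eq0 //.
by rewrite big_ord0 mulr0 addr0; exact/min_idPr.
Qed.

Lemma weight_mono k : weight k <= weight k.+1.
Proof.
rewrite /weight le_min ge_min lexx /= ge_min; apply/orP; right.
rewrite lerD2l; apply: ler_wpM2l => //.
have [kk|kk] := leqP k0 k; last first.
  have -> : (k - k0)%N = 0%N by lia.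
  by have -> : (k.+1 - k0)%N = 0%N by lia.
by rewrite subSn // big_ord_recr /= lerDl exprn_ge0.
Qed.

(** The growth of the weight under arrivals is paid by departures and by half of the weight; the
    other half is left as contraction. *)
Lemma weight_step k (B : R) : 0 <= B -> B * e <= 2^-1 -> B * z <= k0%:R ->
  B * (weight k.+1 - weight k) <= k%:R * (weight k - weight k.-1) + 2^-1 * weight k.
Proof.
move=> B0 Be Bz; have w1 := weight_ge1 k.
have d0 : 0 <= weight k - weight k.-1.
  by case: k {w1} => [|k]; [rewrite subrr|rewrite subr_ge0 weight_mono].
have kd : 0 <= k%:R * (weight k - weight k.-1) by rewrite mulr_ge0.
have [lt|ge] := ltnP k k0.
  have E0 : weight k = 1 by apply: weight_low; exact: ltnW.
  have E1 : weight k.+1 = 1 by exact: weight_low.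
  by rewrite E0 in kd *; rewrite E1; lra.
pose v m : R := 1 + e * \sum_(i < m) z ^+ i.
have wE j : weight (k0 + j) = Num.min W (v j) by rewrite /weight addKn.
have vS j : v j.+1 - v j = e * z ^+ j by rewrite /v big_ord_recr /=; ring.
have [j kE] : exists j, k = (k0 + j)%N by exists (k - k0)%N; lia.
have [WS|vW] := leP W (v j).
  have wk : weight k = W by rewrite kE wE; exact/min_idPl.
  have := weight_le k.+1; rewrite wk => h.
  have : B * (weight k.+1 - W) <= 0 by rewrite mulr_ge0_le0 // subr_le0.
  by rewrite wk in kd; lra.
have wk : weight k = v j by rewrite kE wE; apply/min_idPr/ltW.
have wk1 : weight k.+1 - weight k <= e * z ^+ j.
  by rewrite -vS wk kE -addnS wE lerD2r ge_min lexx orbT.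
apply: (le_trans (ler_wpM2l B0 wk1)).
case: j => [|j] in kE vW wk wk1 *.
  by rewrite expr0 mulr1; lra.
have wkp : e * z ^+ j <= weight k - weight k.-1.
  by rewrite -vS wk kE addnS /= wE lerD2l lerN2 ge_min lexx orbT.
have := ler_wpM2l (ler0n R k) wkp.
have ez : 0 <= e * z ^+ j by rewrite mulr_ge0 // exprn_ge0.
have kk0 : B * z <= k%:R by rewrite (le_trans Bz) // ler_nat.
have := ler_wpM2r ez kk0; rewrite exprS; lra.
Qed.

(** Bernoulli's inequality for each power of [z] bounds the geometric sum below by a quadratic
    polynomial. That suffices to reach [W] over a stretch of order [K] when [e] is of order
    [1 / K]. *)
Lemma weight_top k : (k0 <= k)%N -> 1 <= z ->
  W <= 1 + e * (k - k0)%:R * (1 + (z - 1) * ((k - k0)%:R - 1) / 2) -> weight k = W.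
Proof.
move=> kk z1 H; apply/min_idPl; apply: (le_trans H); rewrite lerD2l -mulrA.
apply: ler_wpM2l => //; elim: (k - k0)%N => [|m IH]; first by rewrite big_ord0 mul0r.
rewrite big_ord_recr /=.
have : 1 + m%:R * (z - 1) <= z ^+ m.
  elim: {IH} m => [|m IHm]; first by rewrite expr0 mul0r addr0.
  have mS : m.+1%:R = m%:R + 1 :> R by rewrite natr1.
  rewrite exprS mS; have m0 := ler0n R m; have z0 : 0 <= z by lra.
  have := ler_wpM2l z0 IHm.
  have : 0 <= m%:R * (z - 1) * (z - 1) by rewrite !mulr_ge0 // subr_ge0.
  by lra.
have mS : m.+1%:R = m%:R + 1 :> R by rewrite natr1.
by move: IH; set g := \sum_(i < m) _; rewrite mS; lra.
Qed.

Lemma cumweight_homo : {homo cumweight : i i' / (i <= i')%N >-> i <= i'}.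
Proof.
move=> i i' ii'; rewrite /cumweight -!(big_mkord xpredT weight) (big_nat_widen _ _ _ _ _ ii') /=.
rewrite !big_mkord big_mkcond; apply: ler_sum => k _.
by case: ifP => _ //; rewrite (le_trans ler01) // weight_ge1.
Qed.

Lemma cumweightS i : cumweight i.+1 - cumweight i = weight i.
Proof. by rewrite /cumweight big_ord_recr /= addrAC subrr add0r. Qed.

Lemma cumweight_lip i : 1 <= cumweight i.+1 - cumweight i <= W.
Proof. by rewrite cumweightS weight_ge1 weight_le. Qed.

End Weights.

Lemma only_top (i i' K : nat) : (i <= i')%N -> (i' < K.+1)%N ->
  (i == K) && (i' != K) = false.
Proof. by case: eqP => //; case: eqP => //; lia. Qed.

Lemma minnS_top (i K : nat) : (K <= i)%N -> (i < K.+1)%N -> minn i.+1 K = i.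
Proof. by lia. Qed.

Section WeightedContraction.
Variables (R : realType) (K n k0 : nat) (W e z : R).
Notation config := {ffun 'I_n -> 'I_K.+1}.
Implicit Types (x y : config).
Hypotheses (W_ge1 : 1 <= W) (e_ge0 : 0 <= e) (z_ge0 : 0 <= z).
Hypotheses (K_gt0 : (0 < K)%N) (n_gt0 : (0 < n)%N).
Local Notation w := (weight k0 W e z).
Local Notation H := (cumweight k0 W e z).
Hypothesis w_top : w K.-1 = W.

Let Hm := cumweight_homo k0 W_ge1 e_ge0 z_ge0.
Let Hl (k : nat) (kK : (k < K)%N) := cumweight_lip k0 W_ge1 e_ge0 z_ge0 k.

(** The distance is the sum of the weights of the edges between the two positions. Each edge decays
    at rate 1/2 by [weight_step]; if just one copy is full, shared arrivals also remove the top
    weight [W] at rate [B]. *)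
Lemma common_drift_le (B : R) (i i' : 'I_K.+1) : 0 <= B -> B * e <= 2^-1 ->
  B * z <= k0%:R -> (i <= i')%N ->
  B * (hdist H (inc i) (inc i') - hdist H i i') + dec_drift H i i' <=
    - (2^-1 * hdist H i i') - B * W * ((i' == K :> nat) && (i != K :> nat))%:R.
Proof.
move=> B0 Be Bz; rewrite leq_eqVlt => /orP[/eqP/val_inj ->|ii'].
  have h0 (a : nat) : hdist H a a = 0 by rewrite /hdist subrr normr0.
  rewrite /dec_drift andbN big1; last by move=> l _; rewrite !h0 subrr.
  by rewrite !h0 /= mulr0n; lra.
have iK' := ltn_ord i'; have iK : (i < K)%N by lia.
rewrite dec_driftE ?(ltnW ii') //.
have hd (a b : nat) : (a <= b)%N -> hdist H a b = H b - H a.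
  by move=> ab; rewrite /hdist distrC ger0_norm // subr_ge0; exact: Hm.
have inci : inc i = i.+1 :> nat by rewrite val_inc; exact/minn_idPl.
have ii2 : (inc i <= inc i')%N by rewrite !val_inc; lia.
rewrite (hd _ _ ii2) (hd _ _ (ltnW ii')) inci.
(* [Phi] is the drift of an edge chain killed at the boundary. *)
pose wt k := if (k < K)%N then w k else 0.
pose Phi (t : nat) := B * wt t - t%:R * w t.-1.
have Hpred (t : nat) : t%:R * (H t.-1 - H t) = - (t%:R * w t.-1).
  case: t => [|t]; first by rewrite !mul0r oppr0.
  by rewrite /= -(cumweightS k0 W e z t); ring.
have Hinc' : H (inc i') - H i' = wt i'.
  rewrite val_inc /wt; case: ltnP => lt; first by rewrite (minn_idPl lt) cumweightS.
  by rewrite (minn_idPr _) ?(leqW lt) // (_ : (i' : nat) = K) ?subrr //; lia.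
have -> : B * (H (inc i') - H i.+1 - (H i' - H i)) +
   (i'%:R * (H i'.-1 - H i') - i%:R * (H i.-1 - H i)) = Phi i' - Phi i.
  rewrite !Hpred /Phi -Hinc' /wt iK -(cumweightS k0 W e z i); ring.
have stepP (t : nat) : (t < K.-1)%N -> Phi t.+1 - Phi t <= - (2^-1 * w t).
  move=> tK; rewrite /Phi /wt; have -> : (t < K)%N by lia.
  have -> : (t.+1 < K)%N by lia.
  have := weight_step W_ge1 e_ge0 z_ge0 t B0 Be Bz.
  have tS : t.+1%:R = t%:R + 1 :> R by rewrite natr1.
  by rewrite tS /=; lra.
have low (t : nat) : (i + t <= K.-1)%N -> Phi (i + t)%N - Phi i <= - (2^-1 * (H (i + t)%N - H i)).
  elim: t => [|t IH] le; first by rewrite addn0 !subrr mulr0 oppr0.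
  rewrite addnS in le *; have := IH (ltnW le); have := stepP _ le.
  by have := cumweightS k0 W e z (i + t); lra.
have [iK2|iK2] := eqVneq (i' : nat) K; last first.
  rewrite /= mulr0 subr0; have := low (i' - i)%N; rewrite subnKC ?(ltnW ii') //.
  by apply; move/eqP: iK2; lia.
have -> : (i != K :> nat) by apply/eqP; lia.
rewrite /= mulr1; have := low (K.-1 - i)%N; have -> : (i + (K.-1 - i) = K.-1)%N by lia.
move=> /(_ (leqnn _)); rewrite iK2.
have top : Phi K - Phi K.-1 <= - (2^-1 * w K.-1) - B * W.
  rewrite /Phi /wt ltnn; have -> : (K.-1 < K)%N by lia.
  have KE : K%:R = K.-1%:R + 1 :> R by rewrite natr1 prednK.
  have wm : w K.-1.-1 <= w K.-1.
    by case: K.-1 => [//|k]; exact: (weight_mono k0 W_ge1 e_ge0 z_ge0).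
  have := ler_wpM2l (ler0n R K.-1) wm; rewrite KE w_top.
  have := weight_ge1 k0 W_ge1 e_ge0 z_ge0 K.-1; rewrite w_top; lra.
have := cumweightS k0 W e z K.-1; rewrite prednK //; lra.
Qed.

(** A surplus arrival adds at most 1 to the distance, and up to [W] more on the few links past [k0]:
    in all at most [2 * n * (B x - B x')]. This is of the order of the number of links full in one
    copy only, each of which loses [B x' * W] under shared arrivals. *)
Lemma weighted_contract_le (B : config -> R) (c : R) x x' : B x' <= B x ->
  0 <= B x' -> B x' * e <= 2^-1 -> B x' * z <= k0%:R -> 0 <= c ->
  n%:R * `|B x - B x'| <= c * (only_l R x x' + only_l R x' x) ->
  2 * c <= B x' * W ->
  \sum_j (k0 <= x j)%:R <= n%:R / W ->
  cpl_op B (hsum H) x x' <= - 2^-1 * hsum H x x'.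
Proof.
move=> BB B0 Be Bz c0 Bdiff cW few; have W1 := W_ge1; have W0 : 0 < W by lra.
rewrite cpl_hsum; have -> : Num.min (B x) (B x') = B x' by exact/min_idPr.
have common (i i' : 'I_K.+1) : B x' * (hdist H (inc i) (inc i') - hdist H i i') + dec_drift H i i' <=
    - (2^-1 * hdist H i i') - B x' * W * (((i == K :> nat) && (i' != K :> nat))%:R
      + ((i' == K :> nat) && (i != K :> nat))%:R).
  have [ii'|/ltnW ii'] := leqP i i'.
    apply: (le_trans (common_drift_le B0 Be Bz ii')).
    by rewrite (only_top ii') // add0r.
  rewrite (hdistC H (inc i)) (hdistC H i) dec_driftC.
  apply: (le_trans (common_drift_le B0 Be Bz ii')).
  by rewrite (only_top ii') // addr0.
have extra (i i' : 'I_K.+1) : hdist H (inc i) i' - hdist H i i' <= 1 + W * (k0 <= i)%:R.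
  apply: (le_trans (ler_norm _)); apply: (le_trans (ler_dist_dist _ _)).
  have -> : H (inc i) - H i' - (H i - H i') = H (inc i) - H i by ring.
  have [ik|ki] := leqP k0 i.
    by rewrite mulr1; apply: (le_trans (H_inc W_ge1 Hl i)); lra.
  rewrite mulr0 addr0 val_inc; case: (ltnP i K) => iK; last first.
    by rewrite minnS_top // subrr normr0 ler01.
  by rewrite (minn_idPl iK) cumweightS weight_low ?normr1 // ltnW.
apply: le_trans (_ : \sum_j (- (2^-1 * hdist H (x j) (x' j))
   - B x' * W * (((x j == K :> nat) && (x' j != K :> nat))%:R + ((x' j == K :> nat) && (x j != K :> nat))%:R)
   + (B x - B x') * (1 + W * (k0 <= x j)%:R)) <= _).
  apply: ler_sum => j _; rewrite subrr mul0r addr0.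
  have := common (x j) (x' j); have := ler_wpM2l (_ : 0 <= B x - B x') (extra (x j) (x' j)).
  by rewrite subr_ge0 => /(_ BB); lra.
rewrite !big_split /= !sumrN -!mulr_sumr !big_split /= -/(hsum H x x') -/(only_l R x x') -/(only_l R x' x).
rewrite -mulr_sumr.
have -> : \sum_(j < n) 1 = n%:R :> R by rewrite sumr_const card_ord.
have fewW : W * \sum_j (k0 <= x j)%:R <= n%:R by rewrite mulrC -ler_pdivlMr.
have BB' : 0 <= B x - B x' by rewrite subr_ge0.
rewrite ger0_norm // in Bdiff.
have o0 : 0 <= only_l R x x' + only_l R x' x by rewrite addr_ge0 ?only_l_ge0.
have := ler_wpM2l BB' fewW; have := ler_wpM2r o0 cW; lra.
Qed.

End WeightedContraction.

Section ExponentialLoad.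
Variables (R : realType) (K n : nat) (tau : R).
Notation config := {ffun 'I_n -> 'I_K.+1}.
Implicit Types (x y : config).
Hypotheses (tau_gt0 : 0 < tau) (tau_le1 : tau <= 1) (n_gt0 : (0 < n)%N).

Let A (i : nat) : R := tau ^+ (K - i).

Definition expload x : R := (\sum_j A (x j)) / n%:R.

Let nR : 0 < n%:R :> R. Proof. by rewrite ltr0n. Qed.

Let A01 i : 0 <= A i <= 1.
Proof.
have t0 := ltW tau_gt0.
by rewrite /A exprn_ge0 //= exprn_ile1.
Qed.

Lemma expload_upd x j i : expload (upd x j i) - expload x = (A i - A (x j)) / n%:R.
Proof. by rewrite /expload -mulrBl (sum_upd (fun _ (i : 'I_K.+1) => A i)). Qed.

Lemma expload_move x j i : `|expload (upd x j i) - expload x| <= n%:R^-1.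
Proof.
rewrite expload_upd normrM normfV (gtr0_norm nR) ler_pdivrMr // mulVf ?gt_eqF //.
by rewrite ler_norml; have := A01 i; have := A01 (x j); lra.
Qed.

Lemma expload01 x : 0 <= expload x <= 1.
Proof.
rewrite /expload divr_ge0 //=; last by apply: sumr_ge0 => j _; case/andP: (A01 (x j)).
rewrite ler_pdivrMr // mul1r; have -> : n%:R = \sum_(j < n) 1 :> R by rewrite sumr_const card_ord.
by apply: ler_sum => j _; case/andP: (A01 (x j)).
Qed.

Lemma full_le_expload x : full_fraction R x <= expload x.
Proof.
rewrite full_fractionE ler_pM2r ?invr_gt0 //; apply: ler_sum => j _.
by case: eqP => [->|_] /=; [rewrite /A subnn expr0|case/andP: (A01 (x j))].
Qed.

(** By Bernoulli's inequality a link at or above [k0] contributes at least 1/2. *)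
Lemma near_full_expload x (k0 : nat) : (K - k0)%:R * (1 - tau) <= 2^-1 ->
  \sum_j (k0 <= x j)%:R <= 2 * (n%:R * expload x).
Proof.
have t1 := tau_le1; have t0 := tau_gt0.
have bern d : 1 - d%:R * (1 - tau) <= tau ^+ d.
  elim: d => [|d IH]; first by rewrite mul0r subr0 expr0.
  have dS : d.+1%:R = d%:R + 1 :> R by rewrite natr1.
  rewrite exprS dS; have := ler_wpM2l (ltW t0) IH.
  have : 0 <= d%:R * ((1 - tau) * (1 - tau)) by rewrite !mulr_ge0 // subr_ge0.
  by lra.
move=> H; rewrite /expload [n%:R * _]mulrC divfK ?gt_eqF // mulr_sumr.
apply: ler_sum => j _; case: leqP => [le|_] /=; last by rewrite mulr_ge0 //; case/andP: (A01 (x j)).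
have := bern (K - x j)%N; rewrite -/(A (x j)).
have : (K - x j)%:R * (1 - tau) <= (K - k0)%:R * (1 - tau).
  by apply: ler_wpM2r; [rewrite subr_ge0|rewrite ler_nat leq_sub2l].
by lra.
Qed.

(** [A] is geometric, so each jump multiplies it by a constant, except that arrivals at a full link
    are lost. In the departure term [i] is replaced by [K] at a cost of at most 1, because
    [(K - i) * (1 - tau) * tau ^ (K - i) <= 1]. *)
Lemma expload_drift (B : config -> R) x : 0 <= B x ->
  dar_op B expload x <= B x * (tau^-1 - 1) * (expload x - full_fraction R x)
     - K%:R * (1 - tau) * expload x + 1.
Proof.
have t1 := tau_le1; have t0 := tau_gt0.
move=> B0; have small d : d%:R * (1 - tau) * tau ^+ d <= 1 - tau ^+ d.
  elim: d => [|d IH]; first by rewrite !mul0r expr0 subrr.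
  have dS : d.+1%:R = d%:R + 1 :> R by rewrite natr1.
  rewrite exprS dS; have := ler_wpM2l (ltW t0) IH.
  have td : tau * tau ^+ d <= 1 by rewrite -exprS exprn_ile1 // ltW.
  have := mulr_ge0 (_ : 0 <= 1 - tau) (_ : 0 <= 1 - tau * tau ^+ d).
  by rewrite !subr_ge0 => /(_ t1 td); lra.
have Ainc (i : 'I_K.+1) : A (inc i) - A i = (tau^-1 - 1) * (A i - (i == K :> nat)%:R).
  rewrite /A val_inc; have iK := ltn_ord i; case: eqP => [E|ne] /=.
    by rewrite E (minn_idPr _) // subnn expr0 !subrr mulr0.
  have lt : (i < K)%N by lia.
  by rewrite (minn_idPl lt) -(subnSK lt) exprS subr0; field; rewrite gt_eqF.
have Apred (i : 'I_K.+1) : i%:R * (A (inord i.-1 : 'I_K.+1) - A i) <= - (K%:R * (1 - tau)) * A i + 1.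
  have iK := ltn_ord i; rewrite inordK; last exact: leq_ltn_trans (leq_pred _) _.
  have -> : i%:R * (A i.-1 - A i) = - (i%:R * (1 - tau) * A i).
    case: (i : nat) iK => [|k] kK /=; first by rewrite !mul0r oppr0.
    have kK' : (k < K)%N by [].
    by rewrite /A -(subnSK kK') exprS; ring.
  have := small (K - i)%N; rewrite -/(A i) natrB -1?ltnS //.
  by have /andP[a0 _] := A01 i; lra.
have -> : dar_op B expload x = (\sum_j (B x * (A (inc (x j)) - A (x j)) +
    (x j)%:R * (A (inord (x j).-1 : 'I_K.+1) - A (x j)))) / n%:R.
  rewrite mulr_suml; apply: eq_bigr => j _; rewrite expload_upd.
  rewrite -(sum_dec (fun i : 'I_K.+1 => A i)).
  have -> : \sum_(l < K) (expload (dn l j x) - expload x) =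
     (\sum_(l < K) (A (dec l (x j)) - A (x j))) / n%:R.
    by rewrite mulr_suml; apply: eq_bigr => l _; rewrite expload_upd.
  by ring.
rewrite ler_pdivrMr //.
have -> : (B x * (tau^-1 - 1) * (expload x - full_fraction R x)
     - K%:R * (1 - tau) * expload x + 1) * n%:R =
   \sum_j (B x * (tau^-1 - 1) * (A (x j) - (x j == K :> nat)%:R)
     - K%:R * (1 - tau) * A (x j) + 1).
  rewrite !big_split /= sumrN -!mulr_sumr sumrB full_fractionE /expload sumr_const card_ord.
  by field; rewrite !gt_eqF.
apply: ler_sum => j _; rewrite Ainc; have := Apred (x j); lra.
Qed.

(** With [1 - tau = s / K] the drift is at most [s * ((beta - 1) * u - beta * phi) + 2]: one unit
    comes from [expload_drift], one from the excess of [tau^-1 - 1] over [1 - tau]. *)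
Lemma expload_lyapunov (B : config -> R) (s M kap : R) x : (0 < K)%N ->
  0 <= s -> 2 * s <= K%:R -> 2 * s ^+ 2 * M <= K%:R -> tau = 1 - s / K%:R ->
  let beta := B x / K%:R in 0 <= beta <= M ->
  (beta - 1) * expload x - beta * full_fraction R x <= - kap * expload x ->
  dar_op B expload x <= - (s * kap * expload x) + 2.
Proof.
move=> K0 s0 sK sMK tauE beta /andP[beta0 betaM] H.
have KR : 0 < K%:R :> R by rewrite ltr0n.
have BE : B x = beta * K%:R by rewrite divfK // gt_eqF.
clearbody beta.
have sE : K%:R * (1 - tau) = s by rewrite tauE; field; rewrite gt_eqF.
have t2 : 2^-1 <= tau.
  have : s / K%:R <= 2^-1 by rewrite ler_pdivrMr //; lra.
  by rewrite tauE; lra.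
have ti : tau^-1 - 1 <= (1 - tau) * (1 + 2 * (1 - tau)).
  have t0 := tau_gt0; have t1 := tau_le1.
  have -> : tau^-1 - 1 = (1 - tau) * tau^-1 by field; rewrite gt_eqF.
  apply: ler_wpM2l; first lra.
  by rewrite -div1r ler_pdivrMr //; nra.
have /andP[e0 e1] := expload01 x; have fe := full_le_expload x.
have /andP[p0 p1] := full_fraction01 R x.
apply: (le_trans (expload_drift _)); first by rewrite BE mulr_ge0 // ltW.
rewrite sE; set u := expload x in H e0 e1 fe *; set phi := full_fraction R x in H fe p0 p1 *.
have uphi : 0 <= u - phi by lra.
have step1 : B x * (tau^-1 - 1) * (u - phi) <= beta * s * (1 + 2 * (1 - tau)) * (u - phi).
  apply: ler_wpM2r => //; rewrite -sE BE.
  have := ler_wpM2l beta0 (ler_wpM2l (ltW KR) ti).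
  by lra.
have step2 : beta * s * (2 * (1 - tau)) * (u - phi) <= 1.
  have bs : 0 <= beta * s * (2 * (1 - tau)) by rewrite !mulr_ge0 // subr_ge0 tau_le1.
  apply: le_trans (_ : beta * s * (2 * (1 - tau)) * 1 <= _); first by apply: ler_wpM2l => //; lra.
  have t1E : 1 - tau = s / K%:R by rewrite tauE; ring.
  rewrite mulr1 t1E mulrA mulrA ler_pdivrMr // mul1r.
  have s2 : 0 <= s * s by rewrite mulr_ge0.
  have := ler_wpM2l s2 betaM; rewrite expr2 in sMK; lra.
have := ler_wpM2l s0 H; lra.
Qed.

End ExponentialLoad.

Section Subcritical.
Variables (R : realType) (rho : nat) (alpha dl : R).
Hypotheses (alpha_gt0 : 0 < alpha) (dl_gt0 : 0 < dl).
Local Notation gain := (@gain R rho).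
Local Notation throughput := (@throughput R rho).
Hypothesis subcritical : forall f, 0 <= f <= 1 -> alpha * throughput f <= 1 - dl.

(** For [beta >= 1] the bound on [beta * (1 - phi)] gives [- dl], as [u <= 1]. For [beta < 1] either
    few links are full and [beta <= bb], or the blocked arrivals alone give [- alpha * d]. *)
Lemma subcritical_drift (kap d bb beta phi u : R) : 0 <= kap ->
  kap <= dl -> kap <= 1 - bb -> kap <= alpha * d -> 0 <= d ->
  alpha <= beta -> beta * (1 - phi) <= 1 - dl -> (phi <= d -> beta <= bb) ->
  0 <= phi -> phi <= u -> u <= 1 ->
  (beta - 1) * u - beta * phi <= - kap * u.
Proof.
move=> k0 k1 k2 k3 d0 ab bp low p0 pu u1; have u0 : 0 <= u by lra.
have a0 := alpha_gt0.
have ku : kap * u <= kap by rewrite ler_piMr.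
have [b1|b1] := leP 1 beta.
  have : (beta - 1) * u <= beta - 1 by rewrite ler_piMr // subr_ge0.
  by lra.
have [pd|dp] := leP phi d.
  have := ler_wpM2r u0 (low pd); have := ler_wpM2r u0 k2; have : 0 <= beta * phi by rewrite mulr_ge0 //; lra.
  by lra.
have h1 : (beta - 1) * u <= 0 by rewrite mulr_le0_ge0 //; lra.
have h2 : alpha * d <= beta * phi by apply: ler_pM => //; lra.
by lra.
Qed.

Lemma weight_parameters (bb W s : R) : 0 < bb -> bb < 1 -> 1 <= W -> 0 < s ->
  exists2 z : R, 1 <= z & exists K0 : nat, forall K : nat, (K0 <= K)%N -> (0 < K)%N ->
    exists k0 : nat, [/\ bb * K%:R * z <= k0%:R, (K - k0)%:R * (s / K%:R) <= 2^-1
      & weight k0 W (2 * bb * K%:R)^-1 z K.-1 = W].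
Proof.
move=> b0 b1 W1 s0.
(* With [k0 = K - K %/ m], the bound [m >= 2 * s] gives the second condition, and
   [m >= 2 / (1 - bb)] makes [1 - 1 / m > bb], which leaves room for [z > 1] in the first. *)
have [m Hm] := nat_bound (Num.max (2 * s) (2 / (1 - bb))).
have {Hm} := Hm m (leqnn m); rewrite ge_max => /andP[ms mb].
have m0 : 0 < m%:R :> R by apply: lt_le_trans ms; lra.
have mN : (0 < m)%N by rewrite -(ltr0n R).
have mb' : m%:R^-1 < 1 - bb.
  move: mb; rewrite ler_pdivrMr ?subr_gt0 // => mb.
  by rewrite -div1r ltr_pdivrMr //; lra.
pose z := (1 - m%:R^-1) / bb.
have z1 : 1 < z by rewrite ltr_pdivlMr //; lra.
exists z; first exact: ltW.
have [K1 HK1] := nat_bound (16 * bb * m%:R ^+ 2 * W / (z - 1)).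
exists (maxn K1 (6 * m)) => K; rewrite geq_max => /andP[/HK1 K1K K6] K0.
have KR : 0 < K%:R :> R by rewrite ltr0n.
have qm : (K %/ m)%:R * m%:R <= K%:R :> R by rewrite -natrM ler_nat leq_trunc_div.
have mq : K%:R <= ((K %/ m)%:R + 1) * m%:R :> R.
  by rewrite natr1 -natrM ler_nat ltnW // ltn_ceil.
have qK : (K %/ m <= K)%N by exact: leq_div.
have K6R : 6 * m%:R <= K%:R :> R by rewrite -natrM ler_nat.
have q6 : (6 <= K %/ m)%N by rewrite leq_divRL.
pose q := (K %/ m)%:R : R.
have q0 : 0 <= q by exact: ler0n.
exists (K - K %/ m)%N; split.
- have -> : bb * K%:R * z = K%:R - K%:R / m%:R by rewrite /z; field; rewrite !gt_eqF.
  by rewrite natrB // lerD2l lerN2 ler_pdivlMr.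
- rewrite subKn // mulrA ler_pdivrMr //.
  by have := ler_wpM2l q0 ms; rewrite -/q in qm *; lra.
- have e0 : 0 <= (2 * bb * K%:R)^-1 by rewrite invr_ge0 !mulr_ge0 // ltW.
  apply: weight_top => //; last 1 first.
  - have -> : (K.-1 - (K - K %/ m))%:R = q - 1 :> R.
      have -> : (K.-1 - (K - K %/ m) = K %/ m - 1)%N by clear -q6 qK; lia.
      by rewrite natrB // (leq_trans _ q6).
    set r := K%:R in KR mq qm K6R K1K e0 *; set mm := m%:R in m0 mq qm K6R K1K *.
    have h1 : r <= 2 * mm * (q - 2) by rewrite -/q in mq; lra.
    have rm : r / (2 * mm) <= q - 2 by rewrite ler_pdivrMr ?mulr_gt0 //; lra.
    have h2 : (4 * bb * mm)^-1 <= (2 * bb * r)^-1 * (q - 1).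
      have -> : (4 * bb * mm)^-1 = (2 * bb * r)^-1 * (r / (2 * mm)) by field; rewrite !gt_eqF.
      by apply: ler_wpM2l => //; lra.
    have h3 : (z - 1) * (r / (4 * mm)) <= 1 + (z - 1) * (q - 1 - 1) / 2.
      have -> : (z - 1) * (r / (4 * mm)) = (z - 1) * (r / (2 * mm)) / 2 by field; rewrite gt_eqF.
      have := ler_wpM2l (_ : 0 <= z - 1) rm; rewrite subr_ge0 => /(_ (ltW z1)); lra.
    have h4 := ler_pM (_ : 0 <= (4 * bb * mm)^-1) (_ : 0 <= (z - 1) * (r / (4 * mm))) h2 h3.
    have X1 : 0 <= (4 * bb * mm)^-1 by rewrite invr_ge0 !mulr_ge0 // ltW.
    have X2 : 0 <= (z - 1) * (r / (4 * mm)) by rewrite mulr_ge0 ?divr_ge0 ?mulr_ge0 ?subr_ge0 // ltW.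
    have {h4} := h4 X1 X2.
    have zp : 0 < z - 1 by rewrite subr_gt0.
    move: K1K; rewrite ler_pdivrMr // => K1K.
    have : W <= (4 * bb * mm)^-1 * ((z - 1) * (r / (4 * mm))).
      have -> : (4 * bb * mm)^-1 * ((z - 1) * (r / (4 * mm))) = r * (z - 1) / (16 * bb * mm ^+ 2).
        by field; rewrite !gt_eqF.
      by rewrite ler_pdivlMr ?mulr_gt0 ?exprn_gt0 //; move: K1K; clear; lra.
    by move=> WW HH; apply: (le_trans WW); apply: (le_trans HH); rewrite lerDr.
  - by clear -q6 qK; lia.
  - exact: ltW.
Qed.

Theorem fast_mixing_subcritical : fast_mixing rho alpha.
Proof.
have a0 := alpha_gt0; have dl0 := dl_gt0.
have a1 : alpha < 1.
  have f01 : 0 <= (0 : R) <= 1 by rewrite lexx ler01.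
  have := subcritical f01; have := gain_ge1 rho f01.
  rewrite throughputE subr0 mul1r => g1; have : alpha * 1 <= alpha * gain 0 by rewrite ler_pM2l.
  by lra.
have [d [bb [d0 d1 bb0 bb1 low]]] := @low_trap R rho alpha a0 a1.
have [L0 L00 HL0] := gain_lipschitz R rho.
pose L := L0 + 1; have L1 : 1 < L by rewrite /L; lra.
have HL f f' : 0 <= f <= 1 -> 0 <= f' <= 1 -> gain f <= L /\ `|gain f - gain f'| <= L * `|f - f'|.
  move=> f01 f01'; have [H1 H2] := HL0 f f' f01 f01'; split; first by rewrite /L; lra.
  by apply: (le_trans H2); apply: ler_wpM2r => //; rewrite /L; lra.
have L_gt0 : 0 < L by lra.
clearbody L; clear L0 L00 HL0.
pose kap := Num.min dl (Num.min (1 - bb) (alpha * d)).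
have kap0 : 0 < kap by rewrite !lt_min dl0 subr_gt0 bb1 mulr_gt0.
have [kap1 kap2 kap3] : [/\ kap <= dl, kap <= 1 - bb & kap <= alpha * d].
  by rewrite /kap; split; rewrite !ge_min lexx ?orbT.
clearbody kap.
(* Makes [2 * M] equal to [alpha * K * W], which is at most [B x * W]. *)
pose W := 2 * L; have W1 : 1 <= W by rewrite /W; lra.
have W0 : 0 < W by lra.
(* [u < eta / 2] leaves at most a fraction [1 / W] of the links past [k0], and keeps the full
   fraction below [d], where [low] bounds [B] by [bb * K]. *)
pose eta := Num.min W^-1 d.
have eta0 : 0 < eta by rewrite lt_min invr_gt0 W0.
have [eta1 eta2] : eta <= W^-1 /\ eta <= d by rewrite /eta; split; rewrite ge_min lexx ?orbT.
clearbody eta.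
(* The drift of [u] is at most [2 - s * kap * u], hence at most [- 1] from [u0 = 3 / (s * kap)] on;
   this [s] puts [u1 = eta / 2] at [4 / (s * kap)]. *)
pose s := 8 / (kap * eta).
have s0 : 0 < s by rewrite divr_gt0 // mulr_gt0.
have skE : s * kap * eta = 8 by rewrite /s; field; rewrite !gt_eqF.
clearbody s.
have sk0 : 0 < s * kap by rewrite mulr_gt0.
pose u0 := 3 / (s * kap); pose u1 := eta / 2.
have u1eta : u1 <= eta by rewrite /u1 ler_pdivrMr // ler_peMr ?(ltW eta0) // ler1n.
have u1E : u1 = 4 / (s * kap).
  by apply: (mulIf (lt0r_neq0 sk0)); rewrite divfK ?gt_eqF // /u1; lra.
have u01 : u0 < u1 by rewrite u1E ltr_pM2r ?invr_gt0 //; lra.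
pose M0 := alpha * L; have M00 : 0 < M0 by rewrite mulr_gt0.
have [z z1 [K1 HK1]] := weight_parameters bb0 bb1 W1 s0.
have [K2 HK2] := nat_bound (Num.max (2 * s) (2 * s ^+ 2 * M0)).
have k40 : 0 < 2^-1 / 2 :> R by rewrite divr_gt0 ?invr_gt0.
apply: (fast_mixing_contract a0 k40).
exists (maxn 1 (maxn K1 K2)) => // K /=; rewrite !geq_max => /and3P[K0 /HK1/(_ K0) [k0 [bz k0s wtop]] /HK2].
rewrite ge_max => /andP[sK sMK].
have KR : 0 < K%:R :> R by rewrite ltr0n.
pose tau := 1 - s / K%:R.
have sK0 : 0 < s / K%:R by rewrite divr_gt0.
have sK1 : s / K%:R <= 2^-1 by rewrite ler_pdivrMr // [leRHS]mulrC ler_pdivlMr // mulrC.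
have tau0 : 0 < tau by rewrite /tau subr_gt0 (le_lt_trans sK1) // invf_lt1 // ltr1n.
have tau1 : tau <= 1 by rewrite /tau gerBl ltW.
pose e := (2 * bb * K%:R)^-1.
have e0 : 0 <= e by rewrite invr_ge0 !mulr_ge0 // ltW.
have z0 : 0 <= z by exact: le_trans z1.
pose H := cumweight k0 W e z.
have Hm := cumweight_homo k0 W1 e0 z0.
have Hl (k : nat) (kK : (k < K)%N) := cumweight_lip k0 W1 e0 z0 k.
pose M := M0 * K%:R.
have M_gt0 : 0 < M by rewrite mulr_gt0.
pose C1 := 2 * W * (M + K%:R) + W * M.
have C10 : 0 <= C1 by rewrite /C1 addr_ge0 ?mulr_ge0 // ?addr_ge0 // ltW.
have C20 : 0 <= M + K%:R by rewrite addr_ge0 // ltW.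
have h20 : 0 < 2^-1 :> R by rewrite invr_gt0.
have C00 : 0 <= 2 :> R by [].
have [A A0 [n0 Hn0]] := @fast_lyapunov R K 2^-1 2 1 u0 u1 C1 (M + K%:R) h20 C00 ltr01 u01 C10 C20.
pose T := 1 + expR (A * (1 - u1)).
exists (W * K%:R * (T + T)).
exists (maxn n0 1) => // n /=; rewrite geq_max => /andP[n0n n_gt0].
have nR : 0 < n%:R :> R by rewrite ltr0n.
pose B (x : {ffun 'I_n -> 'I_K.+1}) := alpha * gain (full_fraction R x) * K%:R.
have phi01 x : 0 <= @full_fraction R K n x <= 1 by exact: full_fraction01.
have Blow x : alpha * K%:R <= B x.
  by rewrite ler_pM2r // ler_peMr ?(ltW a0) //; exact: gain_ge1.
have B0 x : 0 <= B x by apply: le_trans (Blow x); rewrite mulr_ge0 // ltW.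
have BM x : B x <= M.
  by rewrite ler_pM2r // ler_pM2l //; have [] := HL _ _ (phi01 x) (phi01 x).
pose u := @expload R K n tau.
have u01' x : 0 <= u x <= 1 by exact: expload01.
have phiu x : full_fraction R x <= u x by exact: full_le_expload.
have Lu x : dar_op B u x <= - (s * kap * u x) + 2.
  apply: (@expload_lyapunov _ _ _ tau tau0 tau1 n_gt0 B s M0) => //; first exact: ltW.
    by rewrite divr_ge0 ?(ltW KR) // ler_pdivrMr //; exact: BM.
  have BK : B x / K%:R = alpha * gain (full_fraction R x) by rewrite /B mulfK // gt_eqF.
  rewrite BK; case/andP: (phi01 x) => p0 p1; case/andP: (u01' x) => _ ux1.
  apply: (@subcritical_drift kap d bb) => //; try exact: ltW.
  - by rewrite ler_peMr ?(ltW a0) //; exact: gain_ge1.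
  - by have := subcritical (phi01 x); rewrite throughputE [(1 - _) * _]mulrC mulrA.
  - by move=> pd; apply: low; rewrite p0.
pose D := @hsum R K n H.
have D0 x x' : 0 <= D x x' by exact: hsum_ge0.
have contr := Hn0 n n0n n_gt0 B D u B0 D0.
have Bdiff x x' : n%:R * `|B x - B x'| <= M * (only_l R x x' + only_l R x' x).
  have -> : B x - B x' = alpha * K%:R * (gain (full_fraction R x) - gain (full_fraction R x')).
    by rewrite /B; ring.
  have aK : 0 < alpha * K%:R by rewrite mulr_gt0.
  rewrite normrM gtr0_norm //; have [_ HLx] := HL _ _ (phi01 x) (phi01 x').
  have o1 := only_l_ge0 R x x'; have o2 := only_l_ge0 R x' x.
  have hphi : n%:R * `|full_fraction R x - full_fraction R x'| <= only_l R x x' + only_l R x' x.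
    rewrite -[X in X * _]ger0_norm ?ler0n // -normrM mulrBr full_fraction_diff //.
    by apply: (le_trans (ler_normB _ _)); rewrite !ger0_norm.
  have h1 := ler_wpM2l (ltW M_gt0) hphi; apply: le_trans h1.
  have -> : M * (n%:R * `|full_fraction R x - full_fraction R x'|) =
     n%:R * (alpha * K%:R * (L * `|full_fraction R x - full_fraction R x'|)) by rewrite /M /M0; ring.
  by rewrite ler_pM2l // ler_pM2l.
have contr0 x x' : u x < u1 -> u x' < u1 -> cpl_op B D x x' <= - 2^-1 * D x x'.
  have few y : u y < u1 -> \sum_j (k0 <= y j)%:R <= n%:R / W.
    move=> uy; have tauE : (K - k0)%:R * (1 - tau) <= 2^-1 by rewrite /tau opprB addrCA subrr addr0.
    apply: le_trans (near_full_expload tau0 tau1 n_gt0 y tauE) _.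
    have -> : 2 * (n%:R * expload tau y) = n%:R * (2 * u y) by rewrite /u; ring.
    by rewrite ler_pM2l // (le_trans _ eta1) // mulrC -ler_pdivlMr // ltW.
  have Bsmall y : u y < u1 -> B y <= bb * K%:R.
    move=> uy; rewrite ler_pM2r //; apply: low; case/andP: (phi01 y) => -> _ /=.
    by apply: (le_trans (phiu y)); apply: (le_trans (ltW uy)); exact: le_trans eta2.
  have half y y' : B y' <= B y -> u y < u1 -> u y' < u1 -> cpl_op B D y y' <= - 2^-1 * D y y'.
    move=> BB uy uy'; apply: (@weighted_contract_le R K n k0 W e z W1 e0 z0 K0 n_gt0 wtop B M) => //.
    - apply: le_trans (ler_wpM2r e0 (Bsmall y' uy')) _.
      rewrite (_ : bb * K%:R * e = 2^-1) //; rewrite /e; field; rewrite !gt_eqF //.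
    - by apply: le_trans (ler_wpM2r z0 (Bsmall y' uy')) _.
    - exact: ltW.
    - have -> : 2 * M = alpha * K%:R * W by rewrite /M /M0 /W; ring.
      by apply: ler_wpM2r; [exact: ltW|exact: Blow].
    - exact: few.
  have [BB|/ltW BB] := leP (B x') (B x); first by move=> ux ux'; exact: half.
  move=> ux ux'; rewrite cpl_op_sym; last exact: hsumC.
  by rewrite /D hsumC; exact: half.
exists (fun x x' => D x x' * ((1 + expR (A * (u x - u1))) + (1 + expR (A * (u x' - u1))))).
have T1 x : 1 <= 1 + expR (A * (u x - u1)) by rewrite lerDl expR_ge0.
have TU x : 1 + expR (A * (u x - u1)) <= T.
  rewrite lerD2l ler_expR; apply: ler_wpM2l => //; rewrite lerD2r.
  by case/andP: (u01' x).
split.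
- move=> x x'; apply/andP; split; first by rewrite mulr_ge0 // addr_ge0 // (le_trans ler01).
  have cw (i : 'I_K.+1) : 0 <= H i <= W * K%:R.
    rewrite /H /cumweight; apply/andP; split.
      by apply: sumr_ge0 => k _; rewrite (le_trans ler01) // weight_ge1.
    apply: le_trans (_ : \sum_(k < i) W <= _); first by apply: ler_sum => k _; exact: weight_le.
    rewrite sumr_const card_ord -[X in X <= _]mulr_natr; apply: ler_wpM2l; first exact: ltW.
    by rewrite ler_nat -ltnS.
  have DU : D x x' <= W * K%:R * n%:R.
    by apply: hsum_le => i i'; exact: dist_le_range.
  have -> : W * K%:R * (T + T) * n%:R = W * K%:R * n%:R * (T + T) by ring.
  have X0 : 0 <= (1 + expR (A * (u x - u1))) + (1 + expR (A * (u x' - u1))).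
    by rewrite addr_ge0 // (le_trans ler01).
  exact: ler_pM (D0 x x') X0 DU (lerD (TU x) (TU x')).
- move=> x x' xx'; have := @hsum_ge1 R K n _ Hm W Hl x x' xx'.
  rewrite -/H -/(D x x') => D1; have X1 := T1 x; have X2 := T1 x'.
  apply: le_trans (_ : 1 * 1 <= _); first by rewrite mulr1.
  by apply: ler_pM => //; apply: (le_trans X1); rewrite lerDl (le_trans ler01).
- move=> x x'; apply: contr => //.
  + move=> y y'; apply: (@cpl_abs_hsum R K n _ Hm W W1 Hl B M M y y') => //.
    * exact: ltW.
    * by move=> v; rewrite B0 BM.
    * apply: (le_trans (Bdiff y y')); rewrite ler_pM2l //.
      exact: (only_l_le _ _ Hm Hl).
  + by move=> y j; exact: expload_move.
  + by move=> y l j; exact: expload_move.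
  + by move=> y; rewrite lerD2r.
  + move=> y; apply: (le_trans (Lu y)); have /andP[uy _] := u01' y.
    by rewrite gerDr oppr_le0 mulr_ge0 // ltW.
  + move=> y uy; apply: (le_trans (Lu y)); have := ler_wpM2l (ltW sk0) uy.
    rewrite /u0 mulrCA mulfV ?gt_eqF // mulr1 => su.
    rewrite -lerBrDr -opprD lerN2; exact: su.
Qed.

End Subcritical.

(** * Metastability *)

Section ProductLaw.
Variables (R : realType) (K n : nat) (w : nat -> R) (b : R).
Notation config := {ffun 'I_n -> 'I_K.+1}.
Implicit Types (x y : config) (h : config -> R).
Hypotheses (w_sum : \sum_(k < K.+1) w k = 1)
  (w_balance : forall k, (k < K)%N -> k.+1%:R * w k.+1 = b * w k).

Definition product_law x : R := \prod_j w (x j).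

Lemma upd_upd x j i i' : upd (upd x j i) j i' = upd x j i'.
Proof. by apply/ffunP => k; rewrite !updE; case: eqP. Qed.

Lemma product_law_upd x j i : product_law (upd x j i) * w (x j) = product_law x * w i.
Proof.
rewrite /product_law (bigD1 j) //= [in RHS](bigD1 j) //= updE eqxx.
rewrite (eq_bigr (fun k => w (x k))); first by ring.
by move=> k /negPf kj; rewrite updE kj.
Qed.

(** Swapping [x j] with the independent sample [i] is an involution that preserves the joint
    weight. *)
Lemma product_law_resample h (j : 'I_n) :
  \sum_x product_law x * h x = \sum_x product_law x * \sum_(i < K.+1) w i * h (upd x j i).
Proof.
under [RHS]eq_bigr => x _ do rewrite mulr_sumr.
rewrite pair_bigA /=.
pose s (p : config * 'I_K.+1) := (upd p.1 j p.2, p.1 j).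
have sK : involutive s.
  by case=> x i; rewrite /s /= upd_upd upd_id updE eqxx.
rewrite (reindex_inj (inv_inj sK)) /=.
under [RHS]eq_bigr => p _ do
  rewrite upd_upd upd_id mulrA product_law_upd -mulrA [_ * h _]mulrC mulrA.
rewrite -(pair_bigA _ (fun x (i : 'I_K.+1) => product_law x * h x * w i)) /=.
by apply: eq_bigr => x _; rewrite -mulr_sumr w_sum mulr1.
Qed.

(** Detailed balance: arrivals at [k] cancel against departures at [k + 1], and the arrival at [K]
    has no effect. *)
Lemma site_stationary (f : 'I_K.+1 -> R) :
  \sum_(i < K.+1) w i * (b * (f (inc i) - f i) + \sum_(l < K) (f (dec l i) - f i)) = 0.
Proof.
pose F k := f (inord k).
have fF (i : 'I_K.+1) : f i = F i by rewrite /F inord_val.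
under eq_bigr => i _ do rewrite sum_dec [f (inc _)]fF val_inc [f (inord _)]fF fF
  inordK ?(leq_ltn_trans (leq_pred _)) // mulrDr.
rewrite big_split /= big_ord_recr [X in _ + X]big_ord_recl /=.
rewrite (minn_idPr (leqnSn K)) subrr !mulr0 addr0 mul0r mulr0 add0r -big_split /=.
rewrite big1 // => k _; have kK := ltn_ord k; rewrite (minn_idPl kK) /bump /= add1n.
have := w_balance kK => H.
have -> : w k * (b * (F k.+1 - F k)) = (b * w k) * (F k.+1 - F k) by ring.
by rewrite -H; ring.
Qed.

Lemma product_law_stationary h : \sum_x product_law x * dar_op (fun=> b) h x = 0.
Proof.
rewrite /dar_op; under eq_bigr => x _ do rewrite mulr_sumr.
rewrite exchange_big big1 //= => j _; rewrite (product_law_resample _ j) big1 // => x _.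
rewrite (_ : \sum_i _ = 0) ?mulr0 //.
rewrite -[RHS](site_stationary (fun i => h (upd x j i))); apply: eq_bigr => i _.
rewrite /up /dn !updE eqxx upd_upd; congr (_ * (_ + _)).
by apply: eq_bigr => l _; rewrite upd_upd.
Qed.

Lemma product_law_prod (a : nat -> R) :
  \sum_x product_law x * \prod_j a (x j) = (\sum_(i < K.+1) w i * a i) ^+ n.
Proof.
under eq_bigr => x _ do rewrite -big_split /=.
rewrite -(bigA_distr_bigA (fun (j : 'I_n) (i : 'I_K.+1) => w i * a i)) /=.
by rewrite prodr_const card_ord.
Qed.

Lemma product_law_sum : \sum_x product_law x = 1.
Proof.
have <- : (\sum_(i < K.+1) w i * 1) ^+ n = 1.
  by under eq_bigr => i _ do rewrite mulr1; rewrite w_sum expr1n.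
by rewrite -(product_law_prod (fun=> 1)); apply: eq_bigr => x _; rewrite big1 ?mulr1.
Qed.

End ProductLaw.

Section Domination.
Variables (R : realType) (K n : nat) (b Lam : R).
Notation config := {ffun 'I_n -> 'I_K.+1}.
Implicit Types (x y : config) (h : config -> R).
Hypotheses (n_gt0 : (0 < n)%N) (b_ge0 : 0 <= b) (Lam_gt0 : 0 < Lam)
  (Lam_ge : n%:R * (b + b + K%:R) <= Lam) (Lam_ge1 : 1 <= Lam).
Local Notation S := (dstep (fun=> b) Lam).
Local Notation pi := (@product_law R K n (erlang K b)).

Let nR : 0 < n%:R :> R. Proof. by rewrite ltr0n. Qed.

Definition monotone h := forall x y, (forall j, (x j <= y j)%N) -> h x <= h y.

Lemma monotone_up h x j : monotone h -> h x <= h (up j x).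
Proof.
move=> hm; apply: hm => i; rewrite updE; case: eqP => // ->.
by rewrite val_inc leq_min leqnSn -ltnS ltn_ord.
Qed.

Lemma dstep_monotone h : monotone h -> monotone (S h).
Proof.
move=> hm x y xy; have hxy := hm _ _ xy.
have upxy j : h (up j x) <= h (up j y).
  apply: hm => i; rewrite !updE; case: eqP => // _; rewrite !val_inc.
  by have := xy j; lia.
have dnxy j l : h (dn l j x) <= h (dn l j y).
  apply: hm => i; rewrite !updE; case: eqP => // _; rewrite !val_dec.
  by have := xy j; lia.
rewrite /dstep !dar_opE.
have E (g s : R) : g + Lam^-1 * (s - n%:R * (b + K%:R) * g) =
   Lam^-1 * ((Lam - n%:R * (b + K%:R)) * g + s).
  by field; rewrite gt_eqF.
rewrite !E ler_pM2l ?invr_gt0 //; apply: lerD.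
  apply: ler_wpM2l => //; rewrite subr_ge0; apply: le_trans Lam_ge.
  by rewrite ler_pM2l // -addrA lerDr.
apply: ler_sum => j _; apply: lerD; first exact: ler_wpM2l.
by apply: ler_sum => l _.
Qed.

(** The constant-rate chain contracts the l1 distance at rate 1 for every pair, and averaging the
    second copy over [pi] compares the iterate with the equilibrium mean. *)
Lemma iter_constant_rate h x k : (forall x, 0 <= h x <= 1) ->
  iter k S h x <= \sum_x pi x * h x + (1 - 1 / Lam) ^+ k * (K%:R * n%:R).
Proof.
move=> h01.
pose ell1 := @hsum R K n (fun i : nat => i%:R).
have ws := erlang_sum K b_ge0.
have wb k' : (k' < K)%N -> k'.+1%:R * erlang K b k'.+1 = b * erlang K b k'.
  by move=> _; exact: erlang_balance.
have pi0 y : 0 <= pi y by apply: prodr_ge0 => j _; exact: erlang_ge0.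
have ct y y' : cpl_op (fun=> b) ell1 y y' <= - 1 * ell1 y y'.
  rewrite mulN1r; apply: ell1_contract_le => // H; apply: ler_wpM2l => //.
    by rewrite lerD2l lerN2.
  by rewrite lerD2l lerN2 ltW.
have h1 y y' : h y - h y' <= ell1 y y'.
  have [->|yy'] := eqVneq y y'; first by rewrite subrr hsum_ge0.
  have Hl (i : nat) (_ : (i < K)%N) := natr_lip R i.
  apply: le_trans (hsum_ge1 (@natr_homo R) Hl yy').
  by have := dist_le_range (h01 y) (h01 y'); rewrite ler_norml => /andP[].
have cc := cpl_contract Lam_gt0 (fun=> b_ge0) (fun _ _ => Lam_ge) ct Lam_ge1 h1 k x.
have piS g : \sum_y pi y * S g y = \sum_y pi y * g y.
  rewrite /dstep; under eq_bigr => y _ do rewrite mulrDr mulrCA.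
  by rewrite big_split /= -mulr_sumr product_law_stationary // mulr0 addr0.
have piSk : \sum_y pi y * iter k S h y = \sum_y pi y * h y.
  by elim: {cc} k => // k IH; rewrite iterS piS.
have ps : \sum_y pi y = 1 by exact: product_law_sum.
rewrite -piSk -lerBlDl.
rewrite -[X in X - _]mulr1 -[in X in X - _]ps mulr_sumr -sumrB.
set r := (1 - 1 / Lam) ^+ k in cc *.
have r0 : 0 <= r by rewrite exprn_ge0 // subr_ge0 ler_pdivrMr // mul1r.
apply: le_trans (_ : \sum_y pi y * (r * (K%:R * n%:R)) <= _); last first.
  by rewrite -mulr_suml ps mul1r.
apply: ler_sum => y _; rewrite mulrC -mulrBr; apply: ler_wpM2l => //.
apply: (le_trans (cc y)); apply: ler_wpM2l => //; exact: ell1_le.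
Qed.

Variables (B : config -> R) (nu : config -> R).
Hypotheses (nu_dist : is_distribution nu)
  (nu_stat : forall h, \sum_x nu x * dstep B Lam h x = \sum_x nu x * h x).

(** Comparison of stationary laws: under [nu], a step at rates [B] may be replaced by a step at rate
    [b] as long as the test function stays in [P], and after many such steps the average no longer
    depends on [nu]. [P] stands for the increasing or the decreasing functions. *)
Lemma stationary_le (P : (config -> R) -> Prop) h :
  (forall g, P g -> P (S g)) ->
  (forall g, P g -> forall x, dar_op B g x <= dar_op (fun=> b) g x) ->
  P h -> (forall x, 0 <= h x <= 1) ->
  \sum_x nu x * h x <= \sum_x pi x * h x.
Proof.
move=> PS PB Ph h01; have [nu0 nu1] := nu_dist.
have step g : P g -> \sum_x nu x * g x <= \sum_x nu x * S g x.
  move=> Pg; rewrite -(nu_stat g); apply: ler_sum => x _; apply: ler_wpM2l => //.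
  by rewrite lerD2l ler_pM2l ?invr_gt0 //; exact: PB.
have Pk k : P (iter k S h) by elim: k => // k IH; rewrite iterS; exact: PS.
have hk k : \sum_x nu x * h x <= \sum_x nu x * iter k S h x.
  by elim: k => // k IH; apply: (le_trans IH); rewrite iterS; exact: step.
have r0 : 0 <= 1 - 1 / Lam by rewrite subr_ge0 ler_pdivrMr // mul1r.
have r1 : `|1 - 1 / Lam| < 1.
  by rewrite ger0_norm // ltrBlDr ltrDl divr_gt0.
have bound k : \sum_x nu x * h x <= \sum_x pi x * h x + (1 - 1 / Lam) ^+ k * (K%:R * n%:R).
  have E (a : R) : a = \sum_x nu x * a by rewrite -mulr_suml nu1 mul1r.
  apply: (le_trans (hk k)); rewrite [leRHS]E.
  by apply: ler_sum => x _; apply: ler_wpM2l => //; exact: iter_constant_rate.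
apply/ler_addgt0Pr => e e0.
have C0 : 0 < K%:R * n%:R + 1 :> R by rewrite ltr_wpDl // mulr_ge0.
have /cvgrPdist_lt/(_ (e / (K%:R * n%:R + 1))) := cvg_expr r1.
rewrite divr_gt0 // => /(_ isT) [k _ /(_ k (leqnn k))] /=.
rewrite sub0r normrN ger0_norm ?exprn_ge0 // ltr_pdivlMr // => H.
apply: (le_trans (bound k)); rewrite lerD2l.
by have := exprn_ge0 k r0; lra.
Qed.

(** Chernoff bound with a parameter of either sign: positive [t] asks for [B <= b] and bounds the
    upper tail, negative [t] asks for [b <= B] and bounds the lower one. Under the product law links
    are full independently with probability [erlang K b K]. *)
Lemma full_fraction_tail (t c : R) : t != 0 -> `|t| <= 2^-1 ->
  (forall x, 0 <= t * (b - B x)) ->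
  \sum_x nu x * (t * c <= t * full_fraction R x)%R%:R <=
    expR (n%:R * (erlang K b K * (t + 2 * t ^+ 2) - t * c)).
Proof.
move=> tN0 t2 tB; have [nu0 nu1] := nu_dist.
have [tle tge] : t <= 2^-1 /\ - 2^-1 <= t by move: t2; rewrite ler_norml => /andP[].
pose E x := expR (t * (n%:R * full_fraction R x)).
have E0 x : 0 < E x by exact: expR_gt0.
have phi01 x := @full_fraction01 R K n x.
have En x : E x <= expR n%:R.
  rewrite ler_expR; have /andP[p0 p1] := phi01 x.
  apply: le_trans (_ : 1 * (n%:R * 1) <= _); last by rewrite mul1r mulr1.
  apply: le_trans (_ : 1 * (n%:R * full_fraction R x) <= _).
    by apply: ler_wpM2r; [rewrite mulr_ge0|lra].
  by rewrite !mul1r ler_pM2l.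
(* Scaled because the comparison takes test functions with values in [[0, 1]]. *)
pose h x := expR (- n%:R) * E x.
have h01 x : 0 <= h x <= 1.
  rewrite /h mulr_ge0 ?expR_ge0 //=; have := ler_wpM2l (expR_ge0 (- n%:R)) (En x).
  by rewrite -[X in _ -> _ <= X]expR0 -(addNr n%:R) expRD.
pose P g := monotone (fun x => t * g x).
have dom : \sum_x nu x * h x <= \sum_x pi x * h x.
  apply: (@stationary_le P) => //.
  - move=> g Pg; have := dstep_monotone Pg.
    rewrite /P; suff -> : S (fun x => t * g x) = (fun x => t * S g x) by [].
    by apply/funext => x; rewrite /dstep dar_opZ; ring.
  - move=> g Pg x; rewrite /dar_op; apply: ler_sum => j _; rewrite lerD2r.
    have := monotone_up x j Pg; rewrite -subr_ge0 -mulrBr => H.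
    rewrite -subr_ge0 -mulrBl; have := tB x; have [t0|t0|t0] := ltgtP 0 t.
    + move: H; rewrite (pmulr_rge0 _ t0) => H; rewrite (pmulr_rge0 _ t0) => tb.
      exact: mulr_ge0.
    + move: H; rewrite (nmulr_rge0 _ t0) => H; rewrite (nmulr_rge0 _ t0) => tb.
      exact: mulr_le0.
    + by case/eqP: tN0.
  - move=> x y xy; rewrite /h /E.
    have : full_fraction R x <= full_fraction R y.
      rewrite !full_fractionE ler_pM2r ?invr_gt0 //; apply: ler_sum => j _.
      rewrite ler_nat; have := xy j; have := ltn_ord (y j).
      case: eqP => //= ->; rewrite ltnS => yK Ky.
      by rewrite eqn_leq yK Ky.
    rewrite -(ler_pM2l nR) => H; have [t0|t0] := leP 0 t.
      apply: ler_wpM2l => //; rewrite ler_pM2l ?expR_gt0 // ler_expR.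
      exact: ler_wpM2l.
    rewrite ler_nM2l // ler_pM2l ?expR_gt0 // ler_expR ler_nM2l //.
have ws := erlang_sum K b_ge0.
have mgf : \sum_x pi x * E x <= expR (n%:R * (erlang K b K * (t + 2 * t ^+ 2))).
  have EE x : E x = \prod_j (fun i : nat => expR (t * (i == K)%:R)) (x j).
    by rewrite /E full_fractionE [n%:R * _]mulrC divfK ?gt_eqF // mulr_sumr expR_sum.
  under eq_bigr => x _ do rewrite EE.
  rewrite (@product_law_prod R K n (erlang K b) (fun i : nat => expR (t * (i == K)%:R))) expRM_natl; apply: lerXn2r; rewrite ?nnegrE ?expR_ge0 //.
    by apply: sumr_ge0 => i _; rewrite mulr_ge0 ?erlang_ge0 ?expR_ge0.
  rewrite big_ord_recr /= eqxx mulr1.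
  have -> : \sum_(i < K) erlang K b i * expR (t * (i == K :> nat)%:R) = 1 - erlang K b K.
    rewrite -ws big_ord_recr /= addrK; apply: eq_bigr => i _.
    by rewrite ltn_eqF // mulr0 expR0 mulr1.
  apply: le_trans (expR_ge1Dx _).
  have := ler_wpM2l (erlang_ge0 K b_ge0 K) (expR_le_quad tle); lra.
have nuE : \sum_x nu x * E x <= \sum_x pi x * E x.
  rewrite -(ler_pM2l (expR_gt0 (- n%:R))) !mulr_sumr.
  by move: dom; rewrite /h; under eq_bigr => x _ do rewrite mulrCA; under [in leRHS]eq_bigr => x _ do rewrite mulrCA.
rewrite mulrBr expRD.
apply: le_trans (_ : (\sum_x nu x * E x) * expR (- (n%:R * (t * c))) <= _); last first.
  by apply: ler_wpM2r; [exact: expR_ge0|exact: le_trans nuE mgf].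
rewrite mulr_suml; apply: ler_sum => x _; rewrite -mulrA; apply: ler_wpM2l => //.
rewrite -expRD; case: (leP (t * c)) => [le|_] /=; last exact: expR_ge0.
rewrite -[leLHS]expR0 ler_expR; have := ler_wpM2l (ltW nR) le; lra.
Qed.

End Domination.

Section Tails.
Variables R : realType.

(** Going down from [K], the balance equations show that over [m] steps [erlang] shrinks no faster
    than a geometric sequence of ratio [y], where [b * y < 1]. Total mass 1 then bounds the top
    probability by [(1 - y) / (1 - y ^ m)], with [1 - y = c - e]. *)
Lemma erlang_top_le (b c : R) : 0 < b -> 0 < c -> b * (1 - c) < 1 ->
  exists2 c' : R, c' < c & exists K0 : nat, forall K, (K0 <= K)%N -> (0 < K)%N ->
    erlang K (b * K%:R) K <= c'.
Proof.
move=> b0 c0 bc.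
pose e := Num.min (c / 2) ((1 - b * (1 - c)) / (2 * b)).
have e0 : 0 < e by rewrite lt_min !divr_gt0 ?subr_gt0 ?mulr_gt0.
have [e1 e2] : e <= c / 2 /\ e <= (1 - b * (1 - c)) / (2 * b).
  by rewrite /e; split; rewrite ge_min lexx ?orbT.
have be : b * e <= (1 - b * (1 - c)) / 2.
  by move: e2; rewrite !ler_pdivlMr ?mulr_gt0 //; lra.
pose y := 1 - (c - e).
exists (c - e / 2); first by lra.
have c'0 : 0 < c - e / 2 by lra.
have yb : b * y < 1 by rewrite /y; lra.
have [y0|y0] := leP 0 y; last first.
  exists 0%N => K _ K0; apply: (le_trans (erlang_le1 _ _)); first by rewrite mulr_ge0 // ltW.
  by rewrite /y in y0; lra.
have y1 : `|y| < 1 by rewrite ger0_norm // /y; lra.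
have del0 : 0 < e / 2 / (c - e / 2) by rewrite divr_gt0 // divr_gt0.
have /cvgrPdist_lt/(_ _ del0) [m _ /(_ m (leqnn m))] := cvg_expr y1.
rewrite /= sub0r normrN ger0_norm ?exprn_ge0 // ltr_pdivlMr // => ym.
have geo : (c - e) * \sum_(d < m) y ^+ d = 1 - y ^+ m.
  have -> : c - e = - (y - 1) by rewrite /y; ring.
  by rewrite mulNr -subrX1 opprB.
have [K1 HK1] := nat_bound (m%:R / (1 - b * y)).
exists (maxn K1 m) => K; rewrite geq_max => /andP[/HK1 HK mK] K0.
have KR : 0 < K%:R :> R by rewrite ltr0n.
move: HK; rewrite ler_pdivrMr ?subr_gt0 // => HK.
have bK0 : 0 <= b * K%:R by rewrite mulr_ge0 // ltW.
pose w k := erlang K (b * K%:R) k; pose p := w K.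
have w0 k : 0 <= w k by exact: erlang_ge0.
have step d : (d < m)%N -> y * w (K - d)%N <= w (K - d.+1)%N.
  move=> dm; have dK : (d < K)%N by exact: leq_trans mK.
  have := erlang_balance K (b * K%:R) (K - d.+1); rewrite -/(w _) -/(w _) subnSK // => H.
  rewrite -(ler_pM2l (_ : 0 < b * K%:R)) ?mulr_gt0 // -H mulrA.
  apply: ler_wpM2r => //; rewrite natrB; last exact: ltnW.
  have : d%:R <= m%:R :> R by rewrite ler_nat ltnW.
  by lra.
have low d : (d <= m)%N -> y ^+ d * p <= w (K - d)%N.
  elim: d => [|d IH] dm; first by rewrite expr0 mul1r subn0.
  apply: le_trans (step d dm); rewrite exprS -mulrA.
  by apply: ler_wpM2l => //; apply: IH; exact: ltnW.
have tot : (\sum_(d < m) y ^+ d) * p <= 1.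
  have -> : 1 = \sum_(d < K.+1) w (K - d)%N.
    by rewrite -(erlang_sum K bK0) (reindex_inj rev_ord_inj).
  have -> : (\sum_(d < m) y ^+ d) * p = \sum_(d < K.+1 | (d < m)%N) y ^+ d * p.
    by rewrite mulr_suml (big_ord_widen K.+1 (fun d : nat => y ^+ d * p) (leqW mK)).
  rewrite big_mkcond; apply: ler_sum => d _; case: ifP => [dm|_]; last exact: w0.
  by apply: low; exact: ltnW.
have ce : 0 < c - e by lra.
have := ler_wpM2l (ltW ce) tot; rewrite mulrA geo mulr1 => H.
have p0 : 0 <= p := w0 K.
have : (c - e) / (c - e / 2) * p <= (1 - y ^+ m) * p.
  apply: ler_wpM2r => //; rewrite ler_pdivrMr //; lra.
rewrite mulrAC => H2; have {H2} := le_trans H2 H.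
by rewrite ler_pdivrMr // ler_pM2l.
Qed.

Definition stationary_law (K n : nat) (B nu : {ffun 'I_n -> 'I_K.+1} -> R) (Lam : R) :=
  is_distribution nu /\
  forall h, \sum_x nu x * dstep B Lam h x = \sum_x nu x * h x.

Lemma upper_tail (b c : R) : 0 < b -> 0 < c -> b * (1 - c) < 1 ->
  exists2 dl : R, 0 < dl & exists K0 : nat, forall K n, (K0 <= K)%N -> (0 < K)%N -> (0 < n)%N ->
    forall B nu Lam, @stationary_law K n B nu Lam ->
      1 <= Lam -> n%:R * (b * K%:R + b * K%:R + K%:R) <= Lam ->
      (forall x, B x <= b * K%:R) ->
      \sum_x nu x * (c <= full_fraction R x)%R%:R <= expR (- (dl * n%:R)).
Proof.
move=> b0 c0 bc; have [c' cc' [K0 HK0]] := erlang_top_le b0 c0 bc.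
(* Small enough for the quadratic term [2 * c' * t ^ 2] to use up at most half of the linear gain
   [t * (c - c')]; the absolute value covers either sign of [c']. *)
pose t := Num.min 2^-1 ((c - c') / (4 * (`|c'| + 1))).
have c'1 : 0 < `|c'| + 1 by rewrite ltr_wpDl.
have t0 : 0 < t by rewrite lt_min invr_gt0 ltr0n divr_gt0 ?subr_gt0 ?mulr_gt0.
have [t1 t2] : t <= 2^-1 /\ t <= (c - c') / (4 * (`|c'| + 1)).
  by rewrite /t; split; rewrite ge_min lexx ?orbT.
exists (t * (c - c') / 2); first by rewrite divr_gt0 ?mulr_gt0 ?subr_gt0.
exists K0 => K n KK K1 n0 B nu Lam [nuD nuS] L1 LB Bb.
have bK : 0 <= b * K%:R by rewrite mulr_ge0 // ltW.
have L0 : 0 < Lam by lra.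
have T := @full_fraction_tail R K n (b * K%:R) Lam n0 bK L0 LB L1 B nu nuD nuS t c.
have {T} := T (lt0r_neq0 t0) _ _.
rewrite gtr0_norm // => /(_ t1) T.
apply: le_trans (_ : \sum_x nu x * (t * c <= t * full_fraction R x)%R%:R <= _).
  by apply: ler_sum => x _; rewrite (ler_pM2l t0).
apply: (le_trans (T _)).
  move=> x; apply: mulr_ge0; [exact: ltW|by rewrite subr_ge0].
rewrite ler_expR; have nR : 0 < n%:R :> R by rewrite ltr0n.
have -> : - (t * (c - c') / 2 * n%:R) = n%:R * - (t * (c - c') / 2) by ring.
rewrite ler_pM2l //.
have p := HK0 K KK K1; set pp := erlang _ _ _ in p *.
have h1 : pp * (t + 2 * t ^+ 2) <= c' * (t + 2 * t ^+ 2).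
  by apply: ler_wpM2r => //; rewrite addr_ge0 ?mulr_ge0 ?exprn_ge0 // ltW.
have h2 : 2 * c' * t <= (c - c') / 2.
  move: t2; rewrite ler_pdivlMr ?mulr_gt0 // => t2.
  have := ler_wpM2r (ltW t0) (ler_norm c'); lra.
have := ler_wpM2l (ltW t0) h2; rewrite expr2 in h1 *; lra.
Qed.

Lemma lower_tail (b l : R) : 0 < b -> 1 < b * (1 - l) ->
  exists2 dl : R, 0 < dl & forall K n, (0 < K)%N -> (0 < n)%N ->
    forall B nu Lam, @stationary_law K n B nu Lam ->
      1 <= Lam -> n%:R * (b * K%:R + b * K%:R + K%:R) <= Lam ->
      (forall x, b * K%:R <= B x) ->
      \sum_x nu x * (full_fraction R x <= l)%R%:R <= expR (- (dl * n%:R)).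
Proof.
(* [erlang_load] bounds the probability of a full link below by [1 - 1 / b], for every positive
   [K]. *)
move=> b0 bl; pose p' := 1 - b^-1.
have lp : l < p'.
  have : b^-1 < 1 - l by rewrite -div1r ltr_pdivrMr // mulrC.
  by rewrite /p'; lra.
pose t := Num.min 2^-1 ((p' - l) / 4).
have t0 : 0 < t by rewrite lt_min invr_gt0 ltr0n divr_gt0 ?subr_gt0.
have [t1 t2] : t <= 2^-1 /\ t <= (p' - l) / 4.
  by rewrite /t; split; rewrite ge_min lexx ?orbT.
exists (t * (p' - l) / 2); first by rewrite divr_gt0 ?mulr_gt0 ?subr_gt0.
move=> K n K1 n0 B nu Lam [nuD nuS] L1 LB Bb.
have KR : 0 < K%:R :> R by rewrite ltr0n.
have bK : 0 <= b * K%:R by rewrite mulr_ge0 // ltW.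
have L0 : 0 < Lam by lra.
have tN : - t < 0 by rewrite oppr_lt0.
have T := @full_fraction_tail R K n (b * K%:R) Lam n0 bK L0 LB L1 B nu nuD nuS (- t) l.
have {T} := T (ltr0_neq0 tN) _ _.
rewrite normrN gtr0_norm // => /(_ t1) T.
apply: le_trans (_ : \sum_x nu x * (- t * l <= - t * full_fraction R x)%R%:R <= _).
  by apply: ler_sum => x _; rewrite (ler_nM2l tN).
apply: (le_trans (T _)).
  by move=> x; apply: mulr_le0; [exact: ltW|rewrite subr_le0].
rewrite ler_expR; have nR : 0 < n%:R :> R by rewrite ltr0n.
have -> : - (t * (p' - l) / 2 * n%:R) = n%:R * - (t * (p' - l) / 2) by ring.
rewrite ler_pM2l //.
have pp1 : erlang K (b * K%:R) K <= 1 by exact: erlang_le1.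
have ppl : p' <= erlang K (b * K%:R) K.
  have := erlang_load K bK; rewrite mulrAC -[leRHS]mul1r ler_pM2r // mulrC -ler_pdivlMr //.
  by rewrite div1r /p'; lra.
set pp := erlang _ _ _ in pp1 ppl *.
have := ler_wpM2l (ltW t0) ppl; have := ler_wpM2l (ltW t0) (ler_wpM2l (ltW t0) pp1).
have := ler_wpM2l (ltW t0) t2.
by rewrite expr2; lra.
Qed.

End Tails.

Section Trapped.
Variables (R : realType) (K n : nat) (Lam : R).
Notation config := {ffun 'I_n -> 'I_K.+1}.
Hypothesis Lam_gt0 : 0 < Lam.

Lemma exists_stationary_law (B : config -> R) : (forall x, 0 <= B x) ->
  (forall x, n%:R * (B x + K%:R) <= Lam) -> exists nu, stationary_law B nu Lam.
Proof.
move=> B0 BL.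
have uE h x : ustep (event_rate B) Lam h x = dstep B Lam h x.
  by rewrite /ustep /dstep drift_event_rate.
have [||mu [dmu muS]] := @exists_stationary R _ (event_rate B) Lam Lam_gt0 _ _ [ffun=> ord0].
- by move=> x y _; exact: event_rate_ge0.
- by move=> x; apply: le_trans (BL x); apply: exit_rate_le => // h; exact: drift_event_rate.
exists mu; split=> // h; rewrite -(muS h); apply: eq_bigr => x _; by rewrite uE.
Qed.

Variables (q : config -> config -> R) (B Bt : config -> R) (nu : config -> R) (A : {set config}).
Hypotheses (B_ge0 : forall x, 0 <= B x) (B_le : forall x, n%:R * (B x + K%:R) <= Lam)
  (Bt_ge0 : forall x, 0 <= Bt x) (Bt_le : forall x, n%:R * (Bt x + K%:R) <= Lam)
  (B_agree : forall x, x \in A -> B x = Bt x)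
  (nu_stat : stationary_law Bt nu Lam).

(** On [A] the two chains take the same step, and off [A] their steps differ by at most 1 because
    the iterates stay in [[-1, 0]]; so each step from the stationary [nu] loses at most the mass of
    the complement. The indicator carries a minus sign because [mixture_le] gives upper bounds. *)
Lemma escape_le k :
  \sum_x nu x * iter k (dstep B Lam) (fun y => - (y \in A)%:R) x
    <= - 1 + k.+1%:R * \sum_x nu x * (x \notin A)%:R.
Proof.
have [[nu0 nu1] nuS] := nu_stat.
have bnd i x : - 1 <= iter i (dstep B Lam) (fun y => - (y \in A)%:R) x <= 0.
  elim: i x => [|i IH] x /=; first by case: (x \in A) => /=; apply/andP; split; lra.
  apply/andP; split.
    have <- : dstep B Lam (fun=> - 1) x = - 1 by rewrite dstep_cst.
    by apply: dstep_le => // y; case/andP: (IH y).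
  have <- : dstep B Lam (fun=> 0) x = 0 by rewrite dstep_cst.
  by apply: dstep_le => // y; case/andP: (IH y).
elim: k => [|k IH].
  have -> : - 1 = \sum_x - nu x by rewrite sumrN nu1.
  rewrite mul1r /= -big_split; apply: ler_sum => x _ /=.
  by case: (x \in A) => /=; lra.
have kS : k.+2%:R = k.+1%:R + 1 :> R by rewrite natr1.
rewrite iterS kS mulrDl mul1r addrA; set g := iter k _ _ in IH *.
apply: le_trans (_ : \sum_x nu x * g x + \sum_x nu x * (x \notin A)%:R <= _); last first.
  by rewrite lerD2r.
rewrite -(nuS g) -big_split; apply: ler_sum => x _ /=; rewrite -mulrDr; apply: ler_wpM2l => //.
case: (boolP (x \in A)) => [xA|xA] /=.
  rewrite /dstep /dar_op (B_agree xA) lerDl; exact: ler0n.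
have h1 : dstep B Lam g x <= 0.
  have <- : dstep B Lam (fun=> 0) x = 0 by rewrite dstep_cst.
  by apply: dstep_le => // y; case/andP: (bnd k y).
have h2 : - 1 <= dstep Bt Lam g x.
  have <- : dstep Bt Lam (fun=> - 1) x = - 1 by rewrite dstep_cst.
  by apply: dstep_le => // y; case/andP: (bnd k y).
by lra.
Qed.

Hypotheses (q_ge0 : forall x y, x != y -> 0 <= q x y)
  (q_drift : forall h x, drift q h x = dar_op B h x).

(** The linear bound of [escape_le] is put in geometric form by [k + 1 <= lam * (1 + 1 / lam) ^ k];
    the Poisson average then costs a factor at most [expR 1], as the mean number of steps is at most
    [lam]. *)
Lemma trapped (lam t : R) : 0 <= t -> 1 <= lam -> t * Lam <= lam ->
  1 - (\sum_x nu x * (x \notin A)%:R) * lam * expR 1 <=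
  \sum_x nu x * \sum_y transition q t x y * (y \in A)%:R.
Proof.
move=> t0 lam1 tlam; have lam0 : 0 < lam by lra.
have [[nu0 nu1] nuS] := nu_stat.
set eps := \sum_x nu x * _.
have eps0 : 0 <= eps by apply: sumr_ge0 => x _; exact: mulr_ge0.
have q_le x : \sum_(y | y != x) q x y <= Lam.
  by apply: le_trans (B_le x); exact: exit_rate_le.
have uE : ustep q Lam = dstep B Lam.
  by apply/funext => h; apply/funext => x; rewrite /ustep /dstep q_drift.
have r0 : 0 <= 1 + lam^-1 by rewrite addr_ge0 // invr_ge0 ltW.
have pow k : k.+1%:R <= lam * (1 + lam^-1) ^+ k.
  elim: k => [|k IH]; first by rewrite expr0 mulr1.
  have kS : k.+2%:R = k.+1%:R + 1 :> R by rewrite natr1.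
  have k1 : 1 <= (1 + lam^-1) ^+ k by rewrite exprn_ege1 // lerDl invr_ge0 ltW.
  have -> : lam * (1 + lam^-1) ^+ k.+1 = lam * (1 + lam^-1) ^+ k + (1 + lam^-1) ^+ k.
    by rewrite exprS; field; rewrite gt_eqF.
  by rewrite kS lerD.
have key k : \sum_x nu x * iter k (ustep q Lam) (fun y => - (y \in A)%:R) x <=
    - 1 + eps * lam * (1 + lam^-1) ^+ k.
  rewrite uE; apply: (le_trans (escape_le k)); rewrite lerD2l mulrC -mulrA.
  by apply: ler_wpM2l.
have := mixture_le Lam_gt0 q_ge0 q_le t0 key.
have -> : - (t * Lam) * (1 - (1 + lam^-1)) = t * Lam / lam by ring.
have e1 : expR (t * Lam / lam) <= expR 1 by rewrite ler_expR ler_pdivrMr // mul1r.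
have el : 0 <= eps * lam by rewrite mulr_ge0 // ltW.
have := ler_wpM2l el e1.
have -> : \sum_x nu x * (\sum_y transition q t x y * - (y \in A)%:R) =
   - \sum_x nu x * (\sum_y transition q t x y * (y \in A)%:R).
  rewrite -sumrN; apply: eq_bigr => x _; rewrite -mulrN -sumrN; congr (_ * _).
  by apply: eq_bigr => y _; rewrite mulrN.
by lra.
Qed.

End Trapped.

Section Bistable.
Variables (R : realType) (rho : nat) (alpha f0 : R).
Hypotheses (alpha_gt0 : 0 < alpha) (alpha_lt1 : alpha < 1)
  (f0_01 : 0 <= f0 <= 1) (f0_gt1 : 1 < alpha * throughput rho f0).
Local Notation gain := (@gain R rho).

Theorem slow_mixing_bistable : slow_mixing rho alpha.
Proof.
have a0 := alpha_gt0.
have [d [b [d0 d1 b0 b1 low]]] := @low_trap R rho alpha a0 alpha_lt1.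
have [l [c [bl [bu [[l0 lc c1 bl1 bu1] [bl0 high]]]]]] :=
  high_trap a0 alpha_lt1 f0_01 f0_gt1.
have blu : bl <= bu by have := high l; rewrite lexx (ltW lc) => /(_ isT)/andP[h1]; exact: le_trans.
have bu0 : 0 < bu by exact: lt_le_trans blu.
have c0 : 0 < c by lra.
(* [d' <= l] makes the two traps disjoint. *)
pose d' := Num.min d l.
have d'0 : 0 < d' by rewrite lt_min d0 l0.
have [d'1 d'2] : d' <= d /\ d' <= l by rewrite /d'; split; rewrite ge_min lexx ?orbT.
clearbody d'.
have bd : b * (1 - d') < 1.
  by have := mulr_gt0 b0 d'0; lra.
have [dl1 dl1_0 [K1 HK1]] := upper_tail b0 d'0 bd.
have [dl2 dl2_0 [K2 HK2]] := upper_tail bu0 c0 bu1.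
have [dl3 dl3_0 HK3] := lower_tail bl0 bl1.
have [L L0 HL] := gain_lipschitz R rho.
pose dl := Num.min dl1 (Num.min dl2 dl3).
have dl0 : 0 < dl by rewrite !lt_min dl1_0 dl2_0.
have [dle1 dle2 dle3] : [/\ dl <= dl1, dl <= dl2 & dl <= dl3].
  by rewrite /dl; split; rewrite !ge_min lexx ?orbT.
clearbody dl.
(* Up to time [expR (dl / 2 * n)] about [Lam * expR (dl / 2 * n)] steps are taken, each escaping
   with probability of order [expR (- (dl * n))]; the remaining half of the exponent absorbs [Lam],
   which is linear in [n]. *)
exists (dl / 2); first by rewrite divr_gt0.
move=> eps /andP[e0 e2].
have aux (X : R) : X < 2^-1 - eps -> 2^-1 + eps < 1 - X by move=> ?; lra.
exists (maxn 1 (maxn K1 K2)) => // K /=; rewrite !geq_max => /and3P[K_gt0 KK1 KK2].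
have KR : 0 < K%:R :> R by rewrite ltr0n.
pose M := alpha * L * K%:R.
have M0 : 0 <= M by rewrite !mulr_ge0 // ltW.
have bK : 0 < b * K%:R by rewrite mulr_gt0.
have blK : 0 < bl * K%:R by rewrite mulr_gt0.
have buK : 0 < bu * K%:R by rewrite mulr_gt0.
have bluK : bl * K%:R <= bu * K%:R by rewrite ler_pM2r.
pose L1 := 2 * (M + b * K%:R + bu * K%:R) + K%:R + 1.
have L11 : 1 <= L1 by clear -M0 bK buK KR; rewrite /L1; lra.
have [LM Lb Lbu Lbl] : [/\ M + K%:R <= L1, b * K%:R + b * K%:R + K%:R <= L1,
    bu * K%:R + bu * K%:R + K%:R <= L1 & bl * K%:R + bl * K%:R + K%:R <= L1].
  by clear -M0 bK buK blK bluK KR; rewrite /L1; split; lra.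
clearbody L1.
pose C := 2 * (L1 + 1) * expR 1.
have C0 : 0 < C by rewrite !mulr_gt0 ?expR_gt0 //; lra.
have hd0 : 0 < dl / 2 by rewrite divr_gt0.
have th0 : 0 < (2^-1 - eps) / (2 * C) by apply: divr_gt0; [rewrite subr_gt0|exact: mulr_gt0].
have [A0 HA0] := mul_expRN_small hd0 th0.
have [n1 Hn1] := nat_bound A0.
exists (maxn 1 n1) => // n /=; rewrite geq_max => /andP[n_gt0 /Hn1/HA0 nsmall].
have nR : 0 < n%:R :> R by rewrite ltr0n.
have n1R : 1 <= n%:R :> R by rewrite ler1n.
pose B (x : {ffun 'I_n -> 'I_K.+1}) := arrival rho alpha (full_fraction R x) * K%:R.
have phi01 x : 0 <= @full_fraction R K n x <= 1 by exact: full_fraction01.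
have BE x : B x = alpha * gain (full_fraction R x) * K%:R by rewrite /B arrivalE.
have B0 x : 0 <= B x.
  rewrite BE mulr_ge0 ?mulr_ge0 ?(ltW a0) //.
  by apply: le_trans (gain_ge1 rho (phi01 x)).
have BM x : B x <= M.
  by rewrite BE ler_pM2r // ler_pM2l //; have [] := HL _ _ (phi01 x) (phi01 x).
pose Lam := n%:R * L1.
have Lam1 : 1 <= Lam by rewrite /Lam -[leLHS]mulr1; apply: ler_pM.
have Lam0 : 0 < Lam by exact: lt_le_trans Lam1.
have LamP r : r <= L1 -> n%:R * r <= Lam by move=> rL; rewrite ler_pM2l.
pose tau := expR (dl / 2 * n%:R).
have tau1 : 1 <= tau by rewrite -expR0 ler_expR mulr_ge0 // ltW.
pose lam := tau * Lam.
have lam1 : 1 <= lam by rewrite -[leLHS]mulr1; apply: ler_pM.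
have edl (dd : R) : dl <= dd -> expR (- (dd * n%:R)) <= expR (- (dl * n%:R)).
  by move=> le; rewrite ler_expR lerN2 ler_pM2r.
have small : 2 * expR (- (dl * n%:R)) * lam * expR 1 < 2^-1 - eps.
  have -> : 2 * expR (- (dl * n%:R)) * lam * expR 1 =
      2 * L1 * expR 1 * (n%:R * expR (- (n%:R * (dl / 2)))).
    have E : expR (- (dl * n%:R)) * tau = expR (- (n%:R * (dl / 2))).
      by rewrite -expRD; congr expR; field.
    by rewrite -E /lam /Lam; ring.
  have e1 := expR_gt0 (1 : R).
  have h1 : 2 * L1 * expR 1 <= C by rewrite /C ler_pM2r // ler_pM2l // lerDl.
  have x0 : 0 <= n%:R * expR (- (n%:R * (dl / 2))) by rewrite mulr_ge0 ?expR_ge0.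
  have h2 := ler_wpM2r x0 h1; have h3 := ler_wpM2l (ltW C0) nsmall.
  have h4 : C * ((2^-1 - eps) / (2 * C)) = (2^-1 - eps) / 2 by field; rewrite gt_eqF.
  rewrite h4 in h3; apply: (le_lt_trans h2); apply: (le_lt_trans h3).
  by rewrite ltr_pdivrMr // ltr_pMr ?subr_gt0 // ltr1n.
have persist (Bt nu : _ -> R) (A : {set {ffun 'I_n -> 'I_K.+1}}) :
    (forall x, 0 <= Bt x) -> (forall x, n%:R * (Bt x + K%:R) <= Lam) ->
    (forall x, x \in A -> B x = Bt x) -> stationary_law Bt nu Lam ->
    \sum_x nu x * (x \notin A)%:R <= 2 * expR (- (dl * n%:R)) ->
    forall t, 0 <= t < tau ->
      2^-1 + eps < \sum_x nu x * \sum_y transition (@dar_rate R rho alpha K n) t x y * (y \in A)%:R.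
  move=> Bt0 BtL BBt nuS massA t /andP[t0 tt].
  have BL x : n%:R * (B x + K%:R) <= Lam.
  by apply: LamP; apply: le_trans LM; rewrite lerD2r.
  have tl : t * Lam <= lam by rewrite ler_pM2r // ltW.
  have T := @trapped R K n Lam Lam0 (@dar_rate R rho alpha K n) B Bt nu A B0 BL Bt0 BtL BBt nuS
    (dar_rate_ge0 B0) (fun h x => drift_dar rho alpha h x) lam t t0 lam1 tl.
  apply: lt_le_trans T.
  clearbody lam; have le0 : 0 <= lam * expR 1 by rewrite mulr_ge0 ?expR_ge0 // (le_trans ler01).
  have := ler_wpM2r le0 massA; rewrite !(mulrA _ lam) => H; have {H} := le_lt_trans H small.
  exact: aux.
pose Bt1 x := Num.min (B x) (b * K%:R).
pose Bt2 x := Num.min (Num.max (B x) (bl * K%:R)) (bu * K%:R).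
pose A1 := [set x : {ffun 'I_n -> 'I_K.+1} | full_fraction R x < d']%SET.
pose A2 := [set x : {ffun 'I_n -> 'I_K.+1} | l < full_fraction R x < c]%SET.
have Bt1_0 x : 0 <= Bt1 x by rewrite le_min B0 (ltW bK).
have Bt2_0 x : 0 <= Bt2 x by rewrite le_min le_max B0 (ltW buK).
have Bt1_b x : Bt1 x <= b * K%:R by rewrite ge_min lexx orbT.
have Bt2_b x : bl * K%:R <= Bt2 x <= bu * K%:R.
  by rewrite le_min le_max lexx orbT bluK ge_min lexx orbT.
have Bt1_L x : n%:R * (Bt1 x + K%:R) <= Lam by apply: LamP; apply: le_trans Lb; rewrite lerD2r; apply: le_trans (Bt1_b x) _; rewrite lerDl; exact: ltW.
have Bt2_L x : n%:R * (Bt2 x + K%:R) <= Lam by apply: LamP; apply: le_trans Lbu; rewrite lerD2r; case/andP: (Bt2_b x) => _ H; apply: le_trans H _; rewrite lerDl; exact: ltW.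
have [nu1 nu1S] := exists_stationary_law Lam0 Bt1_0 Bt1_L.
have [nu2 nu2S] := exists_stationary_law Lam0 Bt2_0 Bt2_L.
apply: (@mixing_time_ge R _ (@dar_rate R rho alpha K n) A1 A2 nu1 nu2).
- move=> x; rewrite !inE => xd; rewrite negb_and -!leNgt.
  by rewrite (le_trans (ltW xd)).
- by case: nu1S.
- by case: nu2S.
move=> t tt; split.
- apply: (persist Bt1) => //.
    move=> x; rewrite inE => xd; apply/esym/min_idPl; rewrite BE ler_pM2r //; apply: low.
    by case/andP: (phi01 x) => -> _; rewrite (le_trans (ltW xd)).
  apply: le_trans (_ : \sum_x nu1 x * (d' <= full_fraction R x)%R%:R <= _).
    by apply: ler_sum => x _; rewrite inE -leNgt.
  have LB : n%:R * (b * K%:R + b * K%:R + K%:R) <= Lam by exact: LamP.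
  apply: (le_trans (HK1 K n KK1 K_gt0 n_gt0 Bt1 nu1 Lam nu1S Lam1 LB Bt1_b)).
  by apply: (le_trans (edl _ dle1)); rewrite mulr_natl lerDl expR_ge0.
- apply: (persist Bt2) => //.
    move=> x; rewrite inE => /andP[lx xc].
    have : l <= full_fraction R x <= c by rewrite !ltW.
    move=> /high /andP[h1 h2]; rewrite -(ler_pM2r KR) -BE in h1; rewrite -(ler_pM2r KR) -BE in h2.
    by rewrite /Bt2 (max_idPl h1) (min_idPl h2).
  have [[nu0 _] _] := nu2S.
  apply: le_trans (_ : \sum_x nu2 x * (c <= full_fraction R x)%R%:R +
      \sum_x nu2 x * (full_fraction R x <= l)%R%:R <= _).
    rewrite -big_split; apply: ler_sum => x _ /=; rewrite -mulrDr; apply: ler_wpM2l => //.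
    rewrite inE negb_and -!leNgt.
    by case: (_ <= l); case: (c <= _); rewrite /= ?addr0 ?add0r ?lerDl.
  have LB : n%:R * (bu * K%:R + bu * K%:R + K%:R) <= Lam by exact: LamP.
  have LB' : n%:R * (bl * K%:R + bl * K%:R + K%:R) <= Lam by exact: LamP.
  rewrite mulr_natl mulr2n; apply: lerD.
    apply: le_trans (edl _ dle2); apply: (HK2 K n KK2 K_gt0 n_gt0 Bt2 nu2 Lam) => // x.
    by case/andP: (Bt2_b x).
  apply: le_trans (edl _ dle3); apply: (HK3 K n K_gt0 n_gt0 Bt2 nu2 Lam) => // x.
  by case/andP: (Bt2_b x).
Qed.

End Bistable.

(** * The critical load *)

Section Critical.
Variable R : realType.

(** The tolerance 1/4 is admissible in both statements, and [expR (c * n)] eventually exceeds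
    [C * ln n]. This is what makes the critical value unique. *)
Lemma fast_slow_exclusive rho (alpha : R) : fast_mixing rho alpha -> slow_mixing rho alpha -> False.
Proof.
move=> [C fast] [c c0 slow].
have e1 : 0 < (4^-1 : R) < 1 by apply/andP; split; lra.
have e2 : 0 < (4^-1 : R) < 2^-1 by apply/andP; split; lra.
have th0 : 0 < (2 * (`|C| + 1))^-1 by rewrite invr_gt0 mulr_gt0 // ltr_wpDl.
have [A0 HA0] := mul_expRN_small c0 th0.
have [n0 Hn0] := nat_bound A0.
near \oo => K.
have fK : \forall n \near \oo, (dar_tmix rho alpha 4^-1 K n <= (C * ln n%:R)%:E)%E.
  by near: K; exact: fast e1.
have sK : \forall n \near \oo, ((expR (c * n%:R))%:E <= dar_tmix rho alpha 4^-1 K n)%E.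
  by near: K; exact: slow e2.
near \oo => n.
have n_gt0 : (0 < n)%N by near: n; exact: nbhs_infty_gt.
have nR : 0 < n%:R :> R by rewrite ltr0n.
have An : A0 <= n%:R by apply: Hn0; near: n; exact: nbhs_infty_ge.
have le : expR (c * n%:R) <= C * ln n%:R.
  rewrite -lee_fin; apply: (@le_trans _ _ (dar_tmix rho alpha 4^-1 K n)); by near: n.
have lnn : 0 <= ln n%:R :> R by rewrite ln_ge0 // ler1n.
have lnn' : ln n%:R <= n%:R :> R.
  have := expR_ge1Dx (ln n%:R : R); rewrite lnK ?posrE // => H.
  by apply: le_trans H; rewrite lerDr.
have := HA0 _ An; rewrite expRN ler_pdivrMr ?expR_gt0 // [n%:R * c]mulrC => H.
have X0 := expR_gt0 (c * n%:R); set X := expR _ in le H X0.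
have C1 : 0 < `|C| + 1 by rewrite ltr_wpDl.
have h1 : C * ln n%:R <= (`|C| + 1) * n%:R.
  apply: le_trans (_ : (`|C| + 1) * ln n%:R <= _); last by rewrite ler_pM2l.
  by apply: ler_wpM2r => //; apply: (le_trans (ler_norm C)); rewrite lerDl.
have h2 : (`|C| + 1) * n%:R <= X / 2.
  have -> : X / 2 = (`|C| + 1) * ((2 * (`|C| + 1))^-1 * X) by field; rewrite gt_eqF.
  by rewrite ler_pM2l.
lra.
Unshelve. all: by end_near.
Qed.

Lemma is_critical_unique rho (ac : R) : 0 < ac < 1 -> is_critical rho ac ->
  unique (is_critical rho) ac.
Proof.
move=> /andP[a0 a1] [fast slow]; split=> // x [fast' slow'].
have [ltax|ltxa|//] := ltgtP ac x; exfalso.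
  (* The midpoint of [ac] and [y] is slow for [ac] and fast for [x]. The minimum with 1, like the
     maximum with 0 in the other case, keeps the midpoint in [(0, 1)] for an arbitrary real
     candidate [x]. *)
  pose y := Num.min x 1.
  have ay : ac < y by rewrite lt_min ltax.
  have [yx y1] : y <= x /\ y <= 1 by rewrite /y; split; rewrite ge_min lexx ?orbT.
  have b0 : 0 < (ac + y) / 2 by lra.
  apply: (@fast_slow_exclusive rho ((ac + y) / 2)); first by apply: fast' => //; left; lra.
  by apply: slow => //; apply/andP; split; lra.
pose y := Num.max x 0.
have ya : y < ac by rewrite gt_max ltxa.
have [yx y0] : x <= y /\ 0 <= y by rewrite /y; split; rewrite le_max lexx ?orbT.
have b0 : 0 < (ac + y) / 2 by lra.
apply: (@fast_slow_exclusive rho ((ac + y) / 2)); first by apply: fast => //; left; lra.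
by apply: slow' => //; apply/andP; split; lra.
Qed.

Variable rho : nat.
Hypothesis rho_gt0 : (0 < rho)%N.

Lemma throughput_gt1 : exists2 f : R, 0 <= f <= 1 & 1 < throughput rho f.
Proof.
(* At this point [fail] is below 1/2, so [1 + f - 2 * f * fail f ^+ rho] exceeds 1 for every
   positive [rho]. *)
exists 8^-1; first by apply/andP; split; lra.
have f01 : 0 <= (8^-1 : R) <= 1 by apply/andP; split; lra.
have h0 := fail_ge0 f01; have h1 := fail_le1 (8^-1 : R).
have E : fail (8^-1 : R) = 15 / 64 by rewrite /fail; field.
have : fail (8^-1 : R) ^+ rho <= fail 8^-1.
  rewrite -(prednK rho_gt0) exprS ler_piMr //; exact: exprn_ile1.
by rewrite /throughput [leRHS]E; lra.
Qed.

Lemma is_critical_throughput (m f : R) : 0 <= f <= 1 -> throughput rho f = m -> 1 < m ->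
  (forall f', 0 <= f' <= 1 -> throughput rho f' <= m) -> is_critical rho m^-1.
Proof.
move=> f01 fm m1 mmax; have m0 : 0 < m by lra.
split=> alpha a0 => [[am|a1]|/andP[am a1]].
- have dl0 : 0 < 1 - alpha * m by rewrite subr_gt0 -ltr_pdivlMr // div1r.
  apply: (fast_mixing_subcritical a0 dl0) => f' f01'.
  by have := ler_wpM2l (ltW a0) (mmax f' f01'); lra.
- exact: fast_mixing_supercritical.
- apply: (slow_mixing_bistable a0 a1 f01).
  by rewrite fm -ltr_pdivrMr // div1r.
Qed.

End Critical.

Theorem theorem2 (R : realType) :
  exists alpha_c : nat -> R,
    [/\ forall rho : nat, (1 <= rho)%N ->
          unique (is_critical rho) (alpha_c rho),
        forall rho1 rho2 : nat, (1 <= rho1)%N -> (rho1 < rho2)%N ->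
          alpha_c rho2 < alpha_c rho1
      & forall rho : nat, (1 <= rho)%N -> 0 < alpha_c rho < 1].
Proof.
have ex rho : exists f : R, 0 <= f <= 1 /\
    forall f', 0 <= f' <= 1 -> throughput rho f' <= throughput rho f.
  by have [f f01 fmax] := throughput_max R rho; exists f.
have [fm fmP] := choice ex.
pose m rho := throughput rho (fm rho).
have m1 rho : (1 <= rho)%N -> 1 < m rho.
  move=> rho1; have [f f01 f1] := throughput_gt1 R rho1; apply: (lt_le_trans f1).
  by have [_] := fmP rho; exact.
have ac01 rho : (1 <= rho)%N -> 0 < (m rho)^-1 < 1.
  move=> /m1 m1r; have m0 : 0 < m rho by exact: lt_trans m1r.
  by rewrite invr_gt0 m0 invf_lt1.
exists (fun rho => (m rho)^-1); split=> //.
- move=> rho rho1; apply: is_critical_unique; first exact: ac01.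
  by have [f01 fmax] := fmP rho; apply: (is_critical_throughput rho1 f01) => //; exact: m1.
- move=> rho1 rho2 r1 r12; have r2 : (1 <= rho2)%N by exact: leq_trans (ltnW r12).
  have [M1 M2] := (m1 _ r1, m1 _ r2).
  rewrite ltf_pV2 ?posrE ?(lt_trans ltr01) //.
  have [f01 _] := fmP rho1; have [_ fmax2] := fmP rho2.
  apply: lt_le_trans (fmax2 _ f01).
  move: M1; rewrite /m; set f := fm rho1 in f01 * => M1; case/andP: f01 => f0 f1.
  (* The maximiser for [rho1] is interior, since [throughput] is 1 at 0 and 0 at 1; there [fail]
     lies strictly between 0 and 1, and a larger exponent strictly increases [throughput]. *)
  have fN0 : 0 < f.
    rewrite lt_neqAle f0 andbT; apply: contraTneq M1 => <-.
    by rewrite /throughput mulr0 mul0r addr0 subr0 ltxx.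
  have fN1 : f < 1.
    rewrite lt_neqAle f1 andbT; apply: contraTneq M1 => ->.
    by rewrite throughputE subrr mul0r ltr10.
  rewrite /throughput ltrD2l ltrN2 ltr_pM2l ?mulr_gt0 //.
  have F0 : 0 < fail f by rewrite /fail mulr_gt0 //; lra.
  have F1 : fail f < 1 by rewrite -subr_gt0 failE exprn_gt0 // subr_gt0.
  by rewrite -(subnKC r12) addSnnS exprD gtr_pMr ?exprn_gt0 // exprn_ilt1 ?ltW.
Qed.
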